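(* Let $r\ge 3$, let $M$ be a closed $C^{r+1}$ Riemannian manifold and let $f^t:M\to M$ be a $C^r$ flow with a weak expanding foliation $\mathcal W^{cu}$, with expansion constants $C_u\ge 1$, $0<a_u\le A_u$. Then for every $x\in M$ the universal cover $\widetilde{\mathcal W}^{cu}(x)$ of the leaf $\mathcal W^{cu}(x)$, with the Riemannian metric induced from $M$ (lifted to the universal cover), is Gromov hyperbolic with a hyperbolicity constant $\delta=\delta(C_u,a_u,A_u)$ depending only on $C_u,a_u,A_u$. Moreover, the map $y\mapsto\gamma_y$ for $y\in\mathcal W^u(x)$, where $\gamma_y(t)=f^ty$, $t\ge 0$, canonically identifies $\mathcal W^u(x)$ with the relative Gromov boundary $\partial_*\widetilde{\mathcal W}^{cu}(x)$; that is, $y\mapsto[\gamma_y]$ is a bijection from $\mathcal W^u(x)$ onto $\partial_*\widetilde{\mathcal W}^{cu}(x)$.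
   Context: $M$ is a closed $C^{r+1}$ manifold with a $C^r$ Riemannian metric; the flow $f^t$ is $C^r$ in the sense that its generator $\dot f$ is a $C^r$ vector field, and $\dot f$ is a unit vector field. A foliation $\mathcal W^{cu}$ of $M$ has uniformly $C^r$ leaves if it has an atlas of foliation charts whose plaques are parametrized by $C^r$ maps depending continuously, in the $C^r$ topology, on the transverse parameter. It is a weak expanding foliation for $f^t$ if it has uniformly $C^r$ leaves and its tangent bundle $E^{cu}=T\mathcal W^{cu}$ splits orthogonally and $Df^t$-invariantly as $E^{cu}=E^u\oplus E^c$, with $E^c=\operatorname{span}(\dot f)$, and for all $v\in E^u$, $t\ge 0$, $$C_u^{-1}e^{a_ut}\|v\|\le\|Df^tv\|\le C_ue^{A_ut}\|v\|.$$ In this situation there is a foliation $\mathcal W^u$ tangent to $E^u$ (subfoliating $\mathcal W^{cu}$ and $C^r$ along the leaves of $\mathcal W^{cu}$). The leaves of $\mathcal W^u$ are simply connected, so $\mathcal W^u(x)$ lifts homeomorphically to the universal cover $\widetilde{\mathcal W}^{cu}(x)$, and the flow $f^t$ also lifts; in the statement $y\in \mathcal W^u(x)$ and $\gamma_y$ are understood as lifted to $\widetilde{\mathcal W}^{cu}(x)$ (fixing one lift of $\mathcal W^u(x)$). The lifted orbits of $f^t$ are geodesics. A metric space is $\delta$-hyperbolic if $(x|z)_p\ge\min\{(x|y)_p,(y|z)_p\}-\delta$ for all points $x,y,z,p$, where $(x|y)_p=\tfrac12(d(x,p)+d(y,p)-d(x,y))$. The Gromov boundary $\partial\mathcal X$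 of a proper geodesic hyperbolic space $\mathcal X$ is the set of classes $[\gamma]$ of geodesic rays, two rays being equivalent if they stay at bounded distance. All backward-orbit rays $t\mapsto f^{-t}y$, $t\ge0$, in $\widetilde{\mathcal W}^{cu}(x)$ define one common point $*\in\partial\widetilde{\mathcal W}^{cu}(x)$; the relative Gromov boundary is $\partial_*\widetilde{\mathcal W}^{cu}(x)=\partial\widetilde{\mathcal W}^{cu}(x)\setminus\{*\}$. *)

(* Defs.v *)
From HB Require Import structures.
From mathcomp Require Import all_boot all_order all_algebra.
From mathcomp Require Import all_classical all_reals all_analysis.

Set Implicit Arguments.
Unset Strict Implicit.
Unset Printing Implicit Defensive.

Import Order.TTheory GRing.Theory Num.Theory.
Import numFieldNormedType.Exports.

Local Open Scope classical_set_scope.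
Local Open Scope ring_scope.

(** * Maps of class C^m between coordinate spaces *)

(* Meant for open U: all iterated partial derivatives up to order m exist and
   are continuous on U; values outside U are irrelevant. *)
Fixpoint Ck (R : realType) (n : nat) (W : normedModType R) (m : nat)
    (U : set 'rV[R]_n) (h : 'rV[R]_n -> W) : Prop :=
  (forall s, U s -> {for s, continuous h}) /\
  match m with
  | 0 => True
  | m'.+1 => forall i : 'I_n,
      (forall s, U s -> derivable h s (delta_mx 0 i)) /\
      Ck m' U (fun s => 'D_(delta_mx 0 i) h s)
  end.

(* Families s |-> h s y of C^m maps depending continuously on y in the C^m
   (compact-open) topology: every partial derivative in s of order <= m is
   jointly continuous in (s, y). *)
Fixpoint Ck_family (R : realType) (n : nat) (T : topologicalType)
    (W : normedModType R) (m : nat) (U : set ('rV[R]_n * T))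
    (h : 'rV[R]_n -> T -> W) : Prop :=
  (forall z, U z -> {for z, continuous (fun z' : 'rV[R]_n * T => h z'.1 z'.2)}) /\
  match m with
  | 0 => True
  | m'.+1 => forall i : 'I_n,
      (forall z, U z -> derivable (fun s => h s z.2) z.1 (delta_mx 0 i)) /\
      Ck_family m' U (fun s y => 'D_(delta_mx 0 i) (fun s' => h s' y) s)
  end.

(** * Manifolds *)

(* An n-dimensional C^m atlas without boundary, one chart [coord p] around each
   point p (any atlas can be so indexed).  [coord p] and its inverse [param p]
   are only meaningful on [dom p] and on its image.  The tangent space at x is
   represented by 'rV_n through the chart at x, so that vector fields, metrics
   and tangent maps need no compatibility conditions. *)
Record atlas (R : realType) (n m : nat) (M : topologicalType) := Atlas {
  dom : M -> set M;
  coord : M -> M -> 'rV[R]_n;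
  param : M -> 'rV[R]_n -> M;
  dom_open : forall p, open (dom p);
  dom_center : forall p, dom p p;
  coord_open : forall p, open (coord p @` dom p);
  coordK : forall p x, dom p x -> param p (coord p x) = x;
  coord_continuous : forall p x, dom p x -> {for x, continuous (coord p)};
  param_continuous : forall p x, dom p x ->
    {for coord p x, continuous (param p)};
  transition_Ck : forall p q,
    Ck m (coord p @` (dom p `&` dom q)) (fun s => coord q (param p s))
}.

Definition closed_space (M : topologicalType) :=
  compact [set: M] /\ hausdorff_space M.

Section manifold.
Context (R : realType) (n m : nat) (M : topologicalType) (A : atlas R n m M).

(* Components in the chart at p of the tangent vector v at x. *)
Definition components (p x : M) (v : 'rV[R]_n) : 'rV[R]_n :=
  'D_v (fun s => coord A p (param A x s)) (coord A x x).

(* Tangent vector at x with components v in the chart at p. *)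
Definition from_components (p x : M) (v : 'rV[R]_n) : 'rV[R]_n :=
  'D_v (fun s => coord A x (param A p s)) (coord A p x).

Definition Ck_vector_field (r : nat) (X : M -> 'rV[R]_n) :=
  forall p, Ck r (coord A p @` dom A p)
    (fun s => components p (param A p s) (X (param A p s))).

Definition Ck_map (r : nat) (h : M -> M) :=
  continuous h /\
  forall p q, Ck r (coord A p @` (dom A p `&` h @^-1` dom A q))
    (fun s => coord A q (h (param A p s))).

Definition tangent_map (h : M -> M) (x : M) (v : 'rV[R]_n) : 'rV[R]_n :=
  'D_v (fun s => coord A (h x) (h (param A x s))) (coord A x x).

Definition C1_curve (c : R -> M) :=
  continuous c /\
  forall p t, dom A p (c t) ->
    derivable (fun t' => coord A p (c t')) t 1 /\
    {for t, continuous (derive1 (fun t' => coord A p (c t')))}.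

Definition velocity (c : R -> M) (t : R) : 'rV[R]_n :=
  derive1 (fun t' => coord A (c t) (c t')) t.

Definition inner (g : M -> 'M[R]_n) (x : M) (v w : 'rV[R]_n) : R :=
  (v *m g x *m w^T) 0 0.

Definition tnorm (g : M -> 'M[R]_n) (x : M) (v : 'rV[R]_n) : R :=
  Num.sqrt (inner g x v v).

Definition riemannian_metric (r : nat) (g : M -> 'M[R]_n) :=
  [/\ forall x, (g x)^T = g x,
      forall x v, v != 0 -> 0 < inner g x v v &
      forall p v w, Ck r (coord A p @` dom A p)
        (fun s => inner g (param A p s) (from_components p (param A p s) v)
                                        (from_components p (param A p s) w))].

Definition curve_length (g : M -> 'M[R]_n) (c : R -> M) : R :=
  (\int[lebesgue_measure]_(t in `[0%R, 1%R]) tnorm g (c t) (velocity c t))%R.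

(* The flow f with generator X.  Differentiability of the time-t maps is a
   consequence of the regularity of X; it is recorded so that [tangent_map]
   makes sense. *)
Definition flow_of_class (r : nat) (f : R -> M -> M) (X : M -> 'rV[R]_n) :=
  [/\ Ck_vector_field r X,
      forall x, f 0 x = x,
      forall s t x, f (s + t) x = f s (f t x),
      forall t, Ck_map r (f t) &
      forall x, continuous (fun t => f t x) /\
        forall t, derivable (fun t' => coord A (f t x) (f t' x)) t 1 /\
                  velocity (fun t' => f t' x) t = X (f t x)].

End manifold.

(** * Foliations *)

(* A foliation of dimension k and codimension l, with uniformly C^r leaves.
   The foliation chart around p is the homeomorphism [plaque p] from the product
   of the open unit cubes of R^k and R^l onto [fdom p], with inverse
   (along p, trans p); [ball 0 1] is a cube for the sup norm of 'rV. *)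
Record foliation (R : realType) (n m : nat) (M : topologicalType)
    (A : atlas R n m M) (k l r : nat) := Foliation {
  fol_dim : (k + l = n)%N;
  fdom : M -> set M;
  plaque : M -> 'rV[R]_k -> 'rV[R]_l -> M;
  along : M -> M -> 'rV[R]_k;
  trans : M -> M -> 'rV[R]_l;
  fdom_open : forall p, open (fdom p);
  fdom_center : forall p, fdom p p;
  plaque_fdom : forall p s y, ball 0 1 s -> ball 0 1 y -> fdom p (plaque p s y);
  fdom_cube : forall p x, fdom p x ->
    ball 0 1 (along p x) /\ ball 0 1 (trans p x);
  plaqueK : forall p s y, ball 0 1 s -> ball 0 1 y ->
    along p (plaque p s y) = s /\ trans p (plaque p s y) = y;
  fchartK : forall p x, fdom p x -> plaque p (along p x) (trans p x) = x;
  plaque_continuous : forall p (z : 'rV[R]_k * 'rV[R]_l),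
    ball 0 1 z.1 -> ball 0 1 z.2 ->
    {for z, continuous (fun z' : 'rV[R]_k * 'rV[R]_l => plaque p z'.1 z'.2)};
  along_continuous : forall p x, fdom p x -> {for x, continuous (along p)};
  trans_continuous : forall p x, fdom p x -> {for x, continuous (trans p)};
  plaque_Ck : forall p q,
    Ck_family r
      [set z : 'rV[R]_k * 'rV[R]_l |
        [/\ ball 0 1 z.1, ball 0 1 z.2 & dom A q (plaque p z.1 z.2)]]
      (fun s y => coord A q (plaque p s y));
  plaque_immersion : forall p s y w, ball 0 1 s -> ball 0 1 y ->
    'D_w (fun s' => coord A (plaque p s y) (plaque p s' y)) s = 0 -> w = 0;
  (* charts overlap along plaques: locally, trans q is a function of trans p *)
  fol_coherent : forall p q x, fdom p x -> fdom q x ->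
    exists2 N, nbhs x N & forall z z', N z -> N z' ->
      trans p z = trans p z' -> trans q z = trans q z'
}.

Inductive leaf (R : realType) (n m : nat) (M : topologicalType)
    (A : atlas R n m M) (k l r : nat) (F : foliation A k l r) (x : M)
    : M -> Prop :=
| leaf_refl : leaf F x x
| leaf_step p y z : leaf F x y -> fdom F p y -> fdom F p z ->
    trans F p y = trans F p z -> leaf F x z.

(* M with the leaf topology, i.e. the disjoint union of all the leaves, each
   with its intrinsic topology, generated by the open subsets of plaques. *)
Definition leaf_space (R : realType) (n m : nat) (M : topologicalType)
  (A : atlas R n m M) (k l r : nat) (F : foliation A k l r) : Type := M.

Section leaf_topology.
Context (R : realType) (n m : nat) (M : topologicalType) (A : atlas R n m M)
  (k l r : nat) (F : foliation A k l r).

HB.instance Definition _ := Choice.on (leaf_space F).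

Definition leaf_open (U : set (leaf_space F)) : Prop :=
  forall p y, ball 0 1 y ->
    open [set s : 'rV[R]_k | ball 0 1 s /\ U (plaque F p s y)].

Lemma leaf_openT : leaf_open setT.
Proof.
move=> p y _; rewrite (_ : [set s | _] = ball 0 1); first exact: ball_open.
by apply/seteqP; split => s //= -[].
Qed.

Lemma leaf_openI : setI_closed leaf_open.
Proof.
move=> U V oU oV p y y1.
rewrite (_ : [set s | _] =
  [set s : 'rV[R]_k | ball 0 1 s /\ U (plaque F p s y)] `&`
  [set s : 'rV[R]_k | ball 0 1 s /\ V (plaque F p s y)]).
  by apply: openI; [exact: oU | exact: oV].
by apply/seteqP; split => s /=; [move=> [? []] | move=> [[? ?] [? ?]]].
Qed.

Lemma leaf_open_bigU (I : Type) (U : I -> set (leaf_space F)) :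
  (forall i, leaf_open (U i)) -> leaf_open (\bigcup_i U i).
Proof.
move=> oU p y y1.
rewrite (_ : [set s | _] =
  \bigcup_i [set s : 'rV[R]_k | ball 0 1 s /\ U i (plaque F p s y)]).
  by apply: bigcup_open => i _; exact: oU.
by apply/seteqP; split => s /=; [move=> [? [i _ ?]]; exists i |
  move=> [i _ [? ?]]; split=> //; exists i].
Qed.

HB.instance Definition _ := isOpenTopological.Build (leaf_space F)
  leaf_openT leaf_openI leaf_open_bigU.

Definition tangent_space (x : M) : set 'rV[R]_n :=
  [set 'D_w (fun s => coord A x (plaque F x s (trans F x x))) (along F x x)
    | w in [set: 'rV[R]_k]].

End leaf_topology.

(** * Weak expanding foliations *)

Section expanding.
Context (R : realType) (n m : nat) (M : topologicalType) (A : atlas R n m M).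
Context (k l r : nat).

Definition line (v : 'rV[R]_n) : set 'rV[R]_n := [set a *: v | a in [set: R]].

Definition subspace_pred (E : set 'rV[R]_n) :=
  E 0 /\ forall a u v, E u -> E v -> E (a *: u + v).

(* E^cu = T W^cu is the orthogonal sum of Eu and E^c = span X; the uniform
   regularity of the leaves is part of the type of W^cu. *)
Definition weak_expanding (g : M -> 'M[R]_n) (f : R -> M -> M)
    (X : M -> 'rV[R]_n) (Wcu : foliation A k l r) (Eu : M -> set 'rV[R]_n)
    (Cu au Au : R) : Prop :=
  (forall x, subspace_pred (Eu x)) /\
  [/\ forall x, tangent_space Wcu x = [set u + v | u in Eu x & v in line (X x)],
      forall x u v, Eu x u -> line (X x) v -> inner g x u v = 0,
      forall t x, tangent_map A (f t) x @` Eu x = Eu (f t x),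
      forall t x, tangent_map A (f t) x @` line (X x) = line (X (f t x)) &
      forall t x v, 0 <= t -> Eu x v ->
        Cu^-1 * expR (au * t) * tnorm g x v
          <= tnorm g (f t x) (tangent_map A (f t) x v)
          <= Cu * expR (Au * t) * tnorm g x v].

(* Wu is a codimension one foliation of the leaves of Wcu, of class C^r along
   them. First clause: plaques of Wu are locally contained in plaques of Wcu.
   Second clause: in a leaf of Wcu the plaques of Wu are, around any point q,
   the level sets of a C^r submersion to R defined in the leaf coordinates. *)
Definition Ck_subfoliation (k' l' r' : nat)
    (Wu : foliation A k' l' r') (Wcu : foliation A k l r) : Prop :=
  (forall q, exists2 N, nbhs q N & forall z z', N z -> N z' ->
      trans Wu q z = trans Wu q z' -> trans Wcu q z = trans Wcu q z') /\
  (forall q, exists (O : set 'rV[R]_k) (tau : 'rV[R]_k -> R),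
      let P := fun s => plaque Wcu q s (trans Wcu q q) in
      [/\ open O, O (along Wcu q q),
          forall s, O s -> ball 0 1 s /\ fdom Wu q (P s),
          Ck r O (tau : 'rV[R]_k -> R^o) /\
            (forall s, O s -> exists w, 'D_w (tau : 'rV[R]_k -> R^o) s != 0) &
          forall s s', O s -> O s' ->
            (tau s = tau s' <-> trans Wu q (P s) = trans Wu q (P s'))]).

End expanding.

(** * Universal covers *)

Section covering.
Context (R : realType) (U Y : topologicalType).

Definition evenly_covered (p : U -> Y) (V : set Y) : Prop :=
  exists (I : Type) (S : I -> set U),
    [/\ p @^-1` V = \bigcup_i S i,
        forall i j z, S i z -> S j z -> i = j,
        forall i, open (S i) &
        forall i, exists h : Y -> U,
          [/\ forall y, V y -> {for y, continuous h},
              forall y, V y -> S i (h y) /\ p (h y) = y &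
              forall z, S i z -> h (p z) = z]].

Definition simply_connected : Prop :=
  [/\ exists z : U, True,
      forall a b : U, exists c : R -> U,
        [/\ {within `[0, 1], continuous c}, c 0 = a & c 1 = b] &
      forall c : R -> U, {within `[0, 1], continuous c} -> c 0 = c 1 ->
        exists H : R * R -> U,
          [/\ {within `[0, 1] `*` `[0, 1], continuous H},
              forall t, t \in `[0, 1] -> H (0, t) = c t,
              forall t, t \in `[0, 1] -> H (1, t) = c 0 &
              forall s, s \in `[0, 1] -> H (s, 0) = c 0 /\ H (s, 1) = c 0]].

(* p exhibits U as the universal cover of the subspace L of Y, for L open. *)
Definition universal_cover (p : U -> Y) (L : set Y) : Prop :=
  [/\ simply_connected, continuous p, range p = L &
      forall y, L y -> exists V, [/\ open V, V y & evenly_covered p V]].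

End covering.

(* Distance of the Riemannian metric pulled back to U by p : U -> leaf -> M:
   infimum of the lengths of the C^1 curves from a to b.  (Curves are defined on
   the whole line; corners and end points can be smoothed by reparametrizing
   with zero velocity there, so this is the usual Riemannian distance.) *)
Definition cover_dist (R : realType) (n m : nat) (M : topologicalType)
    (A : atlas R n m M) (g : M -> 'M[R]_n) (U : topologicalType) (p : U -> M)
    (a b : U) : R :=
  inf [set curve_length A g (fun t => p (c t)) | c in
        [set c : R -> U | [/\ continuous c, C1_curve A (fun t => p (c t)),
                              c 0 = a & c 1 = b]]].

(** * Gromov hyperbolicity and the Gromov boundary *)

Section gromov.
Context (R : realType) (U : Type) (d : U -> U -> R).

Definition gromov_product (p x y : U) : R := (d x p + d y p - d x y) / 2.

Definition gromov_hyperbolic (delta : R) : Prop :=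
  forall x y z p : U,
    Num.min (gromov_product p x y) (gromov_product p y z) - delta
      <= gromov_product p x z.

(* Only the values at t >= 0 of a ray matter. *)
Definition geodesic_ray (c : R -> U) : Prop :=
  forall s t, 0 <= s -> 0 <= t -> d (c s) (c t) = `|s - t|.

Definition asymptotic (c c' : R -> U) : Prop :=
  exists K : R, forall t, 0 <= t -> d (c t) (c' t) <= K.

Definition ray_class (c : R -> U) : set (R -> U) :=
  [set c' | geodesic_ray c' /\ asymptotic c c'].

Definition gromov_boundary : set (set (R -> U)) :=
  [set ray_class c | c in geodesic_ray].

End gromov.

(* phi t is the lift of f t through p. *)
Definition flow_lift (R : realType) (U : topologicalType) (M : Type)
    (p : U -> M) (f : R -> M -> M) (phi : R -> U -> U) : Prop :=
  [/\ forall z, continuous (fun t => phi t z),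
      forall z, phi 0 z = z &
      forall t z, p (phi t z) = f t (p z)].

(* sigma lifts the leaf Wu(x), with its leaf topology, through p. *)
Definition leaf_lift (R : realType) (n m : nat) (M : topologicalType)
    (A : atlas R n m M) (k l r : nat) (Wu : foliation A k l r) (x : M)
    (U : topologicalType) (p : U -> M) (sigma : M -> U) : Prop :=
  forall y, leaf Wu x y ->
    p (sigma y) = y /\ {for y, continuous (sigma : leaf_space Wu -> U)}.

(* Main.v *)
(* The strong unstable foliation makes the universal cover U of a leaf of W^cu
   look like the upper half space.  The time by which the flow has to be applied
   to carry one local W^u-leaf to another integrates to a height B : U -> R with
   B (f^t z) = B z + t, because U is simply connected.  The component of the
   velocity of a curve along the flow is the derivative of B, so |B z - B y| <=
   d(y, z) and orbits are geodesics.  Flowing every point of a curve down to a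
   fixed level h cancels this component and contracts the other one by the factor
   Cu exp (- au (B - h)); hence a curve of length L joining y and z projects to a
   curve of length at most (2 Cu / au) exp (- au (B y + B z - 2 h - L) / 2) in the
   level h.  Let S(y, z) be the supremum of the levels at which the orbits of y
   and z are at level distance at most 1.  Then d(y, z) is B y + B z - 2 S(y, z)
   up to a constant, and S is ultrametric up to a constant since the levels
   contract downwards exponentially.  This gives hyperbolicity.  A geodesic ray c
   either has B (c t) - t bounded below, and then the projections of c t to a
   level converge (M is compact) to a point whose forward orbit is asymptotic to
   c, or c is asymptotic to the backward orbits.  The level sets of B are the
   lifts of the leaves of W^u. *)

(* Several facts used freely above have to be earned. The flow is not given as jointly
   differentiable: only its strict derivative at time zero is derived, which suffices to
   differentiate f^(theta(t)) c(t), the computation that cancels the flow component of a velocity.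
   That the flow preserves the leaves of W^cu is deduced from tangency of the generator, and that it
   carries local W^u-leaves to local W^u-leaves from the invariance of E^u. The cover U is a bare
   topological space, so separation and completeness are obtained from sheets over plaques, with
   constants uniform in the transverse parameter because leaves may accumulate on themselves. The
   level distance never appears as a number: the existence of a curve of length at most L inside a
   level is the basic predicate, and hyperbolicity is proved from a few formal properties of it. The
   exponent (B y + B z - 2 h - L) / 2 arises by cutting a curve at the point where the height bounds
   started from its two ends agree, and descending from each end separately. *)
From HB Require Import structures.
From mathcomp Require Import all_boot all_order all_algebra.
From mathcomp Require Import all_classical all_reals all_analysis.
From mathcomp Require Import ring lra.
Require Import Defs.

Set Implicit Arguments.
Unset Strict Implicit.
Unset Printing Implicit Defensive.

Import Order.TTheory GRing.Theory Num.Theory.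
Import numFieldNormedType.Exports.

Local Open Scope classical_set_scope.
Local Open Scope ring_scope.

(* A reflexive decision procedure for identities between sums and differences
   in a Z-module, which the [ring] tactic does not cover. *)
Inductive zterm := ZVar of nat | ZAdd of zterm & zterm | ZOpp of zterm | ZZero.

Fixpoint zeval (V : zmodType) (e : seq V) (x : zterm) : V :=
  match x with
  | ZVar n => nth 0 e n
  | ZAdd a b => zeval e a + zeval e b
  | ZOpp a => - zeval e a
  | ZZero => 0
  end.

Fixpoint zcoef (x : zterm) (n : nat) : int :=
  match x with
  | ZVar m => (m == n)%:Z
  | ZAdd a b => zcoef a n + zcoef b n
  | ZOpp a => - zcoef a n
  | ZZero => 0
  end.

(** Variables beyond the end of [e] evaluate to the default 0, so the sum over the actual atoms
    loses nothing. *)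
Lemma zevalE (V : zmodType) (e : seq V) x :
  zeval e x = \sum_(i < size e) nth 0 e i *~ zcoef x i.
Proof.
elim: x => [m|a IHa b IHb|a IHa|] /=.
- have [me|em] := ltnP m (size e).
    rewrite (bigD1 (Ordinal me)) //= eqxx mulr1z big1 ?addr0// => i im.
    by rewrite (negbTE (_ : m != i)) ?mulr0z// eq_sym; exact: contra im.
  rewrite nth_default// big1// => i _.
  rewrite (negbTE (_ : m != i)) ?mulr0z//.
  by rewrite gtn_eqF// (leq_trans (ltn_ord i)).
- by rewrite IHa IHb -big_split; apply: eq_bigr => i _; rewrite /= mulrzDr.
- by rewrite IHa -sumrN; apply: eq_bigr => i _; rewrite mulrNz.
- by rewrite big1// => i _; rewrite mulr0z.
Qed.

Lemma zeval_eq (V : zmodType) (e : seq V) x y :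
  all (fun i => zcoef x i == zcoef y i) (iota 0 (size e)) ->
  zeval e x = zeval e y.
Proof.
move=> /allP xy; rewrite !zevalE; apply: eq_bigr => i _.
by rewrite (eqP (xy i _)) // mem_iota ltn_ord.
Qed.

Ltac zindex x l :=
  match l with
  | ?y :: _ => let _ := match goal with _ => unify x y end in constr:(0%N)
  | _ :: ?l' => let n := zindex x l' in constr:(S n)
  end.
Ltac zinsert x l :=
  match l with
  | _ => let n := zindex x l in l
  | _ => constr:(x :: l)
  end.
Ltac zatoms t l :=
  lazymatch t with
  | (?a + ?b)%R => let l := zatoms a l in zatoms b l
  | (- ?a)%R => zatoms a l
  | 0%R => l
  | _ => zinsert t l
  end.
Ltac zreify t l :=
  lazymatch t with
  | (?a + ?b)%R =>
    let a := zreify a l in let b := zreify b l in constr:(ZAdd a b)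
  | (- ?a)%R => let a := zreify a l in constr:(ZOpp a)
  | 0%R => constr:(ZZero)
  | _ => let n := zindex t l in constr:(ZVar n)
  end.
(** Scalars are distributed first, so that every remaining product of a scalar and a vector is a
    single atom; the integer coefficients are then compared by computation. *)
Ltac zmod :=
  rewrite ?(scalerDl, scalerDr, scalerBl, scalerBr, scaleNr, scalerN, scale1r,
            scale0r, scaler0);
  lazymatch goal with
  | |- @eq ?T ?a ?b =>
    let l := zatoms a (@nil T) in let l := zatoms b l in
    let x := zreify a l in let y := zreify b l in
    exact: (@zeval_eq _ l x y isT)
  end.

(** * Strict differentiability *)

Section calculus.
Context {R : realType}.

Lemma half_gt0 (e : R) : 0 < e -> 0 < e / 2.
Proof. by move=> e0; rewrite divr_gt0. Qed.

Lemma nbhs_dist (V : normedModType R) (x : V) (P : set V) :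
  nbhs x P <-> exists2 d : R, 0 < d & forall y, `|y - x| < d -> P y.
Proof.
split=> [/nbhs_ballP[d /= d0 dP]|[d d0 dP]].
- by exists d => // y yd; apply: dP; rewrite -ball_normE/= distrC.
- by apply/nbhs_ballP; exists d => // y; rewrite -ball_normE/= distrC; exact: dP.
Qed.

Lemma nbhs_ex (V : normedModType R) (x : V) (P : set V) :
  nbhs x P -> exists2 d : R, 0 < d & forall y, `|y - x| < d -> P y.
Proof. by move=> /nbhs_dist. Qed.

Lemma nbhs_exR (x : R) (P : set R) :
  nbhs x P -> exists2 d : R, 0 < d & forall y, `|y - x| < d -> P y.
Proof. exact: (@nbhs_ex R). Qed.

Lemma near_dist (V : normedModType R) (x : V) (d : R) : 0 < d ->
  \forall y \near x, `|y - x| < d.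
Proof. by move=> d0; apply/nbhs_dist; exists d. Qed.

Lemma contP (V W : normedModType R) (f : V -> W) (x : V) :
  {for x, continuous f} <-> forall e : R, 0 < e -> exists2 d : R, 0 < d &
    forall y, `|y - x| < d -> `|f y - f x| < e.
Proof.
split=> [fx e e0|fx].
- move/cvgrPdist_lt : fx => /(_ e e0)/nbhs_dist[d d0 H].
  by exists d => // y /H; rewrite distrC.
- apply/cvgrPdist_lt => e /fx[d d0 H]; apply/nbhs_dist; exists d => // y /H.
  by rewrite distrC.
Qed.

Lemma cont_near (T : topologicalType) (W : normedModType R) (f : T -> W) (x : T)
    (e : R) : {for x, continuous f} -> 0 < e -> \forall y \near x, `|f y - f x| <= e.
Proof.
move=> /cvgrPdist_le fx e0; have := fx _ e0.
by apply: filterS => y h; rewrite distrC.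
Qed.

Lemma continuous_near_eq (T U : topologicalType) (f h : T -> U) (x : T) :
  {for x, continuous f} -> (\near x, f x = h x) -> {for x, continuous h}.
Proof.
move=> fx fh; have E := nbhs_singleton fh.
rewrite /prop_for /continuous_at -E; apply: cvg_trans fx.
by apply: near_eq_cvg; apply: filterS fh => y ->.
Qed.

Lemma continuous_sumr (T : topologicalType) k (f : 'I_k -> T -> R) (x : T) :
  (forall i, {for x, continuous (f i)}) ->
  {for x, continuous (fun y => \sum_i f i y)}.
Proof.
elim: k f => [|k IH] f fx.
  rewrite (_ : (fun _ => _) = fun=> 0); first exact: cst_continuous.
  by apply/funext => y; rewrite big_ord0.
rewrite (_ : (fun _ => _) = fun y => f ord0 y + \sum_i f (lift ord0 i) y).
  by apply: cvgD; [exact: fx|exact: IH].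
by apply/funext => y; rewrite big_ord_recl.
Qed.

Lemma rV_norm_le n (v : 'rV[R]_n) (e : R) : 0 <= e ->
  (forall i, `|v 0 i| <= e) -> `|v| <= e.
Proof.
move=> e0 ve; rewrite [leLHS]/Num.norm/= mx_normrE.
apply: bigmax_le => // -[i j] _ /=; rewrite (ord1 i); exact: ve.
Qed.

Lemma rV_norm_ge n (v : 'rV[R]_n) i : `|v 0 i| <= `|v|.
Proof.
rewrite [leRHS]/Num.norm/= mx_normrE.
exact: (le_bigmax _ (fun ij : 'I_1 * 'I_n => `|v ij.1 ij.2|) (0, i)).
Qed.

(** Made a property of the target space so that the differentiability lemmas serve both the line and
    row vectors. For the latter the sup norm lets the constant pass through coordinates without
    loss. *)
Definition mean_value (W : normedModType R) :=
  forall (f df : R -> W) (a b K : R), a <= b ->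
    (forall t, a <= t <= b -> is_derive t 1 f (df t)) ->
    (forall t, a <= t <= b -> `|df t| <= K) -> `|f b - f a| <= K * (b - a).

Lemma mean_value_R : mean_value R.
Proof.
move=> f df a b K ab fd dK.
have K0 : 0 <= K by apply: le_trans (normr_ge0 _) (dK a _); rewrite lexx ab.
have [x||c cab ->] := @MVT_segment R f df a b ab.
- by rewrite in_itv/= => /andP[ax xb]; apply: fd; rewrite !ltW.
- apply: derivable_within_continuous => x; rewrite in_itv/= => xab.
  by have [] := fd _ xab.
- rewrite normrM (ger0_norm (_ : 0 <= b - a)) ?subr_ge0//.
  by apply: ler_wpM2r; rewrite ?subr_ge0//; apply: dK; move: cab; rewrite in_itv.
Qed.

Lemma is_derive_coord (V : normedModType R) n (f : V -> 'rV[R]_n) x v df i :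
  is_derive x v f df -> is_derive x v (fun y => f y 0 i) (df 0 i).
Proof.
move=> [fd <-]; have := fd; move/derivable_mxP => /(_ 0 i) fi.
split => //; by rewrite (derive_mx fd) mxE.
Qed.

Lemma mean_value_rV n : mean_value 'rV[R]_n.
Proof.
move=> f df a b K ab fd dK.
have K0 : 0 <= K by apply: le_trans (normr_ge0 _) (dK a _); rewrite lexx ab.
apply: rV_norm_le => [|i]; first by rewrite mulr_ge0 ?subr_ge0.
have := @mean_value_R (fun t => f t 0 i) (fun t => df t 0 i) a b K ab.
rewrite !mxE; apply=> t tab.
- exact/is_derive_coord/fd.
- exact: le_trans (rV_norm_ge _ _) (dK _ tab).
Qed.

(* Strict differentiability: unlike Frechet differentiability, holding at every
   point it amounts to class C^1, and it composes without any chain rule for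
   continuity of the derivative. *)
Definition sdiff (V W : normedModType R) (f : V -> W) (x : V) (L : V -> W) :=
  [/\ forall a u v, L (a *: u + v) = a *: L u + L v,
      exists2 K : R, 0 < K & forall v, `|L v| <= K * `|v| &
      forall e : R, 0 < e -> exists2 d : R, 0 < d & forall a b,
        `|a - x| < d -> `|b - x| < d ->
        `|f a - f b - L (a - b)| <= e * `|a - b|].

Definition sderiv (W : normedModType R) (c : R -> W) (t : R) (v : W) :=
  forall e : R, 0 < e -> exists2 d : R, 0 < d & forall a b,
    `|a - t| < d -> `|b - t| < d ->
    `|c a - c b - (a - b) *: v| <= e * `|a - b|.

Section sdiff.
Context (V W : normedModType R).
Implicit Types (f : V -> W) (L : V -> W).

Lemma lin0 L : (forall a u v, L (a *: u + v) = a *: L u + L v) -> L 0 = 0.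
Proof.
by move=> Ll; have := Ll (-1) 0 0; rewrite scaler0 addr0 scaleN1r addNr.
Qed.

Lemma linZ L : (forall a u v, L (a *: u + v) = a *: L u + L v) ->
  forall a u, L (a *: u) = a *: L u.
Proof.
by move=> Ll a u; rewrite -[a *: u]addr0 Ll (lin0 Ll) addr0.
Qed.

Lemma linB L : (forall a u v, L (a *: u + v) = a *: L u + L v) ->
  forall u v, L (u - v) = L u - L v.
Proof.
by move=> Ll u v; rewrite addrC -scaleN1r Ll scaleN1r addrC.
Qed.

Lemma sdiff_lip f x L : sdiff f x L -> exists K d : R, [/\ 0 < K, 0 < d &
  forall a b, `|a - x| < d -> `|b - x| < d -> `|f a - f b| <= K * `|a - b|].
Proof.
move=> [Ll [K K0 LK] fL]; have [d d0 fd] := fL 1 ltr01.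
exists (K + 1), d; split=> // [|a b ad bd]; first by rewrite addr_gt0.
rewrite -[f a - f b](subrK (L (a - b))) (le_trans (ler_normD _ _))//.
by rewrite mulrDl addrC lerD// fd.
Qed.

Lemma sdiff_continuous f x L : sdiff f x L -> {for x, continuous f}.
Proof.
move=> /sdiff_lip [K [d [K0 d0 fK]]].
apply/contP => e e0; exists (Num.min d (e / K)).
  by rewrite lt_min d0 divr_gt0.
move=> y; rewrite lt_min => /andP[yd yK].
apply: le_lt_trans (fK y x yd _) _; first by rewrite subrr normr0.
by rewrite mulrC -ltr_pdivlMr.
Qed.

Lemma sdiff_is_derive f x L v : sdiff f x L -> is_derive x v f (L v).
Proof.
move=> [Ll _ fL].
have H : (fun h : R => h^-1 *: (f (h *: v + x) - f x)) @ 0^' --> L v.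
  apply/cvgrPdist_le => e e0.
  (* The added 1 covers [v = 0]; it recurs below for the same reason. *)
  have v1 : 0 < `|v| + 1 by rewrite ltr_wpDl.
  have [d d0 fd] := fL (e / (`|v| + 1)) (divr_gt0 e0 v1).
  near=> h.
  have h0 : h != 0 by near: h; exact: nbhs_dnbhs_neq.
  have hd : `|h| < d / (`|v| + 1).
    by near: h; apply: dnbhs0_lt; rewrite divr_gt0.
  have hvd : `|h *: v| < d.
    rewrite normrZ; apply: le_lt_trans (_ : `|h| * (`|v| + 1) < d).
      by rewrite ler_wpM2l// lerDl.
    by rewrite -ltr_pdivlMr.
  have := fd (h *: v + x) x; rewrite addrK subrr normr0 => /(_ hvd d0).
  rewrite (linZ Ll) => H.
  rewrite distrC; have -> : h^-1 *: (f (h *: v + x) - f x) - L v = h^-1 *: (f (h *: v + x) - f x - h *: L v).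
    by rewrite [RHS]scalerBr [in RHS]scalerA mulVf// scale1r.
  rewrite normrZ normfV.
  rewrite ler_pdivrMl ?normr_gt0//; apply: le_trans H _.
  rewrite normrZ mulrCA ler_wpM2l// mulrAC ler_pdivrMr// ler_wpM2l ?ltW//.
  by rewrite ltrDl.
split; first by apply/cvg_ex; exists (L v).
exact/cvg_lim.
Unshelve. all: by end_near. Qed.

Lemma sdiff_unique f x L L' : sdiff f x L -> sdiff f x L' -> L =1 L'.
Proof.
move=> fL fL' v.
have [_ <-] := sdiff_is_derive v fL; have [_ <-] := sdiff_is_derive v fL'.
by [].
Qed.

Lemma sdiff_near f g x L : sdiff f x L -> (\near x, f x = g x) -> sdiff g x L.
Proof.
move=> [Ll LK fL] /nbhs_ballP [r /= r0 fg]; split=> // e e0.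
have [d d0 fd] := fL _ e0; exists (Num.min d r); first by rewrite lt_min d0.
have fgE y : `|y - x| < r -> f y = g y.
  by move=> yr; apply: fg; rewrite -ball_normE/= distrC.
by move=> a b; rewrite !lt_min => /andP[ad ar] /andP[bd br];
  rewrite -!fgE//; exact: fd.
Qed.

End sdiff.

Lemma sderiv_sdiff (W : normedModType R) (c : R -> W) t v :
  sderiv c t v <-> sdiff (c : R^o -> W) t (fun h : R^o => h *: v).
Proof.
split=> [cv|[]//]; split=> //.
- by move=> a u w; rewrite scalerDl scalerA.
- exists (`|v| + 1) => [|h]; first by rewrite ltr_wpDl.
  by rewrite normrZ mulrC ler_wpM2r// lerDl.
Qed.

Lemma sdiff_comp (U V W : normedModType R) (f : U -> V) (g : V -> W) x L L' :
  sdiff f x L -> sdiff g (f x) L' -> sdiff (g \o f) x (L' \o L).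
Proof.
move=> fL gL'; have [K [r [K0 r0 fK]]] := sdiff_lip fL.
case: fL gL' => Ll [C C0 LC] fL [Ll' [C' C'0 LC'] gL']; split.
- by move=> a u v /=; rewrite Ll Ll'.
- exists (C' * C) => [|v /=]; first by rewrite mulr_gt0.
  by rewrite (le_trans (LC' _))// -mulrA ler_pM2l.
move=> e e0.
have [d' d'0 gd] := gL' (e / 2 / K) (divr_gt0 (half_gt0 e0) K0).
have [d d0 fd] := fL (e / 2 / C') (divr_gt0 (half_gt0 e0) C'0).
exists (Num.min d (Num.min r (d' / K))).
  by rewrite !lt_min d0 r0 divr_gt0.
move=> a b; rewrite !lt_min => /and3P[ad ar ad'] /and3P[bd br bd'] /=.
have xr : `|x - x| < r by rewrite subrr normr0.
have aK : `|f a - f x| < d'.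
  by apply: le_lt_trans (fK _ _ ar xr) _; rewrite mulrC -ltr_pdivlMr.
have bK : `|f b - f x| < d'.
  by apply: le_lt_trans (fK _ _ br xr) _; rewrite mulrC -ltr_pdivlMr.
have H1 := gd _ _ aK bK.
have H2 := LC' (f a - f b - L (a - b)).
rewrite (linB Ll') in H2.
have H3 := fd _ _ ad bd.
have H4 := fK _ _ ar br.
rewrite -(subrK (L' (f a - f b)) (g _ - _)) -addrA.
rewrite (le_trans (ler_normD _ _))// (splitr e) mulrDl lerD//.
- apply: le_trans H1 _; rewrite -mulrA ler_pM2l ?divr_gt0//.
  by rewrite mulrC ler_pdivrMr// mulrC.
- apply: le_trans H2 _; rewrite -ler_pdivlMl//; apply: le_trans H3 _.
  by rewrite mulrA (mulrC _ (e / 2)).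
Qed.

Lemma sderiv_comp (V W : normedModType R) (c : R -> V) (g : V -> W) t v L :
  sderiv c t v -> sdiff g (c t) L -> sderiv (g \o c) t (L v).
Proof.
move=> /sderiv_sdiff cv gL; apply/sderiv_sdiff.
have [Ll _ _] := gL.
have [a b h] := sdiff_comp cv gL; split => [k u w|//|e e0] /=.
- by rewrite scalerDl -scalerA.
- by case: b => K K0 LK; exists K => // w; have := LK w; rewrite /= (linZ Ll).
- have [d d0 H] := h e e0; exists d => // u w ud wd.
  by have := H u w ud wd; rewrite /= (linZ Ll).
Qed.

(** The curve is only derivable, as an orbit of the flow is at first known to be; strictness of [g]
    alone makes the chain rule work. *)
Lemma is_derive_comp_sdiff (V W : normedModType R) (c : R -> V) (g : V -> W)
    (t : R) v L :
  is_derive t (1 : R) c v -> sdiff g (c t) L -> is_derive t (1 : R) (g \o c) (L v).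
Proof.
move=> [cd cv] gL.
have ct : {for t, continuous c}.
  by apply: differentiable_continuous; apply/derivable1_diffP.
have [K [r [K0 r0 gK]]] := sdiff_lip gL.
have [Ll [C C0 LC] gd] := gL.
have cc : (fun h : R => h^-1 *: (c (h *: 1 + t) - c t)) @ 0^' --> v.
  by rewrite -cv; exact: cd.
have ch : (fun h : R => c (h *: 1 + t)) @ 0^' --> c t.
  have H : (fun h : R => h *: 1 + t) @ 0^' --> (0 : R) *: 1 + t.
    apply: cvgD; last exact: cvg_cst.
    apply: cvgZl; exact: cvg_within.
  by rewrite scale0r add0r in H; exact: (cvg_comp _ _ H ct).
have H : (fun h : R => h^-1 *: ((g \o c) (h *: 1 + t) - (g \o c) t)) @ 0^' -->
    L v.
  apply/cvgrPdist_le => e e0.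
  have v2 : 0 < `|v| + 1 by rewrite ltr_wpDl.
  have [d d0 gd'] := gd (e / 2 / (`|v| + 1)) (divr_gt0 (half_gt0 e0) v2).
  near=> h.
  have h0 : h != 0 by near: h; exact: nbhs_dnbhs_neq.
  have chd : `|c (h *: 1 + t) - c t| < d.
    by rewrite distrC; near: h; move/cvgrPdist_lt : ch; apply.
  have cv1 : `|v - h^-1 *: (c (h *: 1 + t) - c t)| <= Num.min 1 (e / 2 / C).
    near: h; move/cvgrPdist_le : cc; apply.
    by rewrite lt_min ltr01 !divr_gt0.
  move: cv1; rewrite le_min => /andP[cv1 cvC].
  set q := h^-1 *: _ in cv1 cvC.
  have qv : `|q| <= `|v| + 1.
    rewrite -[q](subKr v) (le_trans (ler_normB _ _))// lerD2l//.
  have cq : c (h *: 1 + t) - c t = h *: q by rewrite scalerA divff// scale1r.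
  have H1 := gd' (c (h *: 1 + t)) (c t) chd.
  rewrite subrr normr0 cq (linZ Ll) in H1.
  have {}H1 := H1 d0.
  rewrite distrC /=.
  rewrite -(subrK (L q) (h^-1 *: _)) -addrA (le_trans (ler_normD _ _))//.
  rewrite (splitr e) lerD//.
  - have -> : h^-1 *: (g (c (h *: 1 + t)) - g (c t)) - L q = h^-1 *: (g (c (h *: 1 + t)) - g (c t) - h *: L q).
      by rewrite [RHS]scalerBr [in RHS]scalerA mulVf// scale1r.
    rewrite normrZ normfV.
    rewrite ler_pdivrMl ?normr_gt0//; apply: le_trans H1 _.
    rewrite normrZ mulrCA ler_pM2l ?normr_gt0// mulrAC ler_pdivrMr//.
    by rewrite ler_pM2l ?divr_gt0.
  - rewrite -(linB Ll); apply: le_trans (LC _) _.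
    by rewrite -ler_pdivlMl// mulrC distrC.
split; first by apply/cvg_ex; exists (L v).
exact/cvg_lim.
Unshelve. all: by end_near. Qed.

Lemma sderiv_is_derive (W : normedModType R) (c : R -> W) t v :
  sderiv c t v -> is_derive t (1 : R) c v.
Proof.
move=> /sderiv_sdiff cv.
have := @sdiff_is_derive R^o W c t _ (1 : R) cv.
by rewrite scale1r.
Qed.

Lemma sderiv_unique (W : normedModType R) (c : R -> W) t v w :
  sderiv c t v -> sderiv c t w -> v = w.
Proof. by move=> /sderiv_is_derive[_ <-] /sderiv_is_derive[_ <-]. Qed.

Lemma sderiv_continuous (W : normedModType R) (c : R -> W) t v :
  sderiv c t v -> {for t, continuous c}.
Proof. by move=> /sderiv_sdiff/sdiff_continuous. Qed.

Lemma sderiv_near (W : normedModType R) (c c' : R -> W) t v :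
  sderiv c t v -> (\near t, c t = c' t) -> sderiv c' t v.
Proof.
by move=> /sderiv_sdiff cv cc'; apply/sderiv_sdiff; exact: sdiff_near cc'.
Qed.

Lemma sderiv_cst (W : normedModType R) (w : W) t : sderiv (fun=> w) t 0.
Proof.
move=> e e0; exists 1 => // a b _ _.
by rewrite scaler0 subrr subr0 normr0 mulr_ge0// ltW.
Qed.

(** An increment across [t] is split at [t]. Since [t] lies between the two points, the two errors
    add up to exactly the allowed one. *)
Lemma sderiv_glue (W : normedModType R) (c c' : R -> W) t v :
  sderiv c t v -> sderiv c' t v -> c t = c' t ->
  sderiv (fun s => if s <= t then c s else c' s) t v.
Proof.
move=> cv cv' cc e e0.
have [d d0 H] := cv e e0; have [d' d'0 H'] := cv' e e0.
exists (Num.min d d'); first by rewrite lt_min d0.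
move=> a b; rewrite !lt_min => /andP[ad ad'] /andP[bd bd'].
have tt r : 0 < r -> `|t - t| < r by rewrite subrr normr0.
have main x y : x <= t -> t <= y -> `|x - t| < d -> `|y - t| < d' ->
    `|c x - c' y - (x - y) *: v| <= e * `|x - y|.
  move=> xt ty xd yd.
  have -> : c x - c' y - (x - y) *: v =
     (c x - c t - (x - t) *: v) + (c' t - c' y - (t - y) *: v).
    rewrite -cc addrACA -opprD -scalerDl.
    by rewrite (addrA (c x - c t)) subrK (addrA (x - t)) subrK.
  rewrite (le_trans (ler_normD _ _))//.
  have -> : `|x - y| = `|x - t| + `|t - y|.
    by rewrite !ler0_norm ?subr_le0//; [lra|exact: le_trans ty].
  by rewrite mulrDr lerD// ?H ?H'// tt.
have [at_|ta] := leP a t; have [bt|tb] := leP b t; [exact: H| | |exact: H'].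
- by apply: main => //; exact: ltW.
- have -> : c' a - c b - (a - b) *: v = - (c b - c' a - (b - a) *: v) by zmod.
  by rewrite normrN (distrC a b); apply: main => //; exact: ltW.
Qed.

Lemma sderiv_scale (W : normedModType R) (k : R -> R) t k' (w : W) :
  sderiv k t k' -> sderiv (fun s => k s *: w) t (k' *: w).
Proof.
move=> kk; have [] : sdiff (fun h : R^o => h *: w : W) (k t) (fun h : R^o => h *: w).
  by apply/sderiv_sdiff => e e0; exists 1 => // a b _ _;
    rewrite scalerBl subrr normr0 mulr_ge0// ltW.
move=> a b c; exact: (@sderiv_comp R^o W k (fun h : R^o => h *: w) t k' (fun h : R^o => h *: w)).
Qed.

Lemma sderiv_scalel (W : normedModType R) (w : W) t : sderiv (fun s : R => s *: w) t w.
Proof.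
move=> e e0; exists 1 => // a b _ _.
by rewrite scalerBl subrr normr0 mulr_ge0// ltW.
Qed.

Lemma sderivD (W : normedModType R) (c c' : R -> W) t v v' :
  sderiv c t v -> sderiv c' t v' -> sderiv (fun s => c s + c' s) t (v + v').
Proof.
move=> cv cv' e e0; have e2 : 0 < e / 2 by rewrite divr_gt0.
have [d d0 H] := cv _ e2; have [d' d'0 H'] := cv' _ e2.
exists (Num.min d d'); first by rewrite lt_min d0.
move=> a b; rewrite !lt_min => /andP[ad ad'] /andP[bd bd'].
have -> : c a + c' a - (c b + c' b) - (a - b) *: (v + v') =
   (c a - c b - (a - b) *: v) + (c' a - c' b - (a - b) *: v').
  by zmod.
rewrite (le_trans (ler_normD _ _))// (splitr e) mulrDl lerD//; [exact: H|exact: H'].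
Qed.

(** One increment of [c], from [s] to [s + h], is compared with both derivatives, by strictness at
    [t] and at [s]. *)
Lemma sderiv_continuous_derive (W : normedModType R) (c c' : R -> W) t :
  (\near t, sderiv c t (c' t)) -> {for t, continuous c'}.
Proof.
move=> ncc; have cv := nbhs_singleton ncc.
apply/contP => e e0.
have [d d0 H] := cv (e / 3) (divr_gt0 e0 (ltr0Sn _ _)).
move/nbhs_dist : ncc => [d' d'0 ncc].
exists (Num.min d d'); first by rewrite lt_min d0.
move=> s; rewrite lt_min => /andP[sd sd'].
have [r r0 H'] := ncc _ sd' (e / 3) (divr_gt0 e0 (ltr0Sn _ _)).
pose h := Num.min (d - `|s - t|) r / 2.
have h0 : 0 < h by rewrite half_gt0// lt_min subr_gt0 sd.
have [hd hr] : h < d - `|s - t| /\ h < r.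
  have : Num.min (d - `|s - t|) r <= d - `|s - t| by rewrite ge_min lexx.
  have : Num.min (d - `|s - t|) r <= r by rewrite ge_min lexx orbT.
  by move: h0; rewrite /h => *; split; lra.
have hN : `|h| = h by rewrite gtr0_norm.
have shd : `|s + h - t| < d.
  by rewrite addrAC (le_lt_trans (ler_normD _ _))// hN; lra.
have shs : s + h - s = h by rewrite addrC addrA addNr add0r.
have := H' (s + h) s; rewrite subrr normr0 shs hN => /(_ hr r0).
have := H (s + h) s shd sd; rewrite shs hN.
set X := c _ - c _ => H1 H2.
have E : h *: (c' s - c' t) = (X - h *: c' t) - (X - h *: c' s).
  by zmod.
have : h * `|c' s - c' t| <= e / 3 * h + e / 3 * h.
  rewrite -{1}hN -normrZ E (le_trans (ler_normB _ _))// lerD//.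
rewrite -mulrDl mulrC ler_pM2r// => /le_lt_trans; apply; lra.
Qed.

(* Continuous partial derivatives give strict differentiability, uniformly in a
   parameter y: replace the coordinates of b by those of a one at a time. *)
Lemma C1_sdiff_family n (W : normedModType R) (T : topologicalType)
    (h : 'rV[R]_n -> T -> W) (s0 : 'rV[R]_n) (y0 : T) :
  mean_value W ->
  (\forall z \near (s0, y0), forall i,
     derivable (fun s => h s z.2) z.1 (delta_mx 0 i : 'rV[R]_n)) ->
  (forall i, {for (s0, y0), continuous (fun z : 'rV[R]_n * T =>
     'D_(delta_mx 0 i) (fun s => h s z.2) z.1)}) ->
  forall e : R, 0 < e -> exists2 d : R, 0 < d &
    \forall y \near y0, forall a b, `|a - s0| < d -> `|b - s0| < d ->
      `|h a y - h b y - \sum_i (a - b) 0 i *: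
          'D_(delta_mx 0 i) (fun s => h s y0) s0| <= e * `|a - b|.
Proof.
move=> mvW hd hc e e0.
(* The error is shared among the [n] coordinates; the extra 1 covers [n = 0]. *)
pose e' := e / (n%:R + 1).
have n1 : 0 < n%:R + 1 :> R by rewrite ltr_wpDl.
have e'0 : 0 < e' by rewrite divr_gt0.
have : \forall z \near (s0, y0), forall i,
    derivable (fun s => h s z.2) z.1 (delta_mx 0 i : 'rV[R]_n) /\
    `|'D_(delta_mx 0 i) (fun s => h s z.2) z.1 -
      'D_(delta_mx 0 i) (fun s => h s y0) s0| <= e'.
  have H : \forall z \near (s0, y0), forall i,
    `|'D_(delta_mx 0 i) (fun s => h s z.2) z.1 -
      'D_(delta_mx 0 i) (fun s => h s y0) s0| <= e'.
    apply: (@filter_forall _ _ (fun i z => `|'D_(delta_mx 0 i) (fun s => h s z.2) z.1 - 'D_(delta_mx 0 i) (fun s => h s y0) s0| <= e') (nbhs (s0, y0))) => i.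
    have /cvgrPdist_le /(_ _ e'0) := hc i.
    by apply: filterS => z; rewrite distrC.
  by apply: filterS2 hd H => z h1 h2 i; split.
move=> [[A B] [/= /nbhs_dist[d d0 dA] By] AB].
exists d => //; apply: filterS By => y yB a b ad bd.
pose w (j : nat) : 'rV[R]_n := \row_i (if (i < j)%N then a 0 i else b 0 i).
have w0 : w 0%N = b by apply/rowP => i; rewrite !mxE.
have wn : w n = a by apply/rowP => i; rewrite !mxE ltn_ord.
pose D i := 'D_(delta_mx 0 i) (fun s => h s y0) s0 : W.
have step (i : 'I_n) : `|h (w i.+1) y - h (w i) y - (a - b) 0 i *: D i|
    <= e' * `|(a - b) 0 i|.
  pose v t : 'rV[R]_n := w i + t *: delta_mx 0 i.
  have wi : w i 0 i = b 0 i by rewrite mxE ltnn.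
  have wS : w i.+1 = v (a 0 i - b 0 i).
    apply/rowP => j; rewrite !mxE eqxx /= ltnS leq_eqVlt.
    have [->|ji] := eqVneq j i; first by rewrite eqxx ltnn /= mulr1 addrC subrK.
    by rewrite -(inj_eq val_inj) in ji; rewrite /= in ji; rewrite ?(negbTE ji) mulr0 addr0.
  have w00 : w i = v 0 by rewrite /v scale0r addr0.
  pose q := a 0 i - b 0 i.
  (* Each coordinate of the segment between two consecutive hybrids lies between those of [a] and
     [b], so in the sup norm the segment stays in the ball. Centring at [q / 2] treats both signs of
     [q] at once. *)
  have vd t : `|t - q / 2| <= `|q| / 2 -> `|v t - s0| < d.
    move=> tq; rewrite -(normr_id (v t - s0)).
    have : `|v t - s0| <= Num.max `|a - s0| `|b - s0|.
      apply: rV_norm_le => [|j]; first by rewrite le_max normr_ge0.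
      have aj : `|a 0 j - s0 0 j| <= Num.max `|a - s0| `|b - s0|.
        by rewrite le_max; have := rV_norm_ge (a - s0) j; rewrite !mxE => ->.
      have bj : `|b 0 j - s0 0 j| <= Num.max `|a - s0| `|b - s0|.
        by rewrite le_max; have := rV_norm_ge (b - s0) j; rewrite !mxE => ->; rewrite orbT.
      rewrite /v !mxE eqxx /=.
      have [ji|ji] := eqVneq j i; last first.
        by rewrite mulr0 addr0; case: ifP.
      subst j.
      rewrite ltnn mulr1.
      move: aj bj tq; rewrite /q; move: (Num.max _ _) => m.
      rewrite !ler_norml => /andP[a1 a2] /andP[b1 b2].
      by case: (ger0P (a 0 i - b 0 i)) => qq; move=> /andP[t1 t2];
        apply/andP; split; lra.
    by rewrite normr_id => /le_lt_trans; apply; rewrite gt_max ad.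
  have dv (t : R) : `|v t - s0| < d -> is_derive t (1 : R)
      (fun t => h (v t) y - t *: D i)
      ('D_(delta_mx 0 i) (fun s => h s y) (v t) - D i).
    move=> /dA tA; have [/= dh _] := AB (v t, y) (conj tA yB) i.
    have E : (fun k : R => k^-1 *: (h (v (k *: 1 + t)) y - h (v t) y)) =
        (fun k : R => k^-1 *: (h (k *: delta_mx 0 i + v t) y - h (v t) y)).
      apply/funext => k; do 3 f_equal; rewrite /v addrCA; congr (_ + _).
      by rewrite scalerDl [k *: 1]mulr1.
    have H1 : is_derive t (1 : R) (fun t => h (v t) y) ('D_(delta_mx 0 i) (fun s => h s y) (v t)).
      split; first by rewrite /derivable E; exact: dh.
      by rewrite /derive E.
    have H2 : is_derive t (1 : R) (fun t : R => t *: D i) (D i).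
      exact/sderiv_is_derive/sderiv_scalel.
    exact: is_deriveB.
  have mid t : 0 <= t <= q \/ q <= t <= 0 -> `|t - q / 2| <= `|q| / 2.
    rewrite ler_norml => -[] /andP[t1 t2].
      by rewrite ger0_norm; [apply/andP; split|]; lra.
    by rewrite ler0_norm; [apply/andP; split|]; lra.
  have bnd t : `|v t - s0| < d ->
      `|'D_(delta_mx 0 i) (fun s => h s y) (v t) - D i| <= e'.
    by move=> /dA tA; have [/= _] := AB (v t, y) (conj tA yB) i.
  have qE : (a - b) 0 i = q by rewrite !mxE.
  rewrite qE wS {1}w00 -/q.
  have -> : h (v q) y - h (v 0) y - q *: D i =
     (h (v q) y - q *: D i) - (h (v 0) y - 0 *: D i).
    by rewrite scale0r subr0 addrAC.
  have [q0|q0] := leP 0 q.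
    rewrite (ger0_norm q0) -[X in _ * X]subr0.
    apply: (mvW (fun t => h (v t) y - t *: D i) _ 0 q e' q0) => t tq.
      by apply: dv; apply: vd; apply: mid; left.
    by apply: bnd; apply: vd; apply: mid; left.
  rewrite distrC (ltr0_norm q0) -[- q]add0r.
  apply: (mvW (fun t => h (v t) y - t *: D i) _ q 0 e' (ltW q0)) => t tq.
    by apply: dv; apply: vd; apply: mid; right.
  by apply: bnd; apply: vd; apply: mid; right.
have -> : h a y - h b y - \sum_i (a - b) 0 i *: D i =
    \sum_(i < n) (h (w i.+1) y - h (w i) y - (a - b) 0 i *: D i).
  rewrite big_split /= -sumrN; congr (_ + _).
  rewrite -(big_mkord xpredT (fun i => h (w i.+1) y - h (w i) y)).
  by rewrite telescope_sumr// w0 wn.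
apply: le_trans (ler_norm_sum _ _ _) _.
apply: (@le_trans _ _ (\sum_(i < n) e' * `|a - b|)).
  apply: ler_sum => i _; apply: le_trans (step i) _.
  by rewrite ler_pM2l// rV_norm_ge.
rewrite sumr_const card_ord -mulr_natl mulrA ler_wpM2r// /e'.
by rewrite mulrCA ler_piMr ?(ltW e0)// ler_pdivrMr// mul1r lerDl.
Unshelve. all: by end_near. Qed.

(** The supremum of the times up to which [P] holds throughout satisfies [P] by the first
    hypothesis, and the second one forbids it to lie before [b]. *)
Lemma real_ind (P : R -> Prop) (a b : R) :
  (forall t, a <= t <= b -> (forall s, a <= s < t -> P s) -> P t) ->
  (forall t, a <= t < b -> (forall s, a <= s <= t -> P s) ->
    exists2 d, 0 < d & forall s, t < s < t + d -> s <= b -> P s) ->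
  forall t, a <= t <= b -> P t.
Proof.
move=> H1 H2 t tab; have ab : a <= b by case/andP: tab => /le_trans; apply.
pose S := [set t | a <= t <= b /\ forall s, a <= s <= t -> P s].
have Sa : S a.
  split; first by rewrite lexx ab.
  move=> s; rewrite -eq_le => /eqP <-; apply: H1; first by rewrite lexx ab.
  by move=> r /andP[/le_lt_trans h /h]; rewrite ltxx.
have hS : has_sup S by split; [exists a|exists b => x [/andP[]]].
have Sm : forall s, a <= s < sup S -> P s.
  move=> s /andP[as_ sm].
  have sm' : 0 < sup S - s by rewrite subr_gt0.
  have [x [xab xP] sx] := sup_adherent sm' hS.
  by apply: xP; rewrite as_ /=; move: sx; rewrite opprB addrC subrK; exact: ltW.
have am : a <= sup S by apply: ub_le_sup => //; case: hS.
have mb : sup S <= b by apply: ge_sup; [exists a|move=> x [/andP[]]].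
have Pm : P (sup S) by apply: H1 => //; rewrite am mb.
have SP : forall s, a <= s <= sup S -> P s.
  move=> s /andP[as_]; rewrite le_eqVlt => /orP[/eqP ->//|sm].
  by apply: Sm; rewrite as_.
have [mb'|bm] := ltP (sup S) b; last first.
  by apply: SP; case/andP: tab => -> /le_trans; apply.
have [|d d0 dP] := H2 (sup S) _ SP; first by rewrite am.
pose x := Num.min b (sup S + d / 2).
have xm : sup S < x by rewrite lt_min mb' ltrDl half_gt0.
have : S x.
  split; first by rewrite (le_trans am (ltW xm)) ge_min lexx.
  move=> s /andP[as_ sx]; have [sm|ms] := leP s (sup S); first by apply: SP; rewrite as_.
  move: sx; rewrite le_min => /andP[sb sx].
  apply: dP => //; rewrite ms (le_lt_trans sx)// ltrD2l ltr_pdivrMr// ltr_pMr//.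
  by rewrite ltr1n.
move=> /(ub_le_sup (_ : has_ubound S)); rewrite leNgt xm => h.
by have := h (proj2 hS).
Qed.

(** With [T := Prop] it propagates a property along a curve, such as lying on a given leaf or the
    agreement of two lifts. *)
Lemma loc_const (T : Type) (g : R -> T) (a b : R) :
  (forall t, a <= t <= b -> exists2 d, 0 < d & forall s, a <= s <= b ->
    `|s - t| < d -> g s = g t) ->
  forall t, a <= t <= b -> g t = g a.
Proof.
move=> H; apply: real_ind => [t tab IH|t tab IH].
- have [d d0 dP] := H t tab.
  have [a_t|ta] := ltP a t; last first.
    by congr g; apply/eqP; rewrite eq_le ta; case/andP: tab.
  pose s := Num.max a (t - d / 2).
  have st : s < t by rewrite gt_max a_t/= ltrBlDr ltrDl half_gt0.
  have as_ : a <= s by rewrite le_max lexx.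
  rewrite -(IH s) ?as_ ?st//; symmetry; apply: dP.
    by rewrite as_ (le_trans (ltW st))//; case/andP: tab.
  rewrite distrC gtr0_norm ?subr_gt0//.
  have : t - d / 2 <= s by rewrite le_max lexx orbT.
  by move: d0; clear; lra.
- have [|d d0 dP] := H t; first by case/andP: tab => -> /ltW ->.
  have ta : a <= t by case/andP: tab.
  exists d => // s /andP[ts sd] sb; rewrite -(IH t) ?ta ?lexx//; apply: dP.
    by rewrite sb (le_trans ta (ltW ts)).
  by rewrite gtr0_norm ?subr_gt0// ltrBlDl.
Qed.

(** Real induction on the right end, appending one short interval at a time. It replaces finite
    subdivisions of a segment when lifting paths, building primitives and comparing lengths. *)
Lemma cousin (P : R -> R -> Prop) (a b : R) :
  (forall x y z, a <= x -> x <= y -> y <= z -> z <= b ->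
     P x y -> P y z -> P x z) ->
  (forall t, a <= t <= b -> exists2 d, 0 < d & forall x y, a <= x -> x <= y ->
    y <= b -> `|x - t| < d -> `|y - t| < d -> P x y) ->
  a <= b -> P a b.
Proof.
move=> Pt Pl ab.
suff : forall t, a <= t <= b -> P a t by apply; rewrite ab lexx.
have tt (t d : R) : 0 < d -> `|t - t| < d by rewrite subrr normr0.
apply: real_ind => [t tab IH|t tab IH].
- have [d d0 dP] := Pl t tab; have [ta tb] := andP tab.
  pose s := Num.max a (t - d / 2).
  have st : s <= t by rewrite ge_max ta/= lerBlDr lerDl ltW ?half_gt0.
  have as_ : a <= s by rewrite le_max lexx.
  have sd : `|s - t| < d.
    rewrite distrC ger0_norm ?subr_ge0//.
    have : t - d / 2 <= s by rewrite le_max lexx orbT.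
    by move: d0; clear; lra.
  have Pst : P s t by apply: dP => //; exact: tt.
  move: st; rewrite le_eqVlt => /orP[/eqP st|st].
    have sa : s = a.
      have [/= h|h] := leP (t - d / 2) a; first by rewrite /s max_l.
      have : s = t - d / 2 by rewrite /s max_r// ltW.
      by move: d0 st; clear; lra.
    by rewrite -sa.
  by apply: (Pt _ s) => //; [exact: ltW|apply: IH; rewrite as_].
- have [ta /ltW tb] := andP tab; have [|d d0 dP] := Pl t; first by rewrite ta.
  exists d => // s /andP[ts sd] sb; apply: (Pt _ t) => //; first exact: ltW.
    by apply: IH; rewrite ta lexx.
  apply: dP => //; [exact: ltW|exact: tt|].
  by rewrite gtr0_norm ?subr_gt0// ltrBlDl.
Qed.

Section linear_rV.
Context (W : normedModType R) (n : nat) (L : 'rV[R]_n -> W).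
Hypothesis Ll : forall a u v, L (a *: u + v) = a *: L u + L v.

Lemma lin_rVE v : L v = \sum_i v 0 i *: L (delta_mx 0 i).
Proof.
rewrite [v in LHS]row_sum_delta.
elim/big_rec2: _ => [|i y1 y2 _ IH]; first exact: lin0.
by rewrite Ll IH.
Qed.

Lemma lin_rV_bounded : exists2 K : R, 0 < K & forall v, `|L v| <= K * `|v|.
Proof.
exists (1 + \sum_i `|L (delta_mx 0 i)|).
  by rewrite ltr_wpDr// sumr_ge0.
move=> v; rewrite [in leLHS]lin_rVE (le_trans (ler_norm_sum _ _ _))//.
rewrite mulrDl mul1r mulr_suml ler_wpDl// ler_sum// => i _.
by rewrite normrZ mulrC ler_wpM2l// rV_norm_ge.
Qed.

End linear_rV.

Lemma lin_left_inverse k n (L : 'rV[R]_k -> 'rV[R]_n) :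
  (forall a u v, L (a *: u + v) = a *: L u + L v) ->
  (forall v, L v = 0 -> v = 0) ->
  exists2 J : 'rV[R]_n -> 'rV[R]_k,
    (forall a u v, J (a *: u + v) = a *: J u + J v) & cancel L J.
Proof.
move=> Ll Li; pose M : 'M[R]_(k, n) := \matrix_i L (delta_mx 0 i).
have LM v : L v = v *m M.
  rewrite (lin_rVE Ll) mulmx_sum_row; apply: eq_bigr => i _.
  by rewrite rowK.
have /row_freeP[B MB] : row_free M.
  by apply: inj_row_free => v; rewrite -LM; exact: Li.
exists (fun w => w *m B) => [a u v|v]; first by rewrite mulmxDl scalemxAl.
by rewrite LM -mulmxA MB mulmx1.
Qed.

(** Immersions reflect strict derivatives of continuous curves. Applied to an increment of [f \o s],
    the left inverse [J] gives the increment of [s] up to at most half of itself; absorbing that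
    half yields the Lipschitz bound [ss], after which the same error is negligible. *)
Lemma sderiv_inverse (V W : normedModType R) (f : V -> W) (s : R -> V) (t : R)
    (v : W) (L : V -> W) (J : W -> V) :
  sdiff f (s t) L -> (forall a u v, J (a *: u + v) = a *: J u + J v) ->
  (exists2 K, 0 < K & forall w, `|J w| <= K * `|w|) -> cancel L J ->
  {for t, continuous s} -> sderiv (f \o s) t v -> sderiv s t (J v).
Proof.
move=> [Ll _ fL] Jl [C C0 JC] LJ /contP cs fv e e0.
have v1 : 0 < `|v| + 1 by rewrite ltr_wpDl.
pose e1 := Num.min (1 / 2 / C) (e / 2 / (2 * C * C * (`|v| + 1))).
have e10 : 0 < e1 by rewrite lt_min !divr_gt0// ?mulr_gt0.
have [d1 d10 H1] := fL _ e10.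
have [d2 d20 H2] := cs _ d10.
pose e2 := Num.min 1 (e / 2 / C).
have e20 : 0 < e2 by rewrite lt_min ltr01 !divr_gt0.
have [d3 d30 H3] := fv _ e20.
exists (Num.min d2 d3); first by rewrite lt_min d20.
move=> a b; rewrite !lt_min => /andP[a2 a3] /andP[b2 b3].
have {}H1 := H1 _ _ (H2 _ a2) (H2 _ b2).
have {}H3 := H3 _ _ a3 b3; rewrite /= in H3.
set D := f (s a) - f (s b) in H1 H3.
have K1 : `|J D - (s a - s b)| <= C * (e1 * `|s a - s b|).
  rewrite -[s a - s b in leLHS]LJ -(linB Jl); apply: le_trans (JC _) _.
  by rewrite ler_pM2l.
have K3 : `|J D - (a - b) *: J v| <= C * (e2 * `|a - b|).
  rewrite -(linZ Jl) -(linB Jl); apply: le_trans (JC _) _.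
  by rewrite ler_pM2l.
have Ce1 : C * e1 <= 1 / 2.
  by rewrite mulrC -ler_pdivlMr// ge_min lexx.
have DD : `|D| <= (`|v| + 1) * `|a - b|.
  rewrite -[D](subrK ((a - b) *: v)) (le_trans (ler_normD _ _))// mulrDl addrC.
  rewrite normrZ mulrC lerD2l//; apply: le_trans H3 _.
  by rewrite ler_wpM2r// ge_min lexx.
have ss : `|s a - s b| <= 2 * (C * (`|v| + 1)) * `|a - b|.
  have h1 : `|s a - s b| <= `|J D| + 1 / 2 * `|s a - s b|.
    rewrite -[s a - s b in leLHS](subrK (J D)) (le_trans (ler_normD _ _))//.
    rewrite addrC lerD2l// distrC; apply: le_trans K1 _.
    by rewrite mulrA ler_wpM2r.
  have h2 : `|J D| <= C * (`|v| + 1) * `|a - b|.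
    by apply: le_trans (JC _) _; rewrite -mulrA ler_pM2l.
  by move: h1 h2; rewrite -!mulrA; move: (C * _) => X; lra.
have -> : s a - s b - (a - b) *: J v =
    (J D - (a - b) *: J v) - (J D - (s a - s b)) by zmod.
apply: le_trans (ler_normB _ _) _; rewrite (splitr e) mulrDl lerD//.
- apply: le_trans K3 _; rewrite mulrA ler_wpM2r// mulrC -ler_pdivlMr//.
  by rewrite ge_min lexx orbT.
- apply: le_trans K1 _; apply: (@le_trans _ _ (C * (e1 * (2 * (C * (`|v| + 1)) * `|a - b|)))).
    by rewrite ler_pM2l// ler_pM2l.
  rewrite !mulrA ler_wpM2r//.
  have : e1 * (2 * C * C * (`|v| + 1)) <= e / 2.
    by rewrite -ler_pdivlMr ?mulr_gt0// ge_min lexx orbT.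
  by congr (_ <= _); ring.
Qed.

(** * From continuous partial derivatives to strict differentiability *)

Section Ck.
Context (n : nat) (W : normedModType R).
Hypothesis mvW : mean_value W.

Lemma Ck_family_sdiff (T : topologicalType) m U (h : 'rV[R]_n -> T -> W) s0 y0 :
  Ck_family m.+1 U h -> nbhs (s0, y0) U ->
  sdiff (h ^~ y0) s0 (fun v => 'D_v (h ^~ y0) s0) /\
  forall e : R, 0 < e -> exists2 d : R, 0 < d &
    \forall y \near y0, forall a b, `|a - s0| < d -> `|b - s0| < d ->
      `|h a y - h b y - 'D_(a - b) (h ^~ y0) s0| <= e * `|a - b|.
Proof.
move=> [_ hU] U0.
pose L (v : 'rV[R]_n) := \sum_i v 0 i *: 'D_(delta_mx 0 i) (h ^~ y0) s0.
have Ll a u v : L (a *: u + v) = a *: L u + L v.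
  rewrite /L scaler_sumr -big_split; apply: eq_bigr => i _ /=.
  by rewrite !mxE scalerDl scalerA.
have H (e : R) : 0 < e -> exists2 d : R, 0 < d &
    \forall y \near y0, forall a b, `|a - s0| < d -> `|b - s0| < d ->
      `|h a y - h b y - L (a - b)| <= e * `|a - b|.
  apply: C1_sdiff_family => //.
    by apply: filterS U0 => z Uz i; have [+ _] := hU i; exact.
  move=> i; have [_] := hU i; case: m {hU} => [|m] [+ _]; apply; exact: nbhs_singleton U0.
have sL : sdiff (h ^~ y0) s0 L.
  split=> //; first exact: lin_rV_bounded.
  move=> e /H[d d0 /nbhs_singleton dP]; by exists d.
have LE v : L v = 'D_v (h ^~ y0) s0 by have [_ <-] := sdiff_is_derive v sL.
have <- : L = (fun v => 'D_v (h ^~ y0) s0) by apply/funext.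
split=> // e /H[d d0 dP]; exists d => //; apply: filterS dP => y yP a b ad bd.
by rewrite -LE; exact: yP.
Qed.

Lemma Ck_sdiff m (U : set 'rV[R]_n) (h : 'rV[R]_n -> W) s0 :
  Ck m.+1 U h -> nbhs s0 U -> sdiff h s0 (fun v => 'D_v h s0).
Proof.
move=> hU U0.
(* A single map is seen as a constant family over a dummy parameter. *)
have : Ck_family m.+1 [set z : 'rV[R]_n * R | U z.1] (fun s _ => h s).
  elim: m.+1 h hU => {m} [|m IH] h /= [h0 hU]; split.
  - by move=> z Uz; apply: (@continuous_comp _ _ _ fst h); [exact: cvg_fst|exact: h0].
  - by [].
  - by move=> z Uz; apply: (@continuous_comp _ _ _ fst h); [exact: cvg_fst|exact: h0].
  - move=> i; have [dh Dh] := hU i; split; first by move=> z; exact: dh.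
    exact: IH.
move=> /(@Ck_family_sdiff _ _ _ _ s0 0)[]//.
by exists (U, setT) => [|z []//]; split=> //; exact: filterT.
Qed.

End Ck.

Lemma sderiv_C1 k (c : R -> 'rV[R]_k) t :
  (\near t, derivable c t 1) -> {for t, continuous (derive1 c)} ->
  sderiv c t (derive1 c t).
Proof.
move=> /nbhs_dist[d d0 cd] /contP cc e e0.
have [d' d'0 H] := cc _ e0.
exists (Num.min d d'); first by rewrite lt_min d0.
have main a b : a <= b -> `|a - t| < Num.min d d' -> `|b - t| < Num.min d d' ->
    `|c b - c a - (b - a) *: c^`()%classic t| <= e * (b - a).
  move=> ab ad bd.
  have xd x : a <= x <= b -> `|x - t| < Num.min d d'.
    move: ad bd; rewrite !ltr_norml => /andP[a1 a2] /andP[b1 b2] /andP[x1 x2].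
    by apply/andP; split; lra.
  have -> : c b - c a - (b - a) *: c^`()%classic t =
    (c b - b *: c^`()%classic t) - (c a - a *: c^`()%classic t) by zmod.
  apply: (@mean_value_rV k (fun x => c x - x *: c^`()%classic t)
    (fun x => c^`()%classic x - c^`()%classic t)) => // x /xd; rewrite lt_min => /andP[x1 x2].
    have H1 : is_derive x (1 : R) c (c^`()%classic x).
      by rewrite derive1E; apply/derivableP; exact: cd.
    have H2 : is_derive x (1 : R) (fun x : R => x *: c^`()%classic t) (c^`()%classic t).
      exact/sderiv_is_derive/sderiv_scalel.
    exact: is_deriveB.
  exact: ltW (H _ x2).
move=> a b ad bd; have [ab|/ltW ba] := leP a b; last first.
  by rewrite (ger0_norm (_ : 0 <= a - b)) ?subr_ge0//; exact: main.
rewrite (ler0_norm (_ : a - b <= 0)) ?subr_le0// opprB.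
have -> : c a - c b - (a - b) *: c^`()%classic t =
    - (c b - c a - (b - a) *: c^`()%classic t) by zmod.
by rewrite normrN; exact: main.
Qed.

End calculus.

(** * Charts and metrics *)

Section charts.
Context {R : realType} {n r : nat} {M : topologicalType} (A : atlas R n r.+2 M).
Implicit Types (p q x : M) (c : R -> M).

Lemma chart_nbhs p x (N : set M) : dom A p x -> nbhs x N ->
  nbhs (coord A p x) (coord A p @` (dom A p `&` N)).
Proof.
move=> px Nx.
have H1 : nbhs (coord A p x) (coord A p @` dom A p).
  by apply: open_nbhs_nbhs; split; [exact: coord_open|exists x].
have H2 : nbhs (coord A p x) (param A p @^-1` N).
  by apply: (param_continuous px); rewrite coordK.
apply: filterS2 H1 H2 => s [y py <-]; rewrite /preimage /= coordK// => Ny.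
by exists y.
Qed.

Lemma dom_nbhs p x : dom A p x -> nbhs x (dom A p).
Proof. by move=> px; apply: open_nbhs_nbhs; split => //; exact: dom_open. Qed.

Definition transition p q x v : 'rV[R]_n :=
  'D_v (fun s => coord A q (param A p s)) (coord A p x).

Lemma transition_sdiff p q x : dom A p x -> dom A q x ->
  sdiff (fun s => coord A q (param A p s)) (coord A p x) (transition p q x).
Proof.
move=> px qx; apply: Ck_sdiff (transition_Ck A p q) _; first exact: mean_value_rV.
by apply: chart_nbhs => //; exact: dom_nbhs.
Qed.

Lemma transition_lin p q x : dom A p x -> dom A q x ->
  forall a u v, transition p q x (a *: u + v) =
    a *: transition p q x u + transition p q x v.
Proof. by move=> px qx; have [] := transition_sdiff px qx. Qed.

Lemma transition_id p x v : dom A p x -> transition p p x v = v.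
Proof.
move=> px; apply: (sdiff_unique (transition_sdiff px px) (L' := id)).
apply: (@sdiff_near _ _ _ id); last first.
  have := chart_nbhs px (@filterT _ (nbhs x) (nbhs_filter x)).
  by apply: filterS => s [y [py _] <-]; rewrite coordK.
split=> //; first by exists 1 => // w; rewrite mul1r.
move=> e e0; exists 1 => // a b _ _.
by rewrite subrr normr0 mulr_ge0// ltW.
Qed.

Lemma transition_comp p q q' x v : dom A p x -> dom A q x -> dom A q' x ->
  transition q q' x (transition p q x v) = transition p q' x v.
Proof.
move=> px qx qx'.
have E : coord A q (param A p (coord A p x)) = coord A q x by rewrite coordK.
have H2 := transition_sdiff qx qx'; rewrite -E in H2.
have H := sdiff_comp (transition_sdiff px qx) H2.
apply: (sdiff_unique (f := fun s => coord A q' (param A p s)) (x := coord A p x)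
   (L := transition q q' x \o transition p q x)).
  apply: sdiff_near H _.
  have := chart_nbhs px (dom_nbhs qx).
  by apply: filterS => s [y [py qy] <-] /=; rewrite (coordK py) (coordK qy).
exact: transition_sdiff.
Qed.

(* Strict derivative of a curve, with the tangent vector read in the chart
   attached to the base point. *)
Definition mderiv c t (v : 'rV[R]_n) :=
  {for t, continuous c} /\ sderiv (fun t' => coord A (c t) (c t')) t v.

Lemma continuous_near c t (N : set M) : {for t, continuous c} -> nbhs (c t) N ->
  \forall t' \near t, N (c t').
Proof. by move=> ct Nc; exact: ct. Qed.

Lemma mderiv_chart q c t v : dom A q (c t) -> mderiv c t v ->
  sderiv (fun t' => coord A q (c t')) t (components A q (c t) v).
Proof.
move=> qc [ct cv].
have H := sderiv_comp cv (transition_sdiff (dom_center A (c t)) qc).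
apply: sderiv_near H _.
have := continuous_near ct (dom_nbhs (dom_center A (c t))).
by apply: filterS => t' h /=; rewrite coordK.
Qed.

Lemma mderiv_unique c t v w : mderiv c t v -> mderiv c t w -> v = w.
Proof. by move=> [_ +] [_]; exact: sderiv_unique. Qed.

Lemma mderiv_near c c' t v : mderiv c t v -> (\near t, c t = c' t) ->
  mderiv c' t v.
Proof.
move=> [ct cv] cc'; have E := nbhs_singleton cc'; split.
  rewrite /prop_for /continuous_at -E; apply: cvg_trans ct.
  by apply: near_eq_cvg; apply: filterS cc' => t' ->.
rewrite -E; apply: sderiv_near cv _.
by apply: filterS cc' => t' ->.
Qed.

Lemma mderiv_velocity c t v : mderiv c t v -> velocity A c t = v.
Proof.
move=> [_ /sderiv_is_derive cv]; rewrite /velocity derive1E.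
by have [_ <-] := cv.
Qed.

(** Turns the curves that define the distance, given by continuous derivatives in all charts, into
    curves with a strict derivative at each time, which compose and glue. *)
Lemma C1_curveP c : C1_curve A c <->
  continuous c /\ forall t, exists v, mderiv c t v.
Proof.
split=> -[cc H]; split=> //.
- move=> t; exists (derive1 (fun t' => coord A (c t) (c t')) t); split; first exact: cc.
  apply: sderiv_C1; last by have [] := H (c t) t (dom_center A (c t)).
  have := continuous_near (cc t) (dom_nbhs (dom_center A (c t))).
  by apply: filterS => t' ht'; exact: (H (c t) t' ht').1.
- move=> p t pct.
  have sd : \forall t' \near t, sderiv (fun t' => coord A p (c t')) t'
      (derive1 (fun t' => coord A p (c t')) t').
    have := continuous_near (cc t) (dom_nbhs pct).
    apply: filterS => t' pt'; have [v cv] := H t'.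
    have D := mderiv_chart pt' cv; have := sderiv_is_derive D.
    by rewrite derive1E => -[_ ->].
  split; last exact: (@sderiv_continuous_derive R _ (fun t' => coord A p (c t')) _ t sd).
  by have [] := sderiv_is_derive (nbhs_singleton sd).
Qed.

Section maps.
Variables (h : M -> M) (hC : Ck_map A r.+1 h).

Lemma map_sdiff p q x : dom A p x -> dom A q (h x) ->
  sdiff (fun s => coord A q (h (param A p s))) (coord A p x)
    (fun v => 'D_v (fun s => coord A q (h (param A p s))) (coord A p x)).
Proof.
case: hC => hc hk px qhx; apply: Ck_sdiff (hk p q) _; first exact: mean_value_rV.
apply: chart_nbhs => //; exact: hc (dom_nbhs qhx).
Qed.

Lemma tangent_map_lin x a u v : tangent_map A h x (a *: u + v) =
  a *: tangent_map A h x u + tangent_map A h x v.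
Proof.
have [Ll _ _] := map_sdiff (dom_center A x) (dom_center A (h x)); exact: Ll.
Qed.

Lemma mderiv_map c t v : mderiv c t v ->
  mderiv (h \o c) t (tangent_map A h (c t) v).
Proof.
move=> [ct cv]; split.
  by apply: continuous_comp; [exact: ct|exact: hC.1].
have H := sderiv_comp cv (map_sdiff (dom_center A (c t)) (dom_center A (h (c t)))).
apply: sderiv_near H _.
have := continuous_near ct (dom_nbhs (dom_center A (c t))).
by apply: filterS => t' ht' /=; rewrite coordK.
Qed.

End maps.

Lemma tangent_map_comp h h' x v : Ck_map A r.+1 h -> Ck_map A r.+1 h' ->
  Ck_map A r.+1 (h' \o h) ->
  tangent_map A h' (h x) (tangent_map A h x v) = tangent_map A (h' \o h) x v.
Proof.
move=> hC hC' hhC; have xx := dom_center A x.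
have H1 := map_sdiff hC xx (dom_center A (h x)).
have H2 := map_sdiff hC' (dom_center A (h x)) (dom_center A (h' (h x))).
have E : coord A (h x) (h (param A x (coord A x x))) = coord A (h x) (h x).
  by rewrite coordK.
rewrite -[X in sdiff _ X]E in H2.
have H := sdiff_comp H1 H2.
have H3 := map_sdiff hhC xx (dom_center A ((h' \o h) x)).
have E3 := @sdiff_near _ _ _ _ (fun s => coord A ((h' \o h) x) ((h' \o h) (param A x s))) _ _ H.
apply: (sdiff_unique (E3 _) H3 v).
have := chart_nbhs xx (hC.1 _ _ (dom_nbhs (dom_center A (h x)))).
by apply: filterS => s [y [py qy] <-] /=; rewrite (coordK py) (coordK qy).
Qed.

Lemma tangent_map_id x v : tangent_map A id x v = v.
Proof. exact: transition_id (dom_center A x). Qed.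

End charts.

(** * The Riemannian metric in coordinates *)

Section metric.
Context {R : realType} {n r : nat} {M : topologicalType} (A : atlas R n r.+2 M).
Variables (g : M -> 'M[R]_n).
Implicit Types (x : M) (u v w : 'rV[R]_n).

Lemma innerDl x a u v w : inner g x (a *: u + v) w = a * inner g x u w + inner g x v w.
Proof. by rewrite /inner mulmxDl mulmxDl mxE -!scalemxAl mxE. Qed.

Lemma innerDr x a u v w : inner g x w (a *: u + v) = a * inner g x w u + inner g x w v.
Proof. by rewrite /inner linearD linearZ /= mulmxDr -scalemxAr !mxE. Qed.

Lemma inner_addl x u v w : inner g x (u + v) w = inner g x u w + inner g x v w.
Proof. by rewrite -{1}[u]scale1r innerDl mul1r. Qed.

Lemma inner_addr x u v w : inner g x w (u + v) = inner g x w u + inner g x w v.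
Proof. by rewrite -{1}[u]scale1r innerDr mul1r. Qed.

Lemma inner0l x v : inner g x 0 v = 0.
Proof. by rewrite /inner !mul0mx mxE. Qed.

Lemma inner0r x v : inner g x v 0 = 0.
Proof. by rewrite /inner trmx0 mulmx0 mxE. Qed.

Lemma innerZl x a u w : inner g x (a *: u) w = a * inner g x u w.
Proof. by rewrite -{1}[a *: u]addr0 innerDl inner0l addr0. Qed.

Lemma innerZr x a u w : inner g x w (a *: u) = a * inner g x w u.
Proof. by rewrite -{1}[a *: u]addr0 innerDr inner0r addr0. Qed.

Hypothesis gR : riemannian_metric A r.+1 g.

Lemma innerC x u v : inner g x u v = inner g x v u.
Proof.
case: gR => gs _ _; rewrite /inner.
rewrite -[in LHS](trmxK (u *m g x *m v^T)) mxE !trmx_mul trmxK gs mulmxA.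
by [].
Qed.

Lemma inner_ge0 x v : 0 <= inner g x v v.
Proof.
have [->|v0] := eqVneq v 0; first by rewrite inner0l.
by case: gR => _ gp _; exact/ltW/gp.
Qed.

Lemma tnorm_ge0 x v : 0 <= tnorm g x v.
Proof. exact: sqrtr_ge0. Qed.

Lemma tnorm_sqr x v : tnorm g x v ^+ 2 = inner g x v v.
Proof. by rewrite sqr_sqrtr// inner_ge0. Qed.

Lemma tnorm0 x : tnorm g x 0 = 0.
Proof. by rewrite /tnorm inner0l sqrtr0. Qed.

Lemma tnormZ x a v : tnorm g x (a *: v) = `|a| * tnorm g x v.
Proof.
by rewrite /tnorm innerZl innerZr mulrA -expr2 sqrtrM ?sqr_ge0// sqrtr_sqr.
Qed.

Lemma tnorm_orth x u v : inner g x u v = 0 ->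
  tnorm g x (u + v) ^+ 2 = tnorm g x u ^+ 2 + tnorm g x v ^+ 2.
Proof.
move=> uv; rewrite !tnorm_sqr inner_addl !inner_addr (innerC x v u) uv.
by rewrite addr0 add0r.
Qed.

Lemma inner_CS x u w : inner g x w u ^+ 2 <= inner g x w w * inner g x u u.
Proof.
have [->|u0] := eqVneq u 0; first by rewrite innerC !inner0l mulr0 expr0n.
have up : 0 < inner g x u u by case: gR => _ gp _; exact: gp.
have := inner_ge0 x (inner g x u u *: w + (- inner g x w u) *: u).
rewrite inner_addl !inner_addr !innerZl !innerZr (innerC x u w).
set a := inner g x u u; set b := inner g x w u; set c := inner g x w w => H.
by rewrite -(ler_pM2l up) -/a; nra.
Qed.

Lemma inner_unitmx x : g x \in unitmx.
Proof.
rewrite -row_free_unit; apply: inj_row_free => v vg; apply/eqP.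
apply: contraT => v0; case: gR => _ gp _; have := gp x v v0.
by rewrite /inner vg mul0mx mxE ltxx.
Qed.

(** Each coordinate of [w] is its inner product with a fixed vector [u i], so Cauchy-Schwarz bounds
    it; no compactness of the unit sphere is involved. *)
Lemma inner_lower x : exists2 k : R, 0 < k & forall w, k * `|w| ^+ 2 <= inner g x w w.
Proof.
pose u i : 'rV[R]_n := delta_mx 0 i *m invmx (g x).
have wi w i : w 0 i = inner g x w (u i).
  by rewrite innerC /inner /u mulmxKV ?inner_unitmx// -rowE !mxE.
pose K := 1 + \sum_i inner g x (u i) (u i).
have K1 : 0 < K by rewrite ltr_wpDr// sumr_ge0// => i _; exact: inner_ge0.
exists K^-1; first by rewrite invr_gt0.
move=> w; rewrite ler_pdivrMl//.
have Kw : 0 <= K * inner g x w w by rewrite mulr_ge0 ?inner_ge0// ltW.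
have : `|w| <= Num.sqrt (K * inner g x w w).
  apply: rV_norm_le => [|i]; first exact: sqrtr_ge0.
  rewrite -sqrtr_sqr ler_sqrt//.
  rewrite wi; apply: le_trans (inner_CS _ _ _) _.
  rewrite mulrC ler_wpM2r ?inner_ge0//.
  rewrite /K (bigD1 i)//= addrCA lerDl addr_ge0// sumr_ge0// => j _.
  exact: inner_ge0.
move=> h; rewrite -(sqr_sqrtr Kw) lerXn2r ?nnegrE ?sqrtr_ge0//.
Qed.

(** The coefficients g_ij of the metric in the chart at [q], as functions of the point. *)
Definition gcoef q x i j := inner g x (from_components A q x (delta_mx 0 i))
  (from_components A q x (delta_mx 0 j)).

Lemma gcoef_continuous q x i j : dom A q x -> {for x, continuous (fun x => gcoef q x i j)}.
Proof.
move=> qx; case: gR => _ _ /(_ q (delta_mx 0 i) (delta_mx 0 j)) [/= gc _].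
have H := gc (coord A q x) (ex_intro2 _ _ x qx erefl).
have H' : {for x, continuous ((fun s => gcoef q (param A q s) i j) \o coord A q)}.
  by apply: continuous_comp; [exact: coord_continuous|exact: H].
apply: continuous_near_eq H' _.
by apply: filterS (dom_nbhs qx) => y qy /=; rewrite coordK.
Qed.

Lemma inner_coef q x w w' : dom A q x ->
  inner g x (from_components A q x w) (from_components A q x w') =
  \sum_i \sum_j w 0 i * w' 0 j * gcoef q x i j.
Proof.
move=> qx; have fl := transition_lin qx (dom_center A x).
pose Lw (v : 'rV[R]_n) : R^o := inner g x (from_components A q x v) (from_components A q x w').
have Ll a u v : Lw (a *: u + v) = a *: Lw u + Lw v.
  by rewrite /Lw [from_components _ _ _ _]fl innerDl.
rewrite -/(Lw w) (lin_rVE Ll); apply: eq_bigr => i _.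
pose Lv (v : 'rV[R]_n) : R^o := inner g x (from_components A q x (delta_mx 0 i)) (from_components A q x v).
have Ll' a u v : Lv (a *: u + v) = a *: Lv u + Lv v.
  by rewrite /Lv [from_components _ _ _ (_ + _)]fl innerDr.
rewrite /Lw -/(Lv w') (lin_rVE Ll') scaler_sumr; apply: eq_bigr => j _.
by rewrite scalerA.
Qed.

(** The lower bound at [q] survives nearby because the coefficients vary continuously: each moves by
    at most [e], and all of them together change the quadratic form by at most half of that
    bound. *)
Lemma metric_equiv q : exists k K : R, [/\ 0 < k, 0 < K & \forall x \near q, forall w,
  k * `|w| <= tnorm g x (from_components A q x w) <= K * `|w|].
Proof.
have qq := dom_center A q.
have [k k0 kw] := inner_lower q.
pose N : R := n%:R * n%:R + 1.
have N0 : 0 < N by rewrite ltr_wpDl// mulr_ge0.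
pose e := k / 2 / N.
have e0 : 0 < e by rewrite !divr_gt0.
pose S := k / 2 + \sum_i \sum_j `|gcoef q q i j|.
have S0 : 0 < S.
  by rewrite ltr_wpDr ?half_gt0// sumr_ge0// => i _; rewrite sumr_ge0.
exists (Num.sqrt (k / 2)), (Num.sqrt S); split; rewrite ?sqrtr_gt0 ?half_gt0//.
have : \forall x \near q, dom A q x /\ forall i j, `|gcoef q x i j - gcoef q q i j| <= e.
  apply: filterI; first exact: dom_nbhs.
  apply: (@filter_forall _ _ (fun i x => forall j, `|gcoef q x i j - gcoef q q i j| <= e) (nbhs q)) => i.
  apply: (@filter_forall _ _ (fun j x => `|gcoef q x i j - gcoef q q i j| <= e) (nbhs q)) => j.
  exact: (cont_near (W := R) (@gcoef_continuous q q i j qq)).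
apply: filterS => x [qx H] w.
have wij i j : `|w 0 i * w 0 j| <= `|w| ^+ 2.
  by rewrite normrM expr2 ler_pM// rV_norm_ge.
have bq : inner g q w w = \sum_i \sum_j w 0 i * w 0 j * gcoef q q i j.
  rewrite -inner_coef//.
  by rewrite /from_components -/(transition A q q q w) transition_id.
have D : `|inner g x (from_components A q x w) (from_components A q x w) - inner g q w w|
    <= k / 2 * `|w| ^+ 2.
  rewrite inner_coef// bq -sumrB; apply: le_trans (ler_norm_sum _ _ _) _.
  apply: (@le_trans _ _ (\sum_(i < n) \sum_(j < n) `|w| ^+ 2 * e)).
    apply: ler_sum => i _; rewrite -sumrB; apply: le_trans (ler_norm_sum _ _ _) _.
    by apply: ler_sum => j _; rewrite -mulrBr normrM ler_pM.
  rewrite !sumr_const !card_ord -mulrnA -[leLHS]mulr_natr natrM.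
  have -> : `|w| ^+ 2 * e * (n%:R * n%:R) = (e * (n%:R * n%:R)) * `|w| ^+ 2 by ring.
  rewrite ler_wpM2r ?sqr_ge0// /e mulrAC ler_pdivrMr//.
  by rewrite ler_wpM2l ?lerDl// ltW// half_gt0.
have U : inner g q w w <= (\sum_i \sum_j `|gcoef q q i j|) * `|w| ^+ 2.
  rewrite bq mulr_suml ler_sum// => i _; rewrite mulr_suml ler_sum// => j _.
  by rewrite mulrC (le_trans (ler_norm _))// normrM ler_wpM2l.
have L := kw w.
have nE : `|w| = Num.sqrt (`|w| ^+ 2) by rewrite sqrtr_sqr normr_id.
have k2 : 0 <= k / 2 by rewrite ltW// half_gt0.
rewrite /tnorm nE -(sqrtrM _ k2) -(sqrtrM _ (ltW S0)).
move: D; rewrite ler_norml => /andP[D1 D2].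
apply/andP; split; apply: ler_wsqrtr; first by lra.
by rewrite /S mulrDl; lra.
Qed.

(** The chart at the base point moves with the curve, so the speed is rewritten in the fixed chart
    at [c t], where the components of the velocity and the metric coefficients are continuous. *)
Lemma speed_continuous (c : R -> M) (v : R -> 'rV[R]_n) t :
  (\near t, mderiv A c t (v t)) -> {for t, continuous (fun t => tnorm g (c t) (v t))}.
Proof.
move=> cv; have [ct _] := nbhs_singleton cv.
pose q := c t; have qq : dom A q (c t) := dom_center A q.
have cq := continuous_near ct (dom_nbhs qq).
pose w t := components A q (c t) (v t).
have wc : {for t, continuous w}.
  apply: (@sderiv_continuous_derive _ _ (fun t' => coord A q (c t'))).
  by apply: filterS2 cv cq => s cvs qs; exact: mderiv_chart.
have E : \forall s \near t, inner g (c s) (v s) (v s) =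
    \sum_i \sum_j w s 0 i * w s 0 j * gcoef q (c s) i j.
  apply: filterS cq => s qs; rewrite -inner_coef//.
  suff -> : from_components A q (c s) (w s) = v s by [].
  rewrite /from_components /w /components.
  rewrite -/(transition A (c s) q (c s) (v s)) -/(transition A q (c s) (c s) _).
  by rewrite transition_comp ?transition_id//; exact: dom_center.
have cont : {for t, continuous (fun s => \sum_i \sum_j w s 0 i * w s 0 j * gcoef q (c s) i j)}.
  have wi i : {for t, continuous (fun s => w s 0 i)}.
    by apply: (@continuous_comp _ _ _ w (fun u : 'rV[R]_n => u 0 i)) => //;
      exact: matrix_normedtype.coord_continuous.
  apply: continuous_sumr => i; apply: continuous_sumr => j.
  apply: (@continuousM R _ (fun s => w s 0 i * w s 0 j)).
    exact: (@continuousM R _ (fun s => w s 0 i)).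
  apply: (@continuous_comp _ _ _ c (fun x => gcoef q x i j)) => //.
  exact: gcoef_continuous.
apply: (@continuous_comp _ _ _ (fun s => inner g (c s) (v s) (v s)) (@Num.sqrt R)).
  by apply: continuous_near_eq cont _; apply: filterS E => s ->.
exact: sqrt_continuous.
Qed.

End metric.

(** * Leaf topology *)

Section leaves.
Context {R : realType} {n r : nat} {M : topologicalType} (A : atlas R n r.+2 M).
Context {k l m : nat} (F : foliation A k l m.+1).
Implicit Types (p q x z : M).

Lemma cont_nbhs (T U : topologicalType) (c : T -> U) t (N : set U) :
  {for t, continuous c} -> nbhs (c t) N -> \forall t' \near t, N (c t').
Proof. by move=> ct Nc; exact: ct. Qed.

Lemma ball01 j (s : 'rV[R]_j) : ball 0 1 s <-> `|s| < 1.
Proof. by rewrite -ball_normE /ball_/= sub0r normrN. Qed.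

Lemma fdom_nbhs q x : fdom F q x -> nbhs x (fdom F q).
Proof. by move=> qx; apply: open_nbhs_nbhs; split => //; exact: fdom_open. Qed.

Lemma plaque_continuous_along q s y : ball 0 1 s -> ball 0 1 y ->
  {for s, continuous (fun s => plaque F q s y)}.
Proof.
move=> s1 y1 N /(@plaque_continuous _ _ _ _ _ _ _ _ F q (s, y) s1 y1).
move=> [[B C] [/= Bs Cy] BC]; apply: filterS Bs => s' Bs'.
by apply: (BC (s', y)); split=> //=; exact: nbhs_singleton.
Qed.

Lemma leaf_nbhs_plaque q x (N : set (leaf_space F)) : fdom F q x ->
  nbhs (x : leaf_space F) N -> exists2 d : R, 0 < d &
    forall s, `|s - along F q x| < d -> `|s| < 1 /\ N (plaque F q s (trans F q x)).
Proof.
move=> qx; rewrite nbhsE => -[V [oV Vx] VN].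
have [a1 t1] := fdom_cube qx.
have := oV q (trans F q x) t1 => H.
have : nbhs (along F q x) [set s | ball 0 1 s /\ V (plaque F q s (trans F q x))].
  by apply: open_nbhs_nbhs; split => //=; split=> //; rewrite fchartK.
move=> /nbhs_dist[d d0 dP]; exists d => // s /dP[/ball01 s1 Vs]; split=> //.
exact: VN.
Qed.

Definition plaque_nbhd q x (d : R) : set M :=
  [set z | exists s, [/\ `|s| < 1, `|s - along F q x| < d &
                        z = plaque F q s (trans F q x)]].

(** Openness has to be tested in every foliation chart; by [fol_coherent], a plaque of another chart
    remains in the plaque of [q] near any common point. *)
Lemma nbhs_plaque_nbhd q x d : fdom F q x -> 0 < d ->
  nbhs (x : leaf_space F) (plaque_nbhd q x d).
Proof.
move=> qx d0; have [/ball01 a1 t1] := fdom_cube qx.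
apply: open_nbhs_nbhs; split; last first.
  by exists (along F q x); rewrite subrr normr0 fchartK.
move=> p y y1; rewrite openE => s0 [s01 [s1 [s1n s1d E]]].
have s1b : ball 0 1 s1 by apply/ball01.
have pz : fdom F p (plaque F p s0 y) by exact: plaque_fdom.
have qz : fdom F q (plaque F p s0 y) by rewrite E; exact: plaque_fdom.
have [N Nz NP] := fol_coherent pz qz.
have cp := @plaque_continuous_along p _ _ s01 y1.
have [Ea Et] := plaqueK F q s1b t1.
have H1 : \forall s \near s0, N (plaque F p s y) by exact: cp Nz.
have H2 : \forall s \near s0, fdom F q (plaque F p s y) by exact: cp (fdom_nbhs qz).
have H3 : \forall s \near s0, `|along F q (plaque F p s y) - along F q x| < d.
  have c2 : {for s0, continuous (fun s => along F q (plaque F p s y))}.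
    by apply: (@continuous_comp _ _ _ (fun s => plaque F p s y) (along F q)) => //; exact: along_continuous.
  have e0 : 0 < d - `|s1 - along F q x| by rewrite subr_gt0.
  have := cont_near c2 (half_gt0 e0).
  apply: filterS => s; rewrite E Ea => h.
  rewrite -(subrKA s1) (le_lt_trans (ler_normD _ _))//.
  by move: h e0; move: (`|_|) (`|_|) => u v; lra.
have H4 : \forall s \near s0, ball 0 1 s.
  apply: open_nbhs_nbhs; split => //; exact: ball_open.
near=> s.
have sb : ball 0 1 s by near: s.
split=> //; exists (along F q (plaque F p s y)).
have qs : fdom F q (plaque F p s y) by near: s.
split.
- by apply/ball01; have [] := fdom_cube qs.
- by near: s.
- rewrite -[LHS](fchartK qs); congr (plaque F q _ _).
  rewrite -Et -E; apply: NP; [by near: s|exact: nbhs_singleton Nz|].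
  by rewrite (plaqueK F p sb y1).2 (plaqueK F p s01 y1).2.
Unshelve. all: by end_near. Qed.

(** The working test for the leaf topology: one chart suffices, since plaque neighbourhoods form a
    basis at the point. *)
Lemma lcontP (T : topologicalType) (c : T -> M) (t : T) q : fdom F q (c t) ->
  {for t, continuous (c : T -> leaf_space F)} <->
  {for t, continuous c} /\ \forall t' \near t, trans F q (c t') = trans F q (c t).
Proof.
move=> qc; have [a1 t1] := fdom_cube qc; split => [ct|[ct tt]].
- split.
    move=> N Nc; have cp := @plaque_continuous_along q _ _ a1 t1.
    have : \forall s \near along F q (c t), N (plaque F q s (trans F q (c t))).
      by apply: cp; rewrite fchartK.
    move=> /nbhs_dist[d d0 dN].
    apply: filterS (ct _ (nbhs_plaque_nbhd qc d0)) => t' [s [s1 sd ->]].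
    exact: dN.
  have := cont_nbhs (U := leaf_space F) ct (nbhs_plaque_nbhd qc ltr01).
  apply: filterS => t' [s [/ball01 s1 sd ->]].
  by have [] := plaqueK F q s1 t1.
- move=> N /(leaf_nbhs_plaque qc)[d d0 dN].
  have c2 : {for t, continuous (fun t => along F q (c t))}.
    by apply: (@continuous_comp _ _ _ c (along F q)) => //; exact: along_continuous.
  have H := cont_near c2 (half_gt0 d0).
  have H' : \forall t' \near t, fdom F q (c t') by exact: ct (fdom_nbhs qc).
  suff : \forall t' \near t, N (c t') by [].
  near=> t'; have qt' : fdom F q (c t') by near: t'.
  have -> : c t' = plaque F q (along F q (c t')) (trans F q (c t)).
    by rewrite -[LHS](fchartK qt'); congr (plaque F q _ _); near: t'.
  apply: (proj2 (dN _ _)).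
  apply: (@le_lt_trans _ _ (d / 2)); first by near: t'.
  by rewrite ltr_pdivrMr// ltr_pMr// ltr1n.
Unshelve. all: by end_near. Qed.

Lemma lcont_cont (T : topologicalType) (c : T -> M) t :
  {for t, continuous (c : T -> leaf_space F)} -> {for t, continuous c}.
Proof. by move=> /(lcontP (fdom_center F (c t)))[]. Qed.

Lemma lcont_trans (T : topologicalType) (c : T -> M) t q : fdom F q (c t) ->
  {for t, continuous (c : T -> leaf_space F)} ->
  \forall t' \near t, trans F q (c t') = trans F q (c t).
Proof. by move=> qc /(lcontP qc)[]. Qed.

Section plaque_diff.
Variables (q p : M) (s0 : 'rV[R]_k) (y0 : 'rV[R]_l).
Hypotheses (s1 : ball 0 1 s0) (y1 : ball 0 1 y0) (px : dom A p (plaque F q s0 y0)).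

Definition plaque_deriv w := 'D_w (fun s => coord A p (plaque F q s y0)) s0.

Lemma plaque_sdiff_family :
  sdiff (fun s => coord A p (plaque F q s y0)) s0 plaque_deriv /\
  forall e : R, 0 < e -> exists2 d : R, 0 < d &
    \forall y \near y0, forall a b, `|a - s0| < d -> `|b - s0| < d ->
      `|coord A p (plaque F q a y) - coord A p (plaque F q b y)
        - plaque_deriv (a - b)| <= e * `|a - b|.
Proof.
have := Ck_family_sdiff (@mean_value_rV R n) (plaque_Ck F q p) (s0 := s0) (y0 := y0).
apply.
have H1 : nbhs s0 (ball 0 1 : set 'rV[R]_k).
  by apply: open_nbhs_nbhs; split => //; exact: ball_open.
have H2 : nbhs y0 (ball 0 1 : set 'rV[R]_l).
  by apply: open_nbhs_nbhs; split => //; exact: ball_open.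
have H3 : nbhs (s0, y0) [set z : 'rV[R]_k * 'rV[R]_l | dom A p (plaque F q z.1 z.2)].
  have := @plaque_continuous _ _ _ _ _ _ _ _ F q (s0, y0) s1 y1; apply.
  exact: dom_nbhs.
have H12 : nbhs (s0, y0) [set z : 'rV[R]_k * 'rV[R]_l | ball 0 1 z.1 /\ ball 0 1 z.2].
  by exists (ball 0 1, ball 0 1).
by apply: filterS2 H12 H3 => z [].
Qed.

Lemma plaque_deriv_inj w : plaque_deriv w = 0 -> w = 0.
Proof.
move=> w0; set x := plaque F q s0 y0.
have H1 := plaque_sdiff_family.1.
have H2 := transition_sdiff px (dom_center A x).
have H := sdiff_comp H1 H2.
have H3 : sdiff (fun s => coord A x (plaque F q s y0)) s0 (transition A p x x \o plaque_deriv).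
  apply: sdiff_near H _.
  have := cont_nbhs (@plaque_continuous_along q _ _ s1 y1) (dom_nbhs px).
  by apply: filterS => s h /=; rewrite coordK.
have [_ E] := sdiff_is_derive w H3.
apply: (plaque_immersion s1 y1 (_ : 'D_w (fun s' => coord A x (plaque F q s' y0)) s0 = 0)).
rewrite E /= w0; have := transition_lin px (dom_center A x); exact: lin0.
Qed.

Lemma plaque_left_inverse : exists J : 'rV[R]_n -> 'rV[R]_k,
  [/\ forall a u v, J (a *: u + v) = a *: J u + J v,
      exists2 K, 0 < K & forall w, `|J w| <= K * `|w| & cancel plaque_deriv J].
Proof.
have [Ll _ _] := plaque_sdiff_family.1.
have [J Jl JK] := lin_left_inverse Ll plaque_deriv_inj.
by exists J; split=> //; exact: lin_rV_bounded.
Qed.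

(** The constants serve all plaques near that of [y0], not only this one. The left inverse bounds
    the derivative below by [1 / C], and half of this is given up to the error term. *)
Lemma plaque_bilipschitz : exists (c K d : R), [/\ 0 < c, 0 < K, 0 < d &
  \forall y \near y0, forall a b, `|a - s0| < d -> `|b - s0| < d ->
    c * `|a - b| <= `|coord A p (plaque F q a y) - coord A p (plaque F q b y)|
      <= K * `|a - b|].
Proof.
have [J [Jl [C C0 JC] JK]] := plaque_left_inverse.
have [[_ [K K0 LK] _] H] := plaque_sdiff_family.
pose c := (2 * C)^-1.
have c0 : 0 < c by rewrite invr_gt0 mulr_gt0.
have [d d0 dH] := H c c0.
exists c, (K + c), d; split=> //; first exact: addr_gt0.
apply: filterS dH => y yH a b ad bd.
have := yH a b ad bd; set D := a - b; set X := coord A p _ - _ => H1.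
have H2 : 2 * c * `|D| <= `|plaque_deriv D|.
  have -> : 2 * c = C^-1 by rewrite /c invfM mulrA divff ?mul1r.
  by rewrite ler_pdivrMl// -{1}[D]JK; exact: JC.
have H3 : `|plaque_deriv D| <= `|X| + c * `|D|.
  by rewrite -[plaque_deriv D](subKr X) (le_trans (ler_normB _ _))// lerD2l.
apply/andP; split; first by lra.
rewrite mulrDl -[X](subrK (plaque_deriv D)) (le_trans (ler_normD _ _))// addrC.
by rewrite lerD.
Qed.

End plaque_diff.

(** The plaque parametrization is an immersion, so [sderiv_inverse] pulls the derivative back to
    plaque coordinates. *)
Lemma leaf_deriv (c : R -> M) t q p v :
  {for t, continuous (c : R -> leaf_space F)} -> fdom F q (c t) -> dom A p (c t) ->
  sderiv (fun t' => coord A p (c t')) t v ->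
  exists2 w, sderiv (fun t' => along F q (c t')) t w &
    v = plaque_deriv q p (along F q (c t)) (trans F q (c t)) w.
Proof.
move=> lc qc pc cv; have [a1 t1] := fdom_cube qc; have cc := lcont_cont lc.
set s0 := along F q (c t); set y0 := trans F q (c t).
have px : dom A p (plaque F q s0 y0) by rewrite fchartK.
have [J [Jl JC JK]] := plaque_left_inverse a1 t1 px.
have sd := (plaque_sdiff_family a1 t1 px).1.
have E : \forall t' \near t, coord A p (c t') =
    ((fun s => coord A p (plaque F q s y0)) \o (fun t' => along F q (c t'))) t'.
  have H := lcont_trans qc lc.
  apply: filterS2 H (cc _ (fdom_nbhs qc)) => t' h qt' /=.
  by rewrite -[c t' in LHS](fchartK qt') h.
have cv' := sderiv_near cv E.
have ca : {for t, continuous (fun t' => along F q (c t'))}.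
  by apply: (@continuous_comp _ _ _ c (along F q)) => //; exact: along_continuous.
have D := sderiv_inverse (s := fun t' => along F q (c t')) sd Jl JC JK ca cv'.
exists (J v) => //.
exact: sderiv_unique cv' (sderiv_comp D sd).
Qed.

Lemma mderiv_plaque (s : R -> 'rV[R]_k) (y : 'rV[R]_l) t q w :
  ball 0 1 (s t) -> ball 0 1 y -> sderiv s t w ->
  mderiv A (fun t => plaque F q (s t) y) t
    (plaque_deriv q (plaque F q (s t) y) (s t) y w).
Proof.
move=> s1 y1 sw; split.
  apply: (@continuous_comp _ _ _ s (fun s => plaque F q s y)).
    exact: sderiv_continuous sw.
  exact: plaque_continuous_along.
have := plaque_sdiff_family s1 y1 (dom_center A (plaque F q (s t) y)) => -[sd _].
exact: sderiv_comp sw sd.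
Qed.

Lemma lcont_plaque (T : topologicalType) (s : T -> 'rV[R]_k) (y : 'rV[R]_l) t q :
  ball 0 1 (s t) -> ball 0 1 y -> {for t, continuous s} ->
  {for t, continuous ((fun t => plaque F q (s t) y) : T -> leaf_space F)}.
Proof.
move=> s1 y1 sc; apply/(lcontP (q := q)); first exact: plaque_fdom.
split.
  by apply: (@continuous_comp _ _ _ s (fun s => plaque F q s y)) => //; exact: plaque_continuous_along.
have : \forall t' \near t, ball 0 1 (s t').
  by apply: sc; apply: open_nbhs_nbhs; split => //; exact: ball_open.
apply: filterS => t' s1'.
by rewrite (plaqueK F q s1' y1).2 (plaqueK F q s1 y1).2.
Qed.

Lemma tangent_spaceP (c : R -> M) t v :
  {for t, continuous (c : R -> leaf_space F)} -> mderiv A c t v ->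
  tangent_space F (c t) v.
Proof.
move=> lc [_ cv].
have [w _ ->] := leaf_deriv lc (fdom_center F (c t)) (dom_center A (c t)) cv.
by exists w.
Qed.

Lemma tangent_space_curve x v : tangent_space F x v ->
  exists c : R -> M, [/\ c 0 = x, {for 0, continuous (c : R -> leaf_space F)} &
    mderiv A c 0 v].
Proof.
move=> [w _ <-]; have xx := fdom_center F x; have [a1 t1] := fdom_cube xx.
pose s t : 'rV[R]_k := along F x x + t *: w.
have s0 : s 0 = along F x x by rewrite /s scale0r addr0.
have sw : sderiv s 0 w.
  rewrite -[w]add0r; apply: sderivD; [exact: sderiv_cst|exact: sderiv_scalel].
exists (fun t => plaque F x (s t) (trans F x x)); split.
- by rewrite s0 fchartK.
- by apply: lcont_plaque; rewrite ?s0//; exact: sderiv_continuous sw.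
- have := @mderiv_plaque s (trans F x x) 0 x w; rewrite s0 => /(_ a1 t1 sw).
  by rewrite /plaque_deriv fchartK.
Qed.

(** Lying on the leaf of [x] is locally constant along the curve, by one [leaf_step] in either
    direction. *)
Lemma leaf_lcont (c : R -> M) x (a b : R) : a <= b ->
  (forall t, a <= t <= b -> {for t, continuous (c : R -> leaf_space F)}) ->
  leaf F x (c a) -> leaf F x (c b).
Proof.
move=> ab lc xa.
suff -> : leaf F x (c b) = leaf F x (c a) by [].
apply: (@loc_const R Prop (fun t => leaf F x (c t)) a b); last by rewrite ab lexx.
move=> t tab; have tt := fdom_center F (c t).
have H := lcont_trans tt (lc t tab).
have H' := cont_nbhs (lcont_cont (lc t tab)) (fdom_nbhs tt).
have [d d0 dP] := nbhs_exR (filterI H H').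
exists d => // s _ /dP[h1 h2]; apply/propext; split => h.
- exact: leaf_step h h2 tt h1.
- exact: leaf_step h tt h2 (esym h1).
Qed.

End leaves.

(** * The flow *)

Section invariance.
Context {R : realType}.

Lemma compact_cball n (s0 : 'rV[R]_n) (rho : R) :
  compact [set s : 'rV[R]_n | `|s - s0| <= rho].
Proof.
have E : [set s : 'rV[R]_n | `|s - s0| <= rho] = closed_ball_ (fun x => `|x|) s0 rho.
  by apply/seteqP; split => s /=; rewrite /closed_ball_ /= distrC.
apply: bounded_closed_compact; last by rewrite E; exact: closed_closed_ball_.
exists (`|s0| + rho); split; first exact: num_real.
move=> x xr s /= sr; apply: le_trans (ltW xr).
rewrite -[s](subrK s0) (le_trans (ler_normD _ _))// addrC lerD2l//.
Qed.

Lemma continuous_pair (T U V : topologicalType) (f : T -> U) (g : T -> V) x :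
  {for x, continuous f} -> {for x, continuous g} ->
  {for x, continuous (fun y => (f y, g y))}.
Proof. by move=> fx gx; apply: (cvg_pair (f := f) (g := g) fx gx). Qed.

Lemma closed_limit (T : topologicalType) (c : R -> T) (C : set T) (a t : R) :
  closed C -> {for t, continuous c} -> a < t -> (forall s, a <= s < t -> C (c s)) ->
  C (c t).
Proof.
move=> clC ct at_ Cs; apply: contrapT => nC.
have oC : nbhs (c t) (~` C) by apply: open_nbhs_nbhs; split => //; exact: closed_openC.
have [d d0 dP] := nbhs_exR (ct _ oC).
pose s := Num.max a (t - d / 2).
have st : s < t by rewrite gt_max at_/= ltrBlDr ltrDl half_gt0.
apply: (dP s); last by apply: Cs; rewrite st le_max lexx.
rewrite distrC gtr0_norm ?subr_gt0//.
have : t - d / 2 <= s by rewrite le_max lexx orbT.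
by move: d0; clear; lra.
Qed.

Lemma image_cball_closed (T : topologicalType) n (P : 'rV[R]_n -> T) s0 (rho : R) :
  hausdorff_space T ->
  (forall s, `|s - s0| <= rho -> {for s, continuous P}) ->
  closed (P @` [set s | `|s - s0| <= rho]).
Proof.
move=> hT cP; apply: compact_closed => //; apply: continuous_compact.
  by apply: continuous_in_subspaceT => s; rewrite inE => /cP.
exact: compact_cball.
Qed.

(** Both maps approximate the same increment of [P] along a short multiple of [w]; dividing by its
    length leaves only the error [e]. *)
Lemma sdiff_bound (V W : normedModType R) (P : V -> W) s L L0 (d e : R) :
  0 < d -> (forall a u, L0 (a *: u) = a *: L0 u :> W) ->
  (forall a b, `|a - s| < d -> `|b - s| < d ->
    `|P a - P b - L0 (a - b)| <= e * `|a - b|) -> sdiff P s L ->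
  forall w, `|L w - L0 w| <= e * `|w|.
Proof.
move=> d0 L0Z H [Ll _ sL] w; apply/ler_addgt0Pr => eta eta0.
have w1 : 0 < `|w| + 1 by rewrite ltr_wpDl.
have [d' d'0 H'] := sL (eta / (`|w| + 1)) (divr_gt0 eta0 w1).
pose h := Num.min d d' / (`|w| + 1) / 2.
have h0 : 0 < h by rewrite !divr_gt0// lt_min d0.
have hw : `|s + h *: w - s| < Num.min d d'.
  rewrite addrC addrA addNr add0r normrZ gtr0_norm//.
  apply: (@le_lt_trans _ _ (Num.min d d' / 2)).
    rewrite /h mulrAC ler_pM2r// -mulrA ler_piMr//; first by rewrite ltW// lt_min d0.
    by rewrite ler_pdivrMl// mulr1 lerDl.
  by rewrite ltr_pdivrMr// ltr_pMr ?ltr1n// lt_min d0.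
move: hw; rewrite lt_min => /andP[hd hd'].
have ss x : 0 < x -> `|s - s| < x by rewrite subrr normr0.
have := H _ _ hd (ss _ d0); have := H' _ _ hd' (ss _ d'0).
have -> : s + h *: w - s = h *: w by rewrite addrC addrA addNr add0r.
set X := P _ - P _; rewrite (linZ Ll) L0Z normrZ (gtr0_norm h0) => H1 H2.
have E : h *: (L w - L0 w) = (X - h *: L0 w) - (X - h *: L w) by zmod.
rewrite -(ler_pM2l h0) -{1}(gtr0_norm h0) -normrZ E (le_trans (ler_normB _ _))//.
rewrite mulrDr lerD//; first by apply: le_trans H2 _; rewrite mulrCA.
apply: le_trans H1 _; rewrite mulrCA ler_pM2l// mulrAC ler_pdivrMr//.
by rewrite ler_pM2l// lerDl.
Qed.

(* An integral curve of a Lipschitz field which is tangent to the surface P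
   stays on it: it is the limit of Euler polygons drawn on the surface. *)
Lemma integral_curve_surface k n (P : 'rV[R]_k -> 'rV[R]_n)
    (L : 'rV[R]_k -> 'rV[R]_k -> 'rV[R]_n) (w : 'rV[R]_k -> 'rV[R]_k)
    (xi : 'rV[R]_n -> 'rV[R]_n) (s0 : 'rV[R]_k) (x : R -> 'rV[R]_n)
    (rho K V C T : R) :
  0 <= K -> 0 <= V -> 0 < C -> 0 <= T ->
  (forall s, `|s - s0| <= rho -> sdiff P s (L s)) ->
  (forall s, `|s - s0| <= rho -> `|w s| <= C /\ L s (w s) = xi (P s)) ->
  (forall t, 0 <= t <= T -> is_derive t (1 : R) x (xi (x t))) ->
  (forall t, 0 <= t <= T -> `|xi (x t)| <= V) ->
  (forall t t', 0 <= t <= T -> 0 <= t' <= T ->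
     `|xi (x t) - xi (x t')| <= K * `|x t - x t'|) ->
  (forall t s, 0 <= t <= T -> `|s - s0| <= rho ->
     `|xi (x t) - xi (P s)| <= K * `|x t - P s|) ->
  x 0 = P s0 -> C * T <= rho -> K * T <= 1 / 2 ->
  exists2 s, `|s - s0| <= rho & x T = P s.
Proof.
move=> K0 V0 C0 T0 sdP wP xd xV xK PK x0 CT KT.
have clP : closed (P @` [set s | `|s - s0| <= rho]).
  apply: image_cball_closed; first exact: norm_hausdorff.
  by move=> s /sdP/sdiff_continuous.
suff : (P @` [set s | `|s - s0| <= rho]) (x T) by move=> [s sr <-]; exists s.
have [->|T1] := eqVneq T 0.
  by exists s0 => //=; rewrite subrr normr0 (le_trans _ CT)// mulr_ge0// ltW.
have {T0}T0 : 0 < T by rewrite lt_neqAle eq_sym T1.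
apply: contrapT => nP.
have [eta eta0 etaP] : exists2 d : R, 0 < d & forall y, `|y - x T| < d ->
    ~ (P @` [set s | `|s - s0| <= rho]) y.
  apply: nbhs_ex; apply: open_nbhs_nbhs; split => //; exact: closed_openC.
(* The polygon will be off by at most [2 * e * T = eta / 2] at time [T], while [x T] is at distance
   at least [eta] from the surface. *)
pose e := eta / 4 / T.
have e0 : 0 < e by rewrite !divr_gt0.
have e20 := half_gt0 e0.
(* The one-step error is made uniform in the starting point by compactness of the closed ball. As
   [w] need not be continuous, the bound near [s] uses the derivative at [s] and compares it with
   the derivative at [s']. *)
have stepP : \forall h \near (0 : R), forall s, `|s - s0| <= rho ->
    `|P (s + h *: w s) - P s - h *: xi (P s)| <= e / 2 * `|h|.
  have := (compact_near_coveringP _).1 (@compact_cball k s0 rho).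
  move=> /near_covering_withinP H.
  have := H R (nbhs (0 : R)) (fun h s => `|P (s + h *: w s) - P s - h *: xi (P s)| <= e / 2 * `|h|).
  apply=> s sr.
  pose e1 := e / 2 / (2 * C).
  have e10 : 0 < e1 by rewrite !divr_gt0// mulr_gt0.
  have [Ll _ sL] := sdP s sr.
  have [d d0 dP] := sL e1 e10.
  have N1 : \forall s' \near s, `|s' - s| < d / 2 by apply: near_dist; exact: half_gt0.
  have N2 : \forall h \near (0 : R), `|h| < d / 2 / C.
    have := @near_dist R R 0 (d / 2 / C); rewrite !divr_gt0// => /(_ isT).
    by apply: filterS => h; rewrite subr0.
  exists ([set s' | `|s' - s| < d / 2], [set h | `|h| < d / 2 / C]) => //.
  move=> [s' h] [/= s'd hd] s'r.
  have [wC Lw] := wP s' s'r.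
  have hw : `|h *: w s'| < d / 2.
    rewrite normrZ; apply: (@le_lt_trans _ _ (`|h| * C)); first by rewrite ler_wpM2l.
    by rewrite -ltr_pdivlMr.
  have s'd2 : `|s' - s| < d by apply: lt_trans s'd _; rewrite ltr_pdivrMr// ltr_pMr ?ltr1n.
  have hd2 : `|s' + h *: w s' - s| < d.
    rewrite addrAC (le_lt_trans (ler_normD _ _))// [ltRHS](splitr d).
    by rewrite ltrD.
  have H1 := dP _ _ hd2 s'd2.
  have E1 : s' + h *: w s' - s' = h *: w s' by rewrite addrC addrA addNr add0r.
  rewrite E1 (linZ Ll) in H1.
  have d'0 : 0 < d - `|s' - s| by rewrite subr_gt0.
  have H2 : `|L s' (w s') - L s (w s')| <= e1 * `|w s'|.
    apply: (sdiff_bound d'0 (linZ Ll) _ (sdP s' s'r)) => a b ad bd.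
    by apply: dP; rewrite -[_ - s](subrKA s') (le_lt_trans (ler_normD _ _))//;
      rewrite -ltrBrDr.
  rewrite -Lw.
  have -> : P (s' + h *: w s') - P s' - h *: L s' (w s') =
    (P (s' + h *: w s') - P s' - h *: L s (w s')) - h *: (L s' (w s') - L s (w s')) by zmod.
  rewrite (le_trans (ler_normB _ _))// normrZ.
  rewrite normrZ in H1.
  have Ce1 : e1 * C = e / 2 / 2 by rewrite /e1; field; rewrite gt_eqF.
  have W1 : e1 * `|w s'| <= e / 2 / 2 by rewrite -Ce1 ler_pM2l.
  rewrite [e / 2](splitr (e / 2)) mulrDl lerD//.
    apply: le_trans H1 _; rewrite mulrCA mulrC; rewrite ler_wpM2r//.
  by rewrite mulrC ler_wpM2r// (le_trans H2).
have [h0 h00 h0P] := nbhs_exR stepP.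
pose B := K * V + 1.
have B0 : 0 < B by rewrite ltr_wpDl// mulr_ge0.
pose h1 := Num.min h0 (e / 2 / B).
have h10 : 0 < h1 by rewrite lt_min h00 !divr_gt0.
have [N N0 NT] : exists2 N : nat, (0 < N)%N & T / N%:R < h1.
  have [N] := ltr_add_invr (y := 0) (x := h1 / T) ltac:(by rewrite divr_gt0).
  rewrite add0r => hN; exists N.+1 => //.
  by rewrite -ltr_pdivlMl// mulrC.
pose h := T / N%:R.
have NR0 : 0 < N%:R :> R by rewrite ltr0n.
have h_0 : 0 < h by rewrite divr_gt0.
have hh0 : h < h0 by apply: lt_le_trans NT _; rewrite ge_min lexx.
have hB : B * h <= e / 2.
  rewrite -ler_pdivlMl// mulrC; apply: ltW; apply: lt_le_trans NT _.
  by rewrite ge_min lexx orbT.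
have Nh : N%:R * h = T by rewrite mulrC divfK// gt_eqF.
have jT j : (j <= N)%N -> 0 <= j%:R * h <= T.
  by move=> jN; rewrite mulr_ge0 ?(ltW h_0)//= -Nh ler_pM2r// ler_nat.
(* A step of length [h] adds [e / 2 * h] for the curve, [e / 2 * h] for the surface and [K * h]
   times the error so far. The last is at most [e * h] since [K * T <= 1 / 2], which gives the rate
   [2 * e]. *)
have main j : (j <= N)%N -> exists s, [/\ `|s - s0| <= C * (j%:R * h) &
    `|x (j%:R * h) - P s| <= 2 * e * (j%:R * h)].
  elim: j => [_|j IH jN].
    by exists s0; rewrite !mul0r !mulr0 x0 !subrr !normr0.
  have [s [sC se]] := IH (ltnW jN).
  have jT1 := jT _ (ltnW jN); have jT2 := jT _ jN.
  have /andP[j0 jT'] := jT1.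
  have sr : `|s - s0| <= rho.
    by apply: le_trans sC _; apply: le_trans CT; rewrite ler_pM2l.
  have [wC _] := wP s sr.
  have Ej : j.+1%:R * h = j%:R * h + h by rewrite -natr1 mulrDl mul1r.
  exists (s + h *: w s); split.
    rewrite addrAC (le_trans (ler_normD _ _))// Ej mulrDr lerD//.
    by rewrite normrZ gtr0_norm// mulrC ler_wpM2r// ltW.
  set t := j%:R * h in jT1 j0 jT' se sC *; rewrite Ej -/t.
  have X1 : forall t', t <= t' <= t + h -> `|x t' - x t| <= V * h.
    move=> t' /andP[tt' t'h].
    have : `|x t' - x t| <= V * (t' - t).
      apply: (mean_value_rV (df := fun u => xi (x u))) => // u /andP[u1 u2].
      - apply: xd; rewrite (le_trans j0 u1)/= (le_trans u2)// (le_trans t'h)//.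
        by rewrite -Ej; case/andP: jT2.
      - apply: xV; rewrite (le_trans j0 u1)/= (le_trans u2)// (le_trans t'h)//.
        by rewrite -Ej; case/andP: jT2.
    move=> /le_trans; apply; rewrite ler_wpM2l//; lra.
  have X2 : `|x (t + h) - x t - h *: xi (x t)| <= e / 2 * h.
    have -> : x (t + h) - x t - h *: xi (x t) =
        (x (t + h) - (t + h) *: xi (x t)) - (x t - t *: xi (x t)) by zmod.
    have -> : e / 2 * h = e / 2 * (t + h - t) by congr (_ * _); ring.
    apply: (@mean_value_rV R n (fun u => x u - u *: xi (x t)) (fun u => xi (x u) - xi (x t))).
    - by rewrite lerDl ltW.
    - move=> u /andP[u1 u2]; apply: is_deriveB; last exact/sderiv_is_derive/sderiv_scalel.
      apply: xd; rewrite (le_trans j0 u1)/= (le_trans u2)//.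
      by rewrite -Ej; case/andP: jT2.
    - move=> u /andP[u1 u2]; apply: le_trans (xK _ _ _ jT1) _.
        rewrite (le_trans j0 u1)/= (le_trans u2)//.
        by rewrite -Ej; case/andP: jT2.
      apply: le_trans hB; rewrite /B mulrDl mul1r -[leLHS]addr0 lerD ?(ltW h_0)//.
      by rewrite -mulrA ler_wpM2l// X1// u1 u2.
  have X3 : `|P (s + h *: w s) - P s - h *: xi (P s)| <= e / 2 * h.
    by have := h0P h; rewrite subr0 (gtr0_norm h_0) => /(_ hh0 s sr).
  have X4 := PK t s jT1 sr.
  have -> : x (t + h) - P (s + h *: w s) =
    (x (t + h) - x t - h *: xi (x t)) + (x t - P s) + h *: (xi (x t) - xi (P s))
    - (P (s + h *: w s) - P s - h *: xi (P s)) by zmod.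
  apply: le_trans (ler_normB _ _) _.
  apply: (@le_trans _ _ (e / 2 * h + 2 * e * t + h * (K * (2 * e * t)) + e / 2 * h)).
    rewrite lerD// (le_trans (ler_normD _ _))// lerD//.
      by rewrite (le_trans (ler_normD _ _))// lerD.
    rewrite normrZ gtr0_norm// ler_pM2l//; apply: le_trans X4 _.
    by rewrite ler_wpM2l.
  have Kt : K * t <= 1 / 2 by apply: le_trans KT; rewrite ler_wpM2l.
  have : h * (K * (2 * e * t)) <= e * h.
    have -> : h * (K * (2 * e * t)) = (K * t) * (2 * (e * h)) by ring.
    have eh : 0 <= e * h by rewrite mulr_ge0 ?ltW.
    by move: Kt eh; move: (K * t) (e * h) => a b; nra.
  by move=> ?; lra.
have [s [sC se]] := main N (leqnn N).
rewrite Nh in sC se.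
have sr : `|s - s0| <= rho by exact: le_trans CT.
apply: (etaP (P s)); last by exists s.
rewrite distrC; apply: le_lt_trans se _.
have -> : 2 * e * T = eta / 2 by rewrite /e; field; rewrite gt_eqF.
by rewrite ltr_pdivrMr// ltr_pMr// ltr1n.
Qed.

(** Continuity at small times, how small depending on the point, spreads along each orbit by the
    group law and real induction; negative times follow by reversing the flow. It serves the leaf
    topology and the cover. *)
Lemma local_flow_continuous (Z : topologicalType) (phi : R -> Z -> Z) :
  (forall z, phi 0 z = z) -> (forall s t z, phi (s + t) z = phi s (phi t z)) ->
  (forall z : Z, continuous (fun t => phi t z)) ->
  (forall z : Z, exists2 d : R, 0 < d & \forall z' \near z, forall t, `|t| < d ->
     {for (t, z'), continuous (fun y : R * Z => phi y.1 y.2)}) ->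
  continuous (fun y : R * Z => phi y.1 y.2).
Proof.
move=> phi0 phiD phic phil.
have pos (ph : R -> Z -> Z) :
    (forall z, ph 0 z = z) -> (forall s t z, ph (s + t) z = ph s (ph t z)) ->
    (forall z : Z, continuous (fun t => ph t z)) ->
    (forall z : Z, exists2 d : R, 0 < d & \forall z' \near z, forall t, `|t| < d ->
       {for z', continuous (ph t)}) ->
    forall t z, 0 <= t -> {for z, continuous (ph t)}.
  move=> ph0 phD phc phl t z t0.
  suff : forall s, 0 <= s <= t -> {for z, continuous (ph s)}.
    by apply; rewrite t0 lexx.
  have Ec s s' : ph s = ph (s - s') \o ph s'.
    by apply/funext => y /=; rewrite -phD subrK.
  apply: real_ind => [s /andP[s0 st] IH|s /andP[s0 st] IH].
  - have [->|sn] := eqVneq s 0.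
      have -> : ph 0 = id by apply/funext => y; exact: ph0.
      exact: cvg_id.
    have {s0}s0 : 0 < s by rewrite lt_neqAle eq_sym sn.
    have [d d0 dN] := phl (ph s z).
    have [d' d'0 dN'] := nbhs_exR (phc z s _ dN).
    pose s' := Num.max 0 (s - Num.min d d' / 2).
    have m0 : 0 < Num.min d d' by rewrite lt_min d0.
    have ss' : s' < s by rewrite gt_max s0/= ltrBlDr ltrDl half_gt0.
    have s'd : `|s' - s| < Num.min d d'.
      rewrite distrC gtr0_norm ?subr_gt0//.
      have : s - Num.min d d' / 2 <= s' by rewrite le_max lexx orbT.
      by move: m0; clear; lra.
    move: s'd; rewrite lt_min => /andP[s'd s'd'].
    rewrite (Ec s s'); apply: continuous_comp.
      by apply: IH; rewrite ss' le_max lexx.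
    by apply: (dN' s' s'd'); rewrite distrC.
  - have [d d0 dN] := phl (ph s z); exists d => // s' /andP[ss' s'd] s't.
    rewrite (Ec s' s); apply: continuous_comp; first by apply: IH; rewrite s0 lexx.
    apply: (nbhs_singleton dN); rewrite gtr0_norm ?subr_gt0// ltrBlDl.
    by rewrite addrC in s'd *.
have sl (z : Z) : exists2 d : R, 0 < d & \forall z' \near z, forall t, `|t| < d ->
    {for z', continuous (phi t)}.
  have [d d0 dN] := phil z; exists d => //; apply: filterS dN => z' z'd t td.
  apply: (@continuous_comp _ _ _ (fun y => (t, y)) (fun y : R * Z => phi y.1 y.2)).
    by apply: continuous_pair; [exact: cvg_cst|exact: cvg_id].
  exact: z'd.
have all t z : {for z, continuous (phi t)}.
  have [t0|t0] := leP 0 t; first exact: pos.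
  have := @pos (fun s => phi (- s)) _ _ _ _ (- t) z; rewrite opprK; apply.
  - by move=> y; rewrite oppr0.
  - by move=> s s' y; rewrite opprD.
  - move=> y s; apply: (@continuous_comp _ _ _ (fun s => - s) (fun s => phi s y)).
      exact: opp_continuous.
    exact: phic.
  - move=> y; have [d d0 dN] := sl y; exists d => //.
    by apply: filterS dN => z' z'd s sd; apply: z'd; rewrite normrN.
  - by rewrite oppr_ge0 ltW.
move=> [t z].
have -> : (fun y : R * Z => phi y.1 y.2) =
    (fun y : R * Z => phi y.1 y.2) \o (fun y : R * Z => (y.1 - t, phi t y.2)).
  by apply/funext => y /=; rewrite -phiD subrK.
apply: continuous_comp.
  apply: continuous_pair.
    by apply: (@cvgB _ R^o); [exact: cvg_fst|exact: cvg_cst].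
  apply: (@continuous_comp _ _ _ (fun y : R * Z => y.2) (phi t)); last exact: all.
  exact: cvg_snd.
rewrite /= subrr; have [d d0 dN] := phil (phi t z).
by apply: (nbhs_singleton dN); rewrite normr0.
Qed.

End invariance.

Lemma nbhsW (T : topologicalType) (x : T) (P : set T) : (forall y, P y) -> nbhs x P.
Proof. by move=> H; apply: filterS (@filterT _ (nbhs x) _) => y _. Qed.

Lemma sderiv_mull {R : realType} (a t : R) : sderiv (fun s : R => a * s) t a.
Proof.
move=> e e0; exists 1 => // x y _ _.
have -> : a * x - a * y - (x - y) *: a = 0 by rewrite [_ *: _]mulrC; ring.
by rewrite normr0 mulr_ge0// ltW.
Qed.

Lemma sderiv_id {R : realType} (t : R) : sderiv (fun s : R => s) t 1.
Proof.
by apply: sderiv_near (sderiv_mull 1 t) _; apply: nbhsW => s; rewrite mul1r.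
Qed.

Lemma is_derive_scale_arg {R : realType} (W : normedModType R) (g : R -> W) (a t : R) v :
  is_derive (a * t) (1 : R) g v -> is_derive t (1 : R) (fun u => g (a * u)) (a *: v).
Proof.
case=> gd <-; have [md mv] := sderiv_is_derive (sderiv_mull a t).
have dg : differentiable g (a * t) by exact/derivable1_diffP.
have dm : differentiable (fun s : R => a * s) t by exact/derivable1_diffP.
have dc : differentiable (g \o (fun s : R => a * s)) t by exact: differentiable_comp.
have -> : (fun u => g (a * u)) = g \o (fun s : R => a * s) by [].
split; first exact/derivable1_diffP.
rewrite (deriveE _ dc) (diff_comp dm dg) /= -(deriveE _ dm) mv (deriveE _ dg).
by rewrite -linearZ /= [a *: 1]mulr1.
Qed.

(** * Differentiability of the flow *)

Section flow.
Context {R : realType} {n r : nat} {M : topologicalType} (A : atlas R n r.+2 M).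
Variables (f : R -> M -> M) (X : M -> 'rV[R]_n).
Hypotheses (hf : flow_of_class A r.+1 f X) (hM : hausdorff_space M).
Implicit Types (q x : M) (s t : R).

Lemma flow0 x : f 0 x = x. Proof. by case: hf. Qed.

Lemma flowD s t x : f (s + t) x = f s (f t x). Proof. by case: hf. Qed.

Lemma flow_Ck t : Ck_map A r.+1 (f t). Proof. by case: hf. Qed.

Lemma orbit_continuous x : continuous (fun t => f t x).
Proof. by case: hf => _ _ _ _ /(_ x)[]. Qed.

Definition field q (s : 'rV[R]_n) : 'rV[R]_n :=
  components A q (param A q s) (X (param A q s)).

Lemma field_coord q x : dom A q x -> field q (coord A q x) = components A q x (X x).
Proof. by move=> qx; rewrite /field coordK. Qed.

Lemma field_center q : field q (coord A q q) = X q.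
Proof.
have qq := dom_center A q; rewrite field_coord//.
by rewrite /components -/(transition A q q q _) transition_id.
Qed.

Lemma field_sdiff q x : dom A q x -> exists L, sdiff (field q) (coord A q x) L.
Proof.
case: hf => XC _ _ _ _ qx; eexists; apply: Ck_sdiff (XC q) _; first exact: mean_value_rV.
by apply: open_nbhs_nbhs; split; [exact: coord_open|exists x].
Qed.

Lemma orbit_is_derive q t x : dom A q (f t x) ->
  is_derive t (1 : R) (fun t => coord A q (f t x)) (field q (coord A q (f t x))).
Proof.
move=> qx; case: hf => _ _ _ _ /(_ x)[cx /(_ t)[dx vx]].
have D : is_derive t (1 : R) (fun t' => coord A (f t x) (f t' x)) (X (f t x)).
  by rewrite -vx /velocity derive1E; exact: derivableP.
have H := is_derive_comp_sdiff D (transition_sdiff (dom_center A (f t x)) qx).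
rewrite (field_coord qx).
apply: near_eq_is_derive H.
apply: filterS (cont_nbhs (cx t) (dom_nbhs (dom_center A (f t x)))) => t' h /=.
by rewrite coordK.
Qed.

Lemma chart_ball q (N : set M) : nbhs q N -> exists2 rho : R, 0 < rho &
  forall s : 'rV[R]_n, `|s - coord A q q| < rho ->
    exists y, [/\ dom A q y, N y & s = coord A q y].
Proof.
move=> Nq; have [rho rho0 H] := nbhs_ex (chart_nbhs (dom_center A q) Nq).
by exists rho => // s /H[y [qy Ny] <-]; exists y.
Qed.

Lemma field_lipschitz q : exists K rho : R, [/\ 0 < K, 0 < rho &
  forall a b, `|a - coord A q q| < rho -> `|b - coord A q q| < rho ->
    `|field q a - field q b| <= K * `|a - b|].
Proof. by have [L /sdiff_lip] := field_sdiff (dom_center A q). Qed.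

(** In the closed coordinate ball of radius [rho / 2] the speed is at most [V], so an orbit started
    within [rho / 4] of the centre cannot leave before time [d]. The image of the ball is compact,
    hence closed because [M] is Hausdorff, so no orbit escapes through a limit outside the chart. *)
Lemma flow_stay q (N : set M) : nbhs q N -> exists2 d : R, 0 < d &
  \forall x \near q, forall t, `|t| < d -> N (f t x).
Proof.
move=> Nq; have qq := dom_center A q; set s0 := coord A q q.
have [r1 r10 H1] := chart_ball Nq.
have [K [r2 [K0 r20 HK]]] := field_lipschitz q.
pose rho := Num.min r1 r2.
have rho0 : 0 < rho by rewrite lt_min r10.
pose V := K * rho + `|field q s0| + 1.
have V0 : 0 < V by rewrite ltr_wpDl// addr_ge0// mulr_ge0 ?ltW.
have fV (s : 'rV[R]_n) : `|s - s0| < rho -> `|field q s| <= V.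
  move=> sr; have sr2 : `|s - s0| < r2 by apply: lt_le_trans sr _; rewrite ge_min lexx orbT.
  rewrite -[field q s](subrK (field q s0)) (le_trans (ler_normD _ _))//.
  have := HK s s0 sr2; rewrite -/s0 subrr normr0 => /(_ r20) h.
  rewrite /V -addrA [X in _ <= X]addrA -[leLHS]addr0 lerD// lerD2r.
  by apply: le_trans h _; rewrite ler_pM2l// ltW.
pose d := rho / 4 / V.
have d0 : 0 < d by rewrite !divr_gt0.
exists d => //.
have clC : closed (param A q @` [set s | `|s - s0| <= rho / 2]).
  apply: image_cball_closed => // s sr.
  have [|y [qy _ ->]] := H1 s; last exact: param_continuous.
  apply: le_lt_trans sr _; apply: (@lt_le_trans _ _ rho); last by rewrite ge_min lexx.
  by rewrite ltr_pdivrMr// ltr_pMr// ltr1n.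
have near1 : \forall x \near q, dom A q x /\ `|coord A q x - s0| <= rho / 4.
  apply: filterI; first exact: dom_nbhs.
  by apply: cont_near; [exact: coord_continuous|rewrite divr_gt0].
apply: filterS near1 => x [qx xr] t.
(* The sign [sg] is the direction of time. *)
have key (sg : R) : `|sg| = 1 -> forall u, 0 <= u <= Num.min d `|t| -> `|t| < d ->
    dom A q (f (sg * u) x) /\ `|coord A q (f (sg * u) x) - s0| <= rho / 2.
  move=> sg1 u0 + td; have [_ mt] : Num.min d `|t| <= d /\ Num.min d `|t| <= `|t|.
    by rewrite !ge_min !lexx orbT.
  have cg : continuous (fun u => f (sg * u) x).
    move=> v; apply: (@continuous_comp _ _ _ (fun u => sg * u) (fun t => f t x)).
      exact: mulrl_continuous.
    exact: orbit_continuous.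
  have inC y : (param A q @` [set s | `|s - s0| <= rho / 2]) y ->
      dom A q y /\ `|coord A q y - s0| <= rho / 2.
    move=> [s /= sr <-]; have [|z [qz _ E]] := H1 s.
      apply: le_lt_trans sr _; apply: (@lt_le_trans _ _ rho); last by rewrite ge_min lexx.
      by rewrite ltr_pdivrMr// ltr_pMr// ltr1n.
    by rewrite E coordK// -E.
  have Cin y : dom A q y -> `|coord A q y - s0| <= rho / 2 ->
      (param A q @` [set s | `|s - s0| <= rho / 2]) y.
    by move=> qy yr; exists (coord A q y) => //; exact: coordK.
  have bound v : 0 <= v -> (forall u, 0 <= u <= v ->
      dom A q (f (sg * u) x) /\ `|coord A q (f (sg * u) x) - s0| <= rho / 2) ->
      `|coord A q (f (sg * v) x) - coord A q x| <= V * v.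
    move=> v0 Hv.
    have := @mean_value_rV R n (fun u => coord A q (f (sg * u) x))
      (fun u => sg *: field q (coord A q (f (sg * u) x))) 0 v V v0.
    rewrite mulr0 flow0 subr0; apply.
      move=> w /Hv[qw wr].
      exact: is_derive_scale_arg (orbit_is_derive qw).
    move=> w /Hv[qw wr]; rewrite normrZ sg1 mul1r; apply: fV.
    by apply: le_lt_trans wr _; rewrite ltr_pdivrMr// ltr_pMr// ltr1n.
  have Vd : V * d = rho / 4 by rewrite /d mulrC divfK// gt_eqF.
  move: u0; apply: real_ind => [v /andP[v0 vm] IH|v /andP[v0 vm] IH].
  - have [->|vn] := eqVneq v 0.
      by rewrite mulr0 flow0; split=> //; apply: le_trans xr _; lra.
    have v0' : 0 < v by rewrite lt_neqAle eq_sym vn.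
    apply/inC; apply: (closed_limit clC (cg v) v0') => w /IH[qw wr].
    exact: Cin.
  - have := bound v v0 IH => B.
    have [qv vr] : dom A q (f (sg * v) x) /\ `|coord A q (f (sg * v) x) - s0| <= rho / 2.
      by apply: IH; rewrite v0 lexx.
    have vd : V * v < rho / 4.
      by rewrite -Vd ltr_pM2l//; apply: lt_le_trans vm _; rewrite ge_min lexx.
    have vr' : `|coord A q (f (sg * v) x) - s0| < rho / 2.
      rewrite -(subrKA (coord A q x)) (le_lt_trans (ler_normD _ _))//.
      by move: xr B vd; move: (`|_|) (`|_|) => a b; lra.
    have cc : {for v, continuous (fun v => coord A q (f (sg * v) x))}.
      apply: (@continuous_comp _ _ _ (fun u => f (sg * u) x) (coord A q)); first exact: cg.
      exact: coord_continuous.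
    have e0 : 0 < rho / 2 - `|coord A q (f (sg * v) x) - s0| by rewrite subr_gt0.
    have [d1 d10 d1P] := nbhs_exR (filterI (cont_nbhs (cg v) (dom_nbhs qv)) (cont_near cc e0)).
    exists d1 => // w /andP[vw wd] wm.
    have [|qw wr] := d1P w.
      by rewrite gtr0_norm ?subr_gt0// ltrBlDl.
    split=> //; rewrite -(subrKA (coord A q (f (sg * v) x))) (le_trans (ler_normD _ _))//.
    by move: wr; rewrite -lerBrDr.
move=> td.
have [t0|t0] := leP 0 t.
  have [|] := @key 1 (normr1 _) t _ td.
    by rewrite t0 le_min ler_norm (ltW (le_lt_trans (ler_norm _) td)).
  rewrite mul1r => qt tr; have [|y [qy Ny E]] := H1 (coord A q (f t x)).
    apply: le_lt_trans tr _; apply: (@lt_le_trans _ _ rho); last by rewrite ge_min lexx.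
    by rewrite ltr_pdivrMr// ltr_pMr// ltr1n.
  by rewrite -(coordK qt) E coordK.
have [||] := @key (- 1) _ (- t) _ td.
- by rewrite normrN normr1.
- by rewrite oppr_ge0 (ltW t0) le_min -(ltr0_norm t0) (ltW td) lexx.
rewrite mulrNN mul1r => qt tr; have [|y [qy Ny E]] := H1 (coord A q (f t x)).
  apply: le_lt_trans tr _; apply: (@lt_le_trans _ _ rho); last by rewrite ge_min lexx.
  by rewrite ltr_pdivrMr// ltr_pMr// ltr1n.
by rewrite -(coordK qt) E coordK.
Qed.

Lemma flow_continuous : continuous (fun z : R * M => f z.1 z.2).
Proof.
move=> [t0 x0] N Nf.
have [d d0 H] := flow_stay Nf.
have H1 := cont_nbhs ((flow_Ck t0).1 x0) H.
exists ([set t | `|t - t0| < d], [set x | forall t, `|t| < d -> N (f t (f t0 x))]).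
  by split=> //; exact: (@near_dist R R).
by move=> [t x] /= [td xN]; rewrite -[t](subrK t0) flowD; exact: xN.
Qed.

(* The flow map is strictly differentiable at time zero, with derivative
   (sigma, s) |-> s + sigma X. *)
Lemma flow_strict q : forall e : R, 0 < e -> exists2 d : R, 0 < d &
  forall s s' a b, `|s| < d -> `|s'| < d -> dom A q a -> dom A q b ->
    `|coord A q a - coord A q q| < d -> `|coord A q b - coord A q q| < d ->
    dom A q (f s' b) /\
    `|coord A q (f s' b) - coord A q (f s a) - (coord A q b - coord A q a)
      - (s' - s) *: X q| <= e * (`|coord A q b - coord A q a| + `|s' - s|).
Proof.
move=> e e0; set s0 := coord A q q.
have [K [r2 [K0 r20 HK]]] := field_lipschitz q.
pose rho := Num.min r2 (e / K).
have rho0 : 0 < rho by rewrite lt_min r20 divr_gt0.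
have rr2 : rho <= r2 by rewrite ge_min lexx.
have Krho : K * rho <= e by rewrite mulrC -ler_pdivlMr// ge_min lexx orbT.
have N1 : nbhs q [set x | dom A q x /\ `|coord A q x - s0| <= rho / 2].
  apply: filterI; first exact/dom_nbhs/dom_center.
  by apply: cont_near; [exact/coord_continuous/dom_center|rewrite half_gt0].
have [d1 d10 H1] := flow_stay N1.
have [d2 d20 H2] := chart_ball H1.
pose d := Num.min d1 (Num.min d2 (Num.min (1 / (2 * K)) (e / (2 * K)))).
have K2 : 0 < 2 * K by rewrite mulr_gt0.
have d0 : 0 < d by rewrite !lt_min d10 d20 !divr_gt0.
have dd1 : d <= d1 by rewrite ge_min lexx.
have dd2 : d <= d2 by rewrite !ge_min lexx orbT.
have dK1 : d * (2 * K) <= 1 by rewrite -ler_pdivlMr// !ge_min lexx !orbT.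
have dKe : d * (2 * K) <= e by rewrite -ler_pdivlMr// !ge_min lexx !orbT.
exists d => //.
have stay a s : dom A q a -> `|coord A q a - s0| < d -> `|s| < d ->
    dom A q (f s a) /\ `|coord A q (f s a) - s0| < rho.
  move=> qa ad sd.
  have [y [qy Hy E]] := H2 _ (lt_le_trans ad dd2).
  have ay : a = y by rewrite -(coordK qa) E coordK.
  subst y; have [qs sr] := Hy s (lt_le_trans sd dd1); split=> //.
  by apply: le_lt_trans sr _; rewrite ltr_pdivrMr// ltr_pMr// ltr1n.
move=> s s' a b sd s'd qa qb ad bd; split; first by have [] := stay b s' qb bd s'd.
pose u s := coord A q (f s b) - coord A q (f s a).
pose du s := field q (coord A q (f s b)) - field q (coord A q (f s a)).
have ud t : `|t| < d -> is_derive t (1 : R) u (du t).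
  move=> td; have [qb' _] := stay b t qb bd td; have [qa' _] := stay a t qa ad td.
  by apply: is_deriveB; exact: orbit_is_derive.
have duK t : `|t| < d -> `|du t| <= K * `|u t|.
  move=> td; have [_ rb] := stay b t qb bd td; have [_ ra] := stay a t qa ad td.
  by apply: HK; exact: lt_le_trans rr2.
have u0 : u 0 = coord A q b - coord A q a by rewrite /u !flow0.
have mvu t C (x y : R) : `|t| < d -> (forall v, `|v| <= `|t| -> `|du v| <= C) ->
    `|x| <= `|t| -> `|y| <= `|t| -> `|u x - u y| <= C * `|x - y|.
  move=> td HC.
  have mv (x' y' : R) : `|x'| <= `|t| -> `|y'| <= `|t| -> y' <= x' ->
      `|u x' - u y'| <= C * (x' - y').
    move=> xt yt yx.
    have vt v : y' <= v <= x' -> `|v| <= `|t|.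
      move: xt yt; rewrite !ler_norml => /andP[a1 a2] /andP[b1 b2] /andP[c1 c2].
      by apply/andP; split; lra.
    apply: (mean_value_rV (df := du)) => // v /vt vt'; last exact: HC.
    by apply: ud; apply: le_lt_trans td.
  move=> xt yt; have [yx|/ltW xy] := leP y x.
    by rewrite (ger0_norm (_ : 0 <= x - y)) ?subr_ge0//; exact: mv.
  by rewrite distrC (distrC x) (ger0_norm (_ : 0 <= y - x)) ?subr_ge0//; exact: mv.
(* In place of Gronwall's inequality, the difference [u] of two orbits is maximized at some [c];
   since [d * K <= 1 / 2], the bound on its derivative gives [M2], hence the estimate. *)
have uM t : `|t| < d -> `|u t - u 0| <= e * `|u 0|.
  move=> td.
  have [||c cI cM] := @EVT_max R (fun v => `|u v|) (- `|t|) `|t|.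
  - by rewrite (le_trans (_ : _ <= 0))// oppr_le0.
  - apply: continuous_in_subspaceT => v; rewrite inE /= in_itv /= -ler_norml => vt.
    apply: (@continuous_comp _ _ _ u (fun w => `|w|)); last exact: norm_continuous.
    apply: differentiable_continuous; apply/derivable1_diffP.
    by have [] := ud v (le_lt_trans vt td).
  move: cI; rewrite in_itv /= -ler_norml => ct.
  have HC v : `|v| <= `|t| -> `|du v| <= K * `|u c|.
    move=> vt; apply: le_trans (duK v (le_lt_trans vt td)) _.
    by rewrite ler_pM2l//; apply: cM; rewrite in_itv /= -ler_norml.
  have z : `|0 : R| <= `|t| by rewrite normr0.
  have C1 := mvu t _ c 0 td HC ct z; rewrite subr0 in C1.
  have cd : `|c| <= d by rewrite ltW// (le_lt_trans ct).
  have M2 : `|u c| <= 2 * `|u 0|.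
    have h1 : `|u c| <= `|u 0| + `|u c - u 0|.
      by rewrite -{1}[u c](subrK (u 0)) addrC ler_normD.
    have h2 : K * `|u c| * `|c| <= 1 / 2 * `|u c|.
      have -> : K * `|u c| * `|c| = (`|c| * K) * `|u c| by ring.
      rewrite ler_wpM2r//; apply: (@le_trans _ _ (d * K)); first by rewrite ler_pM2r.
      by move: dK1; rewrite mulrCA; lra.
    by lra.
  have C2 := mvu t _ t 0 td HC (lexx _) z; rewrite subr0 in C2.
  apply: le_trans C2 _.
  apply: (@le_trans _ _ (K * (2 * `|u 0|) * d)).
    by rewrite ler_pM ?mulr_ge0 ?(ltW K0) ?ler_pM2l ?(ltW td).
  have -> : K * (2 * `|u 0|) * d = d * (2 * K) * `|u 0| by ring.
  by rewrite ler_wpM2r.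
pose w t := coord A q (f t a) - t *: X q.
have wd t : `|t| < d -> is_derive t (1 : R) w (field q (coord A q (f t a)) - X q).
  move=> td; have [qa' _] := stay a t qa ad td.
  apply: is_deriveB; last exact/sderiv_is_derive/sderiv_scalel.
  exact: orbit_is_derive.
have we t : `|t| < d -> `|field q (coord A q (f t a)) - X q| <= e.
  move=> td; have [_ ra] := stay a t qa ad td.
  rewrite -field_center; apply: le_trans (HK _ _ _ _) _.
  - exact: lt_le_trans rr2.
  - by rewrite subrr normr0.
  - by apply: le_trans Krho; rewrite ler_pM2l// ltW.
have wM : `|w s' - w s| <= e * `|s' - s|.
  have mv (x y : R) : `|x| < d -> `|y| < d -> y <= x -> `|w x - w y| <= e * (x - y).
    move=> xt yt yx.
    have vt v : y <= v <= x -> `|v| < d.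
      move: xt yt; rewrite !ltr_norml => /andP[a1 a2] /andP[b1 b2] /andP[c1 c2].
      by apply/andP; split; lra.
    apply: (mean_value_rV (df := fun t => field q (coord A q (f t a)) - X q)) => // v /vt vd.
      exact: wd.
    exact: we.
  have [yx|/ltW xy] := leP s s'.
    by rewrite (ger0_norm (_ : 0 <= s' - s)) ?subr_ge0//; exact: mv.
  by rewrite distrC (distrC s') (ger0_norm (_ : 0 <= s - s')) ?subr_ge0//; exact: mv.
have -> : coord A q (f s' b) - coord A q (f s a) - (coord A q b - coord A q a)
    - (s' - s) *: X q = (u s' - u 0) + (w s' - w s) by rewrite u0 /u /w; zmod.
by rewrite (le_trans (ler_normD _ _))// mulrDr lerD// -u0; exact: uM.
Qed.

(** Near [t] the map is written as [f (th x - th t)] after the fixed map [f (th t)]: the chain rule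
    for a single time handles the latter, and the former has a time close to zero, where
    [flow_strict] applies. *)
Lemma mderiv_flow (th : R -> R) (c : R -> M) t th' v :
  sderiv th t th' -> mderiv A c t v ->
  mderiv A (fun t => f (th t) (c t)) t
    (tangent_map A (f (th t)) (c t) v + th' *: X (f (th t) (c t))).
Proof.
move=> thd cv.
set q := f (th t) (c t); set v1 := tangent_map A _ _ _.
have [cc _] := cv.
split.
  apply: (@continuous_comp _ _ _ (fun t => (th t, c t)) (fun z : R * M => f z.1 z.2)).
    by apply: continuous_pair => //; exact: sderiv_continuous thd.
  exact: flow_continuous.
have c1v : mderiv A (f (th t) \o c) t v1 := mderiv_map (flow_Ck (th t)) cv.
have [c1c c1d] := c1v.
rewrite -/q; move=> e e0.
pose B := `|v1| + `|th'| + `|X q| + 3.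
have B0 : 0 < B by rewrite ltr_wpDl// !addr_ge0.
pose e1 := Num.min 1 (e / B).
have e10 : 0 < e1 by rewrite lt_min ltr01 divr_gt0.
have [d d0 Hd] := flow_strict q e10.
have [d1 d10 H1] := c1d _ e10.
have [d2 d20 H2] := thd _ e10.
have [d3 d30 H3] := nbhs_exR (cont_nbhs c1c (dom_nbhs (dom_center A q))).
have c1q : {for t, continuous (fun t' => coord A q ((f (th t) \o c) t'))}.
  exact: sderiv_continuous c1d.
have [d4 d40 H4] := (contP _ _).1 c1q _ d0.
have [d5 d50 H5] := (contP _ _).1 (sderiv_continuous thd) _ d0.
exists (Num.min d1 (Num.min d2 (Num.min d3 (Num.min d4 d5)))).
  by rewrite !lt_min d10 d20 d30 d40.
move=> a b; rewrite !lt_min => /and5P[a1 a2 a3 a4 a5] /and5P[b1 b2 b3 b4 b5].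
have E (x : R) : f (th x) (c x) = f (th x - th t) (f (th t) (c x)).
  by rewrite -flowD subrK.
rewrite !E.
have [_ F1] := Hd _ _ _ _ (H5 _ b5) (H5 _ a5) (H3 _ b3) (H3 _ a3) (H4 _ b4) (H4 _ a4).
have F2 := H1 _ _ a1 b1; have F3 := H2 _ _ a2 b2.
rewrite /= in F1 F2.
set Ca := coord A q (f (th t) (c a)) in F1 F2; set Cb := coord A q (f (th t) (c b)) in F1 F2.
set Fa := coord A q (f (th a - th t) _) in F1 *; set Fb := coord A q (f (th b - th t) _) in F1 *.
have Et : th a - th t - (th b - th t) = th a - th b by ring.
rewrite Et in F1.
have e11 : e1 <= 1 by rewrite ge_min lexx.
have G2 : `|Ca - Cb| <= (`|v1| + 1) * `|a - b|.
  rewrite -[Ca - Cb](subrK ((a - b) *: v1)) (le_trans (ler_normD _ _))//.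
  rewrite normrZ mulrDl mul1r addrC mulrC lerD2l (le_trans F2)//.
  by rewrite ler_piMl.
have F3' : `|th a - th b - (a - b) * th'| <= e1 * `|a - b| := F3.
have G3 : `|th a - th b| <= (`|th'| + 1) * `|a - b|.
  rewrite -[th a - th b](subrK ((a - b) * th')) (le_trans (ler_normD _ _))//.
  have E1 : `|(a - b) * th'| = `|th'| * `|a - b| by rewrite normrM mulrC.
  have E2 : e1 * `|a - b| <= `|a - b| by rewrite ler_piMl.
  by rewrite E1; lra.
have -> : Fa - Fb - (a - b) *: (v1 + th' *: X q) =
   (Fa - Fb - (Ca - Cb) - (th a - th b) *: X q) + (Ca - Cb - (a - b) *: v1)
   + (th a - th b - (a - b) * th') *: X q.
  have -> : (th a - th b - (a - b) * th') *: X q =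
    (th a - th b) *: X q - (a - b) *: (th' *: X q) by rewrite scalerBl scalerA.
  by zmod.
apply: (@le_trans _ _ (e1 * B * `|a - b|)); last first.
  rewrite ler_wpM2r//.
  have : e1 <= e / B by rewrite ge_min lexx orbT.
  by rewrite ler_pdivlMr.
apply: (@le_trans _ _ (e1 * ((`|v1| + 1) * `|a - b| + (`|th'| + 1) * `|a - b|) + e1 * `|a - b| + e1 * `|a - b| * `|X q|)).
  rewrite (le_trans (ler_normD _ _))// lerD//; last by rewrite normrZ ler_wpM2r.
  rewrite (le_trans (ler_normD _ _))// lerD//.
  by apply: le_trans F1 _; rewrite ler_pM2l// lerD.
by rewrite /B le_eqVlt; apply/orP; left; apply/eqP; ring.
Qed.

Lemma mderiv_orbit t x : mderiv A (fun t => f t x) t (X (f t x)).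
Proof.
have H1 := sderiv_id t.
have H2 : mderiv A (fun=> x) t 0.
  by split; [exact: cst_continuous|exact: sderiv_cst].
have := mderiv_flow H1 H2.
by rewrite (lin0 (tangent_map_lin (flow_Ck t) x)) add0r scale1r.
Qed.

(** The image under [f t] of the orbit of [x] is differentiated at time 0 in two ways: by the chain
    rule, and as the same orbit shifted by [t]. *)
Lemma tangent_map_field t x : tangent_map A (f t) x (X x) = X (f t x).
Proof.
have H := mderiv_map (flow_Ck t) (mderiv_orbit 0 x).
rewrite flow0 in H.
have := mderiv_orbit (t + 0) x; rewrite addr0 => H'.
have H1 : sderiv (fun h : R => t + h) 0 (1 : R).
  rewrite -[1]add0r; apply: (sderivD (W := R)); first exact: sderiv_cst.
  exact: sderiv_id.
have H2 : mderiv A (fun=> x) 0 0.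
  by split; [exact: cst_continuous|exact: sderiv_cst].
have := mderiv_flow H1 H2.
rewrite addr0 (lin0 (tangent_map_lin (flow_Ck t) x)) add0r scale1r => H3.
apply: mderiv_unique H _; apply: mderiv_near H3 _.
by apply: nbhsW => h /=; rewrite flowD.
Qed.

Lemma tangent_map_flow s t x v :
  tangent_map A (f s) (f t x) (tangent_map A (f t) x v) = tangent_map A (f (s + t)) x v.
Proof.
have E : f s \o f t = f (s + t) by apply/funext => y /=; rewrite flowD.
by rewrite -E; apply: (tangent_map_comp (r := r)); rewrite ?E; exact: flow_Ck.
Qed.

Lemma tangent_map_flow0 x v : tangent_map A (f 0) x v = v.
Proof.
have -> : f 0 = id by apply/funext => y; exact: flow0.
exact: tangent_map_id.
Qed.

End flow.

Lemma norm_near_le {R : realType} (W : normedModType R) (a b : W) (e V : R) :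
  `|a - b| <= e -> `|a| <= V -> `|b| <= V + e.
Proof.
move=> ab aV; rewrite -[b](subKr a) (le_trans (ler_normB _ _))//.
by rewrite lerD.
Qed.

Lemma leaf_nbhs_coords {R : realType} {n r : nat} {M : topologicalType}
    (A : atlas R n r.+2 M) {k l m : nat} (F : foliation A k l m.+1) (q x : M) (d : R) :
  fdom F q x -> 0 < d ->
  nbhs (x : leaf_space F) [set z : leaf_space F | [/\ fdom F q z,
    trans F q z = trans F q x & `|along F q z - along F q x| < d]].
Proof.
move=> qx d0; have [_ t1] := fdom_cube qx.
apply: (@filterS _ _ (nbhs_filter (x : leaf_space F)) _ _ _ (nbhs_plaque_nbhd qx d0)).
move=> z [s [/ball01 s1 sd ->]].
by rewrite /= (plaqueK F q s1 t1).1 (plaqueK F q s1 t1).2; split=> //; exact: plaque_fdom.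
Qed.

(** * Invariance of the leaves under the flow *)

Section leaf_flow.
Context {R : realType} {n r : nat} {M : topologicalType} (A : atlas R n r.+2 M).
Variables (f : R -> M -> M) (X : M -> 'rV[R]_n).
Hypotheses (hf : flow_of_class A r.+1 f X) (hM : hausdorff_space M).
Context {k l m : nat} (F : foliation A k l m.+1).
Hypothesis FX : forall x, tangent_space F x (X x).
Implicit Types (q x : M).

(** The plaque of [q] is the surface to which [integral_curve_surface] is applied: tangency of [X]
    lifts the field to plaque coordinates as [w], with a bound uniform near [q]. *)
Lemma orbit_plaque q : exists2 d : R, 0 < d & forall t : R, `|t| <= d ->
  fdom F q (f t q) /\ trans F q (f t q) = trans F q q.
Proof.
have qq := fdom_center F q; have dq := dom_center A q.
have [a1 t1] := fdom_cube qq; set s0 := along F q q in a1; set y0 := trans F q q in t1.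
pose P s := coord A q (plaque F q s y0).
have Pq : plaque F q s0 y0 = q := fchartK qq.
have [K [r2 [K0 r20 HK]]] := field_lipschitz hf q.
have px : dom A q (plaque F q s0 y0) by rewrite Pq.
have [J [Jl [CJ CJ0 JC] JK]] := plaque_left_inverse a1 t1 px.
have [sd0 fam] := plaque_sdiff_family a1 t1 px.
have e0 : 0 < (2 * CJ)^-1 by rewrite invr_gt0 mulr_gt0.
have [d2 d20 /nbhs_singleton Hd2] := fam _ e0.
have cpl := @plaque_continuous_along _ _ _ _ _ _ _ _ F q _ _ a1 t1.
have N1 : \forall s \near s0, [/\ `|s| < 1, dom A q (plaque F q s y0) &
    `|P s - coord A q q| < r2].
  have H1 : \forall s \near s0, `|s| < 1.
    have : nbhs s0 (ball 0 1 : set 'rV[R]_k) by apply: open_nbhs_nbhs; split => //; exact: ball_open.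
    by apply: filterS => s /ball01.
  have H2 := cont_nbhs cpl (dom_nbhs px).
  have H3 : \forall s \near s0, `|P s - coord A q q| < r2.
    have [d dd H] := (contP P s0).1 (sdiff_continuous sd0) _ r20.
    apply/nbhs_dist; exists d => // s /H; rewrite /P Pq.
    by [].
  near=> s; split; [near: s; exact: H1|near: s; exact: H2|near: s; exact: H3].
have [d3 d30 Hd3] := nbhs_ex N1.
pose rho := Num.min d2 d3 / 2.
have m0 : 0 < Num.min d2 d3 by rewrite lt_min d20.
have rho0 : 0 < rho by rewrite half_gt0.
have rho23 s : `|s - s0| <= rho -> `|s - s0| < d2 /\ `|s - s0| < d3.
  move=> sr; have : `|s - s0| < Num.min d2 d3.
    by apply: le_lt_trans sr _; rewrite ltr_pdivrMr// ltr_pMr// ltr1n.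
  by rewrite lt_min => /andP.
have sP s : `|s - s0| <= rho -> [/\ ball 0 1 s, dom A q (plaque F q s y0) &
    `|P s - coord A q q| < r2].
  by move=> /rho23[_ /Hd3[/ball01]].
have sdP s : `|s - s0| <= rho -> sdiff P s (plaque_deriv F q q s y0).
  by move=> /sP[s1 ds _]; have [] := plaque_sdiff_family s1 t1 ds.
pose V := K * r2 + `|field A X q (coord A q q)|.
have V0 : 0 <= V by rewrite addr_ge0// mulr_ge0 ?ltW.
have fV s : `|s - coord A q q| < r2 -> `|field A X q s| <= V.
  move=> sr; rewrite -[field A X q s](subrK (field A X q (coord A q q))).
  rewrite (le_trans (ler_normD _ _))// lerD2r.
  apply: le_trans (HK _ _ sr _) _; first by rewrite subrr normr0.
  by rewrite ler_pM2l// ltW.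
(* The left inverse at [s0], with derivatives differing by at most [1 / (2 * CJ)], gives
   [|w| <= CJ * V + |w| / 2]. *)
pose C := 2 * CJ * V + 1.
have C0 : 0 < C by rewrite ltr_wpDl// !mulr_ge0// ltW.
have wex s : exists w, `|s - s0| <= rho ->
    `|w| <= C /\ plaque_deriv F q q s y0 w = field A X q (P s).
  have [sr|nsr] := pselect (`|s - s0| <= rho); last by exists 0.
  have [s1 ds Pr] := sP s sr.
  have [c [c0 lc cX]] := tangent_space_curve (FX (plaque F q s y0)).
  have qc : fdom F q (c 0) by rewrite c0; exact: plaque_fdom.
  have dc : dom A q (c 0) by rewrite c0.
  have [w _ E] := leaf_deriv lc qc dc (mderiv_chart dc cX).
  exists w => _; move: E; rewrite c0 (plaqueK F q s1 t1).1 (plaqueK F q s1 t1).2 => E.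
  have E' : plaque_deriv F q q s y0 w = field A X q (P s) by rewrite /P (field_coord X ds) -E.
  split=> //.
  have [sd2 _] := rho23 s sr.
  have D0 : 0 < d2 - `|s - s0| by rewrite subr_gt0.
  have [L0l _ _] := sd0.
  have B : `|plaque_deriv F q q s y0 w - plaque_deriv F q q s0 y0 w| <= (2 * CJ)^-1 * `|w|.
    apply: (sdiff_bound D0 (linZ L0l) _ (sdP s sr)) => a b ad bd.
    by apply: Hd2; rewrite -[_ - s0](subrKA s) (le_lt_trans (ler_normD _ _))// -ltrBrDr.
  have B2 : `|w| <= CJ * `|plaque_deriv F q q s0 y0 w| by rewrite -{1}[w]JK; exact: JC.
  have B3 : `|plaque_deriv F q q s0 y0 w| <= V + (2 * CJ)^-1 * `|w|.
    by apply: norm_near_le B _; rewrite E'; exact: fV Pr.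
  have B4 : `|w| <= CJ * V + 1 / 2 * `|w|.
    apply: le_trans B2 _; apply: (@le_trans _ _ (CJ * (V + (2 * CJ)^-1 * `|w|))).
      by rewrite ler_pM2l.
    rewrite mulrDr lerD2l mulrA le_eqVlt; apply/orP; left; apply/eqP.
    by congr (_ * _); field; rewrite gt_eqF.
  by rewrite /C -mulrA; move: B4; move: (CJ * V) => z; lra.
have [w wP] := choice wex.
have Nq : nbhs q [set x | dom A q x /\ `|coord A q x - coord A q q| < r2].
  apply: filterI; first exact: dom_nbhs.
  have H := @cont_near R _ _ (coord A q) q _ (coord_continuous dq) (half_gt0 r20).
  by apply: filterS H => x /le_lt_trans; apply; rewrite ltr_pdivrMr// ltr_pMr// ltr1n.
have [d1 d10 /nbhs_singleton Hd1] := flow_stay hf hM Nq.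
pose d := Num.min (d1 / 2) (Num.min (rho / C) (1 / (2 * K))).
have K2 : 0 < 2 * K by rewrite mulr_gt0.
have d0 : 0 < d by rewrite !lt_min half_gt0// !divr_gt0.
have dd1 : d < d1.
  by apply: le_lt_trans (_ : d1 / 2 < d1); [rewrite ge_min lexx|rewrite ltr_pdivrMr// ltr_pMr// ltr1n].
have dC : C * d <= rho by rewrite mulrC -ler_pdivlMr// !ge_min lexx orbT.
have dK : K * d <= 1 / 2.
  have : d * (2 * K) <= 1 by rewrite -ler_pdivlMr// !ge_min lexx !orbT.
  have -> : d * (2 * K) = 2 * (K * d) by ring.
  by move: (K * d) => z; lra.
exists d => // t td.
suff [s sr E] : exists2 s, `|s - s0| <= rho & coord A q (f t q) = P s.
  have [s1 ds _] := sP s sr.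
  have [qt _] := Hd1 t (le_lt_trans td dd1).
  have -> : f t q = plaque F q s y0 by rewrite -(coordK qt) E /P coordK.
  by split; [exact: plaque_fdom|exact: (plaqueK F q s1 t1).2].
have tT : C * `|t| <= rho by apply: le_trans dC; rewrite ler_pM2l.
have tK : K * `|t| <= 1 / 2 by apply: le_trans dK; rewrite ler_pM2l.
have P0 : coord A q (f 0 q) = P s0 by rewrite (flow0 hf) /P Pq.
have inr u : 0 <= u <= `|t| -> `|u| < d1.
  by move=> /andP[u0 ut]; rewrite ger0_norm// (le_lt_trans ut)// (le_lt_trans td).
have [t0|t0] := leP 0 t.
  have At : `|t| = t by rewrite ger0_norm.
  rewrite At in tT tK inr.
  apply: (@integral_curve_surface R k n P (fun s => plaque_deriv F q q s y0) w
    (field A X q) s0 (fun u => coord A q (f u q)) rho K V C t) => //.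
  - exact: ltW.
  - by move=> u /inr/Hd1[qu _]; exact: (orbit_is_derive hf).
  - by move=> u /inr/Hd1[_]; exact: fV.
  - by move=> u u' /inr/Hd1[_ h] /inr/Hd1[_ h']; exact: HK.
  - by move=> u s /inr/Hd1[_ h] /sP[_ _ h']; exact: HK.
have At : `|t| = - t by rewrite ltr0_norm.
rewrite At in tT tK inr.
have Hn u : 0 <= u <= - t -> dom A q (f (-1 * u) q) /\
    `|coord A q (f (-1 * u) q) - coord A q q| < r2.
  by move=> /inr ud; apply: Hd1; rewrite mulN1r normrN.
have opB (a b : 'rV[R]_n) : `|- a - - b| = `|a - b|.
  by rewrite (_ : - a - - b = - (a - b)) ?normrN//; zmod.
have [] := @integral_curve_surface R k n P (fun s => plaque_deriv F q q s y0) (fun s => - w s)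
    (fun z => - field A X q z) s0 (fun u => coord A q (f (-1 * u) q)) rho K V C (- t).
- exact: ltW.
- exact: V0.
- exact: C0.
- by rewrite oppr_ge0 ltW.
- exact: sdP.
- move=> s sr; have [h1 h2] := wP s sr; rewrite normrN; split; first exact: h1.
  have [Ll _ _] := sdP s sr.
  by rewrite -scaleN1r (linZ Ll) h2 scaleN1r.
- move=> u /Hn[qu _]; have := is_derive_scale_arg (orbit_is_derive hf qu).
  by rewrite scaleN1r.
- by move=> u /Hn[_ h]; rewrite normrN; exact: fV h.
- by move=> u u' /Hn[_ h] /Hn[_ h']; rewrite opB; exact: HK h h'.
- by move=> u s /Hn[_ h] /sP[_ _ h']; rewrite opB; exact: HK h h'.
- by rewrite mulr0.
- exact: tT.
- exact: tK.
- by move=> s sr; rewrite mulN1r opprK => E; exists s.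
Unshelve. all: by end_near. Qed.

Lemma orbit_lcont x : continuous ((fun t => f t x) : R -> leaf_space F).
Proof.
have main q : {for (0 : R), continuous ((fun t => f t q) : R -> leaf_space F)}.
  apply/(lcontP (q := q)); first by rewrite (flow0 hf); exact: fdom_center.
  split; first exact: (orbit_continuous hf).
  have [d d0 dP] := orbit_plaque q.
  apply/nbhs_dist; exists d => // t; rewrite subr0 => td.
  by rewrite (flow0 hf); have [] := dP t (ltW td).
move=> t.
have E : (fun t => f t x) = (fun h => f h (f t x)) \o (fun s => s - t).
  by apply/funext => s /=; rewrite -(flowD hf) subrK.
have H := main (f t x).
have S : {for t, continuous (fun s : R => s - t)}.
  by apply: (@cvgB _ R^o); [exact: cvg_id|exact: cvg_cst].
have := @continuous_comp R R (leaf_space F) (fun s => s - t) (fun h => f h (f t x)) t S.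
by rewrite subrr => /(_ H); rewrite -E.
Qed.

Lemma leaf_id_continuous : continuous (fun x : leaf_space F => x : M).
Proof. by move=> x; apply: (@lcont_cont _ _ _ _ A _ _ _ F (leaf_space F) (fun x : leaf_space F => (x : M))); exact: cvg_id. Qed.

Lemma orbit_trans q x (t : R) :
  (forall u, 0 <= u <= 1 -> fdom F q (f (u * t) x)) ->
  trans F q (f t x) = trans F q x.
Proof.
move=> H.
have lc u : {for u, continuous ((fun u => f (u * t) x) : R -> leaf_space F)}.
  apply: (@continuous_comp R R (leaf_space F) (fun u => u * t) (fun t => f t x)).
    exact: mulrr_continuous.
  exact: orbit_lcont.
have := @loc_const R _ (fun u => trans F q (f (u * t) x)) 0 1 _ 1.
rewrite mul0r mul1r (flow0 hf) ler01 lexx; apply=> // u u01.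
have := lcont_trans (H u u01) (lc u).
by move=> /nbhs_exR[d d0 dP]; exists d => // s _; exact: dP.
Qed.

(** For a short time the orbits of all points near [q] stay in one foliation chart, where the
    transverse coordinate is constant along them. *)
Lemma leaf_flow_continuous :
  continuous ((fun z : R * leaf_space F => f z.1 z.2) : _ -> leaf_space F).
Proof.
apply: (@local_flow_continuous R (leaf_space F) f).
- exact: (flow0 hf).
- exact: (flowD hf).
- exact: orbit_lcont.
move=> q; have qq := fdom_center F q.
have [d d0 dP] := flow_stay hf hM (fdom_nbhs qq).
exists d => //.
pose S : set (leaf_space F) := [set x | (forall t : R, `|t| < d -> fdom F q (f t x)) /\
  trans F q x = trans F q q].
have Sq : nbhs (q : leaf_space F) S.
  have H1 : nbhs (q : leaf_space F) [set x : leaf_space F | forall t : R, `|t| < d -> fdom F q (f t x)].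
    exact: (@cont_nbhs (leaf_space F) M (fun x => x) q _ (@leaf_id_continuous q) dP).
  suff H2 : nbhs (q : leaf_space F) [set x : leaf_space F | trans F q x = trans F q q].
    by apply: filterS2 H1 H2.
  by apply: filterS (leaf_nbhs_coords qq ltr01) => z [].
have Strans x (t : R) : S x -> `|t| < d -> trans F q (f t x) = trans F q q.
  move=> [Sx <-] td; apply: orbit_trans => u /andP[u0 u1]; apply: Sx.
  rewrite normrM ger0_norm// (le_lt_trans _ td)// ler_piMl//.
apply: filterS (nbhs_interior Sq) => x xS t td.
have Sx := nbhs_singleton xS.
refine (proj2 (@lcontP _ _ _ _ _ _ _ _ F (R * leaf_space F)%type (fun y : R * leaf_space F => f y.1 y.2) (t, x) q (Sx.1 t td)) _).
split.
  apply: (@continuous_comp _ _ _ (fun z : R * leaf_space F => (z.1, z.2 : M)) (fun z : R * M => f z.1 z.2)).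
    apply: continuous_pair; first exact: cvg_fst.
    apply: (@continuous_comp _ _ _ (fun z : R * leaf_space F => z.2) (fun x : leaf_space F => x : M)).
      exact: cvg_snd.
    exact: leaf_id_continuous.
  exact: (flow_continuous hf hM).
exists ([set t | `|t| < d], S).
  split=> //=; have e0 : 0 < d - `|t| by rewrite subr_gt0.
  apply/nbhs_dist; exists (d - `|t|) => // s sd /=.
  by rewrite -[s](subrK t) (le_lt_trans (ler_normD _ _))// -ltrBrDr.
by move=> [t' x'] /= [t'd Sx']; rewrite !Strans.
Qed.

Lemma leaf_flow x y (t : R) : leaf F x y -> leaf F x (f t y).
Proof.
move=> xy; have := @leaf_lcont R n r M A k l m F (fun u => f (u * t) y) x 0 1 ler01.
rewrite mul0r mul1r (flow0 hf); apply => // u _.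
apply: (@continuous_comp R R (leaf_space F) (fun u => u * t) (fun t => f t y)).
  exact: mulrr_continuous.
exact: orbit_lcont.
Qed.

End leaf_flow.

Lemma nbhsI (T : topologicalType) (x : T) (P Q : set T) :
  nbhs x P -> nbhs x Q -> nbhs x (P `&` Q).
Proof. exact: filterI. Qed.

Lemma contN {R : realType} (T : topologicalType) (W : normedModType R) (f : T -> W) (x : T) :
  (forall e : R, 0 < e -> nbhs x [set y | `|f y - f x| <= e]) -> {for x, continuous f}.
Proof.
move=> H; apply/cvgrPdist_le => e e0; apply: filterS (H e e0) => y /=.
by rewrite distrC.
Qed.

(** * Local heights *)

Section heights.
Context {R : realType} {n r : nat} {M : topologicalType} (A : atlas R n r.+2 M).
Variables (f : R -> M -> M) (X : M -> 'rV[R]_n).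
Hypotheses (hf : flow_of_class A r.+1 f X) (hM : hausdorff_space M).
Context {k l : nat} (Wcu : foliation A k.+1 l r.+1) (Wu : foliation A k l.+1 1).
Variable Eu : M -> set 'rV[R]_n.
Hypothesis cuE : forall x,
  tangent_space Wcu x = [set u + v | u in Eu x & v in line (X x)].
Hypothesis uE : forall x, tangent_space Wu x = Eu x.
Hypothesis Eu0 : forall x, Eu x 0.
Hypothesis Eu_inv : forall t x, tangent_map A (f t) x @` Eu x = Eu (f t x).
Hypothesis sub_trans : forall q, exists2 N, nbhs q N &
  forall z z', N z -> N z' -> trans Wu q z = trans Wu q z' ->
    trans Wcu q z = trans Wcu q z'.
Variables (O : M -> set 'rV[R]_k.+1) (tau : M -> 'rV[R]_k.+1 -> R).
Hypothesis tau_spec : forall q,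
  let P := fun s => plaque Wcu q s (trans Wcu q q) in
  [/\ open (O q), O q (along Wcu q q),
      forall s, O q s -> ball 0 1 s /\ fdom Wu q (P s),
      Ck r.+1 (O q) (tau q : 'rV[R]_k.+1 -> R^o) /\
        (forall s, O q s -> exists w, 'D_w (tau q : 'rV[R]_k.+1 -> R^o) s != 0) &
      forall s s', O q s -> O q s' ->
        (tau q s = tau q s' <-> trans Wu q (P s) = trans Wu q (P s'))].
Implicit Types (q x z : M).

Lemma field_tangent x : tangent_space Wcu x (X x).
Proof.
rewrite cuE; exists 0; first exact: Eu0.
by exists (X x); rewrite ?add0r//; exists 1; rewrite ?scale1r.
Qed.

Lemma lcont_sub (T : topologicalType) (c : T -> M) t :
  {for t, continuous (c : T -> leaf_space Wu)} ->
  {for t, continuous (c : T -> leaf_space Wcu)}.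
Proof.
move=> lc; have cc := lcont_cont lc.
apply/(lcontP (q := c t)); first exact: fdom_center.
split=> //; have [N Nt NP] := sub_trans (c t).
apply: filterS2 (cont_nbhs cc Nt) (lcont_trans (fdom_center Wu (c t)) lc) => t' Nt' E.
by apply: NP => //; exact: nbhs_singleton.
Qed.

Lemma leaf_nbhsW (x : M) (B : set M) :
  nbhs (x : M) B -> nbhs (x : leaf_space Wcu) (B : set (leaf_space Wcu)).
Proof.
have idc := @leaf_id_continuous R n r M A k.+1 l r Wcu x.
by move=> H; exact: (@cont_nbhs (leaf_space Wcu) M (fun x => x) x B idc H).
Qed.

(** The part of the plaque of [q] where the submersion [tau q] is available: a neighbourhood for the
    leaf topology, not for that of [M]. *)
Definition level_dom q : set (leaf_space Wcu) := [set z | [/\ fdom Wcu q z,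
  trans Wcu q z = trans Wcu q q & O q (along Wcu q z)]].

Definition level q z := tau q (along Wcu q z).

Lemma level_domE q z : level_dom q z ->
  plaque Wcu q (along Wcu q z) (trans Wcu q q) = z.
Proof. by move=> [qz <- _]; exact: fchartK. Qed.

Lemma level_dom_center q : level_dom q q.
Proof. by have [_ Oq _ _ _] := tau_spec q; split=> //; exact: fdom_center. Qed.

Lemma level_dom_fdom q z : level_dom q z -> fdom Wu q z.
Proof.
move=> qz; have [_ _ H _ _] := tau_spec q; have [_ _ /H[_]] := qz.
by rewrite level_domE.
Qed.

Lemma level_eq q z z' : level_dom q z -> level_dom q z' ->
  (level q z = level q z' <-> trans Wu q z = trans Wu q z').
Proof.
move=> qz qz'; have [_ _ _ _ H] := tau_spec q.
have [_ _ Oz] := qz; have [_ _ Oz'] := qz'.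
by have := H _ _ Oz Oz'; rewrite !level_domE.
Qed.

Lemma level_dom_nbhs q z : level_dom q z -> nbhs (z : leaf_space Wcu) (level_dom q).
Proof.
move=> [qz tz Oz]; have [oO _ _ _ _] := tau_spec q.
have [d d0 dO] : exists2 d : R, 0 < d & forall s, `|s - along Wcu q z| < d -> O q s.
  by apply: nbhs_ex; exact: open_nbhs_nbhs.
apply: (@filterS _ _ (nbhs_filter (z : leaf_space Wcu)) _ _ _ (leaf_nbhs_coords qz d0)).
by move=> y [qy ty yd]; split; [exact: qy|rewrite ty|exact: dO].
Qed.

(** The differential of the level is extended from the leaf to all of the tangent space through a
    left inverse of the plaque immersion; only its values on vectors tangent to the leaf matter. *)
Lemma level_deriv q z : level_dom q z -> exists L : 'rV[R]_n -> R,
  [/\ forall a u v, L (a *: u + v) = a * L u + L v,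
      forall (c : R -> M) t v, {for t, continuous (c : R -> leaf_space Wcu)} ->
        c t = z -> mderiv A c t v -> sderiv (fun t => level q (c t)) t (L v) &
      exists2 v, tangent_space Wcu z v & L v != 0].
Proof.
move=> qz; have [qz1 tz Oz] := qz; have [oO _ _ [tC tD] _] := tau_spec q.
have [a1 t1] := fdom_cube qz1; set s0 := along Wcu q z in a1 Oz *.
set y0 := trans Wcu q z in t1 tz.
have Pz : plaque Wcu q s0 y0 = z := fchartK qz1.
have px : dom A z (plaque Wcu q s0 y0) by rewrite Pz; exact: dom_center.
have [J [Jl [C C0 JC] JK]] := plaque_left_inverse a1 t1 px.
have [[Ll _ _] _] := plaque_sdiff_family a1 t1 px.
have td : sdiff (tau q : _ -> R^o) s0 (fun w => 'D_w (tau q : _ -> R^o) s0).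
  apply: Ck_sdiff tC _; first exact: mean_value_R.
  exact: open_nbhs_nbhs.
have [tl _ _] := td.
exists (fun v => 'D_(J v) (tau q : _ -> R^o) s0); split.
- by move=> a u v; rewrite Jl tl.
- move=> c t v lc ct [_ cv].
  have qc : fdom Wcu q (c t) by rewrite ct.
  have [w sw E] := leaf_deriv lc qc (dom_center A (c t)) cv.
  have vw : v = plaque_deriv Wcu q z s0 y0 w by rewrite E ct.
  have -> : J v = w by rewrite vw JK.
  have := sderiv_comp sw (_ : sdiff (tau q : _ -> R^o) (along Wcu q (c t)) (fun w => 'D_w (tau q : _ -> R^o) s0)).
  by rewrite ct => /(_ td).
- have [w w0] := tD s0 Oz.
  exists (plaque_deriv Wcu q z s0 y0 w); last by rewrite JK.
  pose s t : 'rV[R]_k.+1 := s0 + t *: w.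
  have s00 : s 0 = s0 by rewrite /s scale0r addr0.
  have sw : sderiv s 0 w.
    by rewrite -[w]add0r; apply: sderivD; [exact: sderiv_cst|exact: sderiv_scalel].
  have lc : {for (0 : R), continuous ((fun t => plaque Wcu q (s t) y0) : R -> leaf_space Wcu)}.
    by apply: lcont_plaque; rewrite ?s00; [exact: a1|exact: t1|exact: sderiv_continuous sw].
  have D := @mderiv_plaque _ _ _ _ A _ _ _ Wcu s y0 0 q w.
  rewrite s00 in D; have {}D := D a1 t1 sw.
  by have := tangent_spaceP lc D; rewrite /= s00 Pz.
Qed.

(** A vector of [Eu] is the velocity of a curve in a leaf of [Wu], along which the level is
    constant. *)
Lemma level_deriv_Eu q z (L : 'rV[R]_n -> R) : level_dom q z ->
  (forall (c : R -> M) t v, {for t, continuous (c : R -> leaf_space Wcu)} ->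
        c t = z -> mderiv A c t v -> sderiv (fun t => level q (c t)) t (L v)) ->
  forall u, Eu z u -> L u = 0.
Proof.
move=> qz HL u; rewrite -uE => /tangent_space_curve[c [c0 lc cu]].
have lc' := lcont_sub lc.
have D := HL c 0 u lc' c0 cu.
apply: (sderiv_unique D).
apply: sderiv_near (sderiv_cst (level q z : R) 0) _.
have qc : fdom Wu q (c 0) by rewrite c0; exact: level_dom_fdom.
have H1 := lcont_trans qc lc.
have H2 : \forall t \near (0 : R), level_dom q (c t).
  by apply: lc'; rewrite c0; exact: level_dom_nbhs.
apply: filterS2 H1 H2 => t h1 h2.
by apply/(level_eq qz h2); rewrite h1 c0.
Qed.

Let FX := field_tangent.

(* Points of the same strong unstable plaque are joined by a segment of that
   plaque, whose image under the flow is again tangent to Eu. *)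
Lemma flow_level q : exists (d : R) (N : set (leaf_space Wcu)),
  [/\ 0 < d, nbhs (q : leaf_space Wcu) N &
    forall z z' (b : R), N z -> N z' -> level q z = level q z' -> `|b| < d ->
      [/\ level_dom q (f b z), level_dom q (f b z') &
          level q (f b z) = level q (f b z')]].
Proof.
have lfc := leaf_flow_continuous hf hM FX.
have [[B N1] [/= B0 N1q] BN] : nbhs ((0 : R), q : leaf_space Wcu)
    [set z : R * leaf_space Wcu | level_dom q (f z.1 z.2)].
  apply: (lfc (0, q)); rewrite /= (flow0 hf).
  exact/level_dom_nbhs/level_dom_center.
have [d d0 dB] := nbhs_exR B0.
have N1f z (b : R) : N1 z -> `|b| < d -> level_dom q (f b z).
  by move=> N1z bd; apply: (BN (b, z)); split=> //=; apply: dB; rewrite subr0.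
have qq := fdom_center Wcu q; have wq := fdom_center Wu q.
have [e1 y1] := fdom_cube wq.
have [e e0 eN] := leaf_nbhs_plaque qq N1q.
have [G Gq GP] := sub_trans q.
pose G' := G `&` [set z | fdom Wcu q z /\ `|along Wcu q z - along Wcu q q| < e].
have G'q : nbhs q G'.
  apply: filterI => //; apply: filterI; first exact: fdom_nbhs.
  have := @cont_near R _ _ (along Wcu q) q _ (along_continuous qq) (half_gt0 e0).
  by apply: filterS => z /le_lt_trans; apply; rewrite ltr_pdivrMr// ltr_pMr// ltr1n.
have [[C D] [/= Ce Dy] CD] : nbhs (along Wu q q, trans Wu q q)
    [set z : 'rV[R]_k * 'rV[R]_l.+1 | [/\ ball 0 1 z.1, ball 0 1 z.2 & G' (plaque Wu q z.1 z.2)]].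
  have H1 : nbhs (along Wu q q, trans Wu q q)
      [set z : 'rV[R]_k * 'rV[R]_l.+1 | G' (plaque Wu q z.1 z.2)].
    have := @plaque_continuous _ _ _ _ _ _ _ _ Wu q (along Wu q q, trans Wu q q) e1 y1.
    by apply; rewrite /= fchartK.
  have H2 : nbhs (along Wu q q, trans Wu q q)
      [set z : 'rV[R]_k * 'rV[R]_l.+1 | ball 0 1 z.1 /\ ball 0 1 z.2].
    exists (ball 0 1, ball 0 1) => //; split; apply: open_nbhs_nbhs; split => //; exact: ball_open.
  by apply: filterS2 H1 H2 => z h [].
have [rho rho0 rC] := nbhs_ex Ce.
pose N : set (leaf_space Wcu) := [set z | [/\ N1 z, level_dom q z, G' z,
  `|along Wu q z - along Wu q q| < rho & D (trans Wu q z)]].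
exists d, N; split=> //.
- have H1 := level_dom_nbhs (level_dom_center q).
  have H2 : nbhs (q : leaf_space Wcu) (G' : set (leaf_space Wcu)) by exact: leaf_nbhsW.
  have H3 : nbhs (q : leaf_space Wcu) [set z : leaf_space Wcu | `|along Wu q z - along Wu q q| < rho].
    apply: leaf_nbhsW; have := @cont_near R _ _ (along Wu q) q _ (along_continuous wq) (half_gt0 rho0).
    by apply: filterS => z /le_lt_trans; apply; rewrite ltr_pdivrMr// ltr_pMr// ltr1n.
  have H4 : nbhs (q : leaf_space Wcu) [set z : leaf_space Wcu | D (trans Wu q z)].
    by apply: (@leaf_nbhsW q [set z | D (trans Wu q z)]); exact: (cont_nbhs (trans_continuous wq)).
  have H12 := nbhsI N1q H1; have H34 := nbhsI H3 H4.
  have H := nbhsI (nbhsI H12 H2) H34.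
  by apply: filterS H => z [[[? ?] ?] [? ?]].
move=> z z' b [Nz qz Gz zr Dz] [Nz' qz' Gz' zr' Dz'] zz' bd.
have bz := N1f z b Nz bd; have bz' := N1f z' b Nz' bd.
split=> //.
have tt := (level_eq qz qz').1 zz'.
have wz := level_dom_fdom qz; have wz' := level_dom_fdom qz'.
set y' := trans Wu q z in Dz tt.
pose s (h : R) := along Wu q z + h *: (along Wu q z' - along Wu q z).
have sd h : sderiv s h (along Wu q z' - along Wu q z).
  by rewrite -[X in sderiv _ _ X]add0r; apply: sderivD; [exact: sderiv_cst|exact: sderiv_scalel].
pose c (h : R) := plaque Wu q (s h) y'.
have sr h : 0 <= h <= 1 -> [/\ ball 0 1 (s h), ball 0 1 y' & G' (c h)].
  move=> /andP[h0 h1]; apply: (CD (s h, y')); split=> //=; apply: rC.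
  have -> : s h - along Wu q q = (1 - h) *: (along Wu q z - along Wu q q) +
      h *: (along Wu q z' - along Wu q q) by rewrite /s; zmod.
  rewrite (le_lt_trans (ler_normD _ _))// !normrZ !ger0_norm ?subr_ge0//.
  have [->|hn] := eqVneq h 0; first by rewrite subr0 mul1r mul0r addr0.
  have hp : 0 < h by rewrite lt_neqAle eq_sym hn.
  have : h * `|along Wu q z' - along Wu q q| < h * rho by rewrite ltr_pM2l.
  have : (1 - h) * `|along Wu q z - along Wu q q| <= (1 - h) * rho.
    by rewrite ler_wpM2l ?subr_ge0// ltW.
  by lra.
have c0 : c 0 = z by rewrite /c /s scale0r addr0 fchartK.
have c1 : c 1 = z' by rewrite /c /s scale1r addrC subrK tt fchartK.
have lc h : 0 <= h <= 1 -> {for h, continuous (c : R -> leaf_space Wu)}.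
  by move=> /sr[s1 yy1 _]; apply: lcont_plaque; [exact: s1|exact: yy1|exact: sderiv_continuous (sd h)].
have N1c h : 0 <= h <= 1 -> N1 (c h).
  move=> h01; have [s1 yy1 [Gc [qc cr]]] := sr h h01.
  have tc : trans Wcu q (c h) = trans Wcu q q.
    have [_ <- _] := qz; apply: GP => //; first by case: Gz.
    by rewrite (plaqueK Wu q s1 yy1).2.
  by rewrite -(fchartK qc) tc; exact: (eN _ cr).2.
have Dc h : 0 <= h <= 1 -> sderiv (fun h => level q (f b (c h))) h 0.
  move=> h01; have [s1 yy1 _] := sr h h01.
  have qc := N1f (c h) b (N1c h h01) bd.
  have [L [_ HL _]] := level_deriv qc.
  have cv := @mderiv_plaque _ _ _ _ A _ _ _ Wu s y' h q _ s1 yy1 (sd h).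
  set v := plaque_deriv _ _ _ _ _ _ in cv.
  have Ev : Eu (c h) v by rewrite -uE; exact: tangent_spaceP (lc h h01) cv.
  have Efv : Eu (f b (c h)) (tangent_map A (f b) (c h) v) by rewrite -Eu_inv; exists v.
  rewrite -(level_deriv_Eu qc HL Efv).
  have mc := mderiv_map (flow_Ck hf b) cv.
  suff l1 : {for h, continuous ((fun h => f b (c h)) : R -> leaf_space Wcu)} by exact: (HL _ _ _ l1 erefl mc).
  have cp : {for h, continuous (fun h => (b, c h : leaf_space Wcu))}.
    by apply: continuous_pair; [exact: cvg_cst|exact: lcont_sub (lc h h01)].
  have fc : {for (b, c h : leaf_space Wcu), continuous ((fun z : R * leaf_space Wcu => f z.1 z.2) : _ -> leaf_space Wcu)} := lfc _.
  exact: (@continuous_comp R (R * leaf_space Wcu)%type (leaf_space Wcu) _ _ h cp fc).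
have := @mean_value_R R (fun h => level q (f b (c h))) (fun=> 0) 0 1 0 ler01.
rewrite mul0r c0 c1 => H; apply/eqP; rewrite eq_sym -subr_eq0 -normr_le0; apply: H.
  by move=> h /Dc/sderiv_is_derive.
by move=> *; rewrite normr0.
Qed.

Lemma level_field q : exists2 a : R, a != 0 & sderiv (fun t => level q (f t q)) 0 a /\
  forall (c : R -> M) t u b, {for t, continuous (c : R -> leaf_space Wcu)} ->
    c t = q -> Eu q u -> mderiv A c t (u + b *: X q) ->
    sderiv (fun t => level q (c t)) t (b * a).
Proof.
have [L [Ll HL [v Tv Lv]]] := level_deriv (level_dom_center q).
have Lu := level_deriv_Eu (level_dom_center q) HL.
exists (L (X q)).
  move: Tv; rewrite cuE => -[u Eq [_ [b _ <-]]] vE.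
  apply: contraNneq Lv => LX.
  by rewrite -vE addrC Ll LX mulr0 add0r Lu.
split.
  apply: HL; [exact: (orbit_lcont hf hM FX)|exact: (flow0 hf)|].
  have := mderiv_orbit hf hM 0 q; by rewrite (flow0 hf).
move=> c t u b lc ct Eq cv.
have := HL c t _ lc ct cv.
by have -> : L (u + b *: X q) = b * L (X q) by rewrite addrC Ll (Lu u Eq) addr0.
Qed.

(** Together with the next lemma it stands in for the inverse function theorem, applied to the level
    along an orbit to find the unique time at which a given level is reached. *)
Lemma half_inj (w : R -> R) (d : R) :
  (forall t t', `|t| < d -> `|t'| < d -> `|w t - w t' - (t - t')| <= `|t - t'| / 2) ->
  forall t t', `|t| < d -> `|t'| < d -> `|t - t'| <= 2 * `|w t - w t'|.
Proof.
move=> H t t' td t'd; have := H t t' td t'd.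
have := ler_distD (w t - w t') (t - t') 0; rewrite !subr0 (distrC (t - t')); lra.
Qed.

Lemma half_ivt (w : R -> R) (d : R) : 0 < d ->
  (forall t t', `|t| < d -> `|t'| < d -> `|w t - w t' - (t - t')| <= `|t - t'| / 2) ->
  forall y, `|y - w 0| <= d / 4 -> exists2 t, `|t| <= d / 2 & w t = y.
Proof.
move=> d0 H y yw.
have d2 : 0 <= d / 2 by rewrite divr_ge0// ltW.
have in2 t : t \in `[- (d / 2), d / 2] -> `|t| < d.
  by rewrite in_itv/= -ler_norml => /le_lt_trans; apply; rewrite ltr_pdivrMr// ltr_pMr// ltr1n.
have [t tI tE] : exists2 c, c \in `[- (d / 2), d / 2] & w c = y.
  have i1 : - (d / 2) \in `[- (d / 2), d / 2] by rewrite in_itv/=; lra.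
  have i2 : d / 2 \in `[- (d / 2), d / 2] by rewrite in_itv/=; lra.
  have i0 : (0 : R) \in `[- (d / 2), d / 2] by rewrite in_itv/=; lra.
  apply: IVT; first by lra.
    apply: continuous_in_subspaceT => t; rewrite inE => /in2 td; apply/contP => e e0.
    exists (Num.min (e / 2) (d - `|t|)); first by rewrite lt_min half_gt0// subr_gt0.
    move=> t'; rewrite lt_min => /andP[h1 h2].
    have t'd : `|t'| < d by have := ler_normD (t' - t) t; rewrite subrK; lra.
    have := H t' t t'd td; have := ler_normD (w t' - w t - (t' - t)) (t' - t).
    by rewrite subrK; lra.
  have w1 : w (- (d / 2)) <= y.
    have := H 0 (- (d / 2)) (in2 _ i0) (in2 _ i1).
    rewrite opprK add0r (ger0_norm d2) !ler_norml => /andP[h _].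
    by move: yw; rewrite ler_norml => /andP[h' _]; lra.
  have w2 : y <= w (d / 2).
    have := H (d / 2) 0 (in2 _ i2) (in2 _ i0).
    rewrite subr0 (ger0_norm d2) !ler_norml => /andP[h _].
    by move: yw; rewrite ler_norml => /andP[_ h']; lra.
  by rewrite ge_min w1 le_max w2 orbT.
by exists t => //; move: tI; rewrite in_itv/= -ler_norml.
Qed.

Lemma level_continuous q : {for (q : leaf_space Wcu), continuous (level q : leaf_space Wcu -> R)}.
Proof.
have [oO Oq _ [tC _] _] := tau_spec q.
have tc : {for along Wcu q q, continuous (tau q : 'rV[R]_k.+1 -> R)} by case: tC => + _; exact.
apply: (@continuous_comp (leaf_space Wcu) _ R (along Wcu q) (tau q)) => //.
apply: (@continuous_comp (leaf_space Wcu) M _ (fun x => x) (along Wcu q)); first exact: leaf_id_continuous.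
exact: (along_continuous (fdom_center Wcu q)).
Qed.

(* [H q z] is the time h such that z and the point f^h q of the orbit of q
   lie on the same local leaf of Wu. *)
Lemma height_exists : exists H : M -> M -> R, forall q,
  [/\ H q q = 0,
      nbhs (q : leaf_space Wcu) [set z : leaf_space Wcu |
        nbhs (z : leaf_space Wcu) [set z' : leaf_space Wcu | H q z' - H q z = H z z']],
      forall (c : R -> M) t u b, {for t, continuous (c : R -> leaf_space Wcu)} ->
        c t = q -> Eu q u -> mderiv A c t (u + b *: X q) ->
        sderiv (fun t => H q (c t)) t b &
      nbhs (q : leaf_space Wcu) [set z : leaf_space Wcu |
        (H q z = 0 <-> trans Wu q z = trans Wu q q)]].
Proof.
(* [V] is the level rescaled to have derivative 1 along the flow at [q], as [half_inj] and
   [half_ivt] require. *)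
have H1 q : exists z : R * (M -> R), let d := z.1 in let V := z.2 in [/\ 0 < d,
    forall t t', `|t| < d -> `|t'| < d ->
      `|V (f t q) - V (f t' q) - (t - t')| <= `|t - t'| / 2,
    forall (c : R -> M) t u b, {for t, continuous (c : R -> leaf_space Wcu)} ->
      c t = q -> Eu q u -> mderiv A c t (u + b *: X q) ->
      sderiv (fun t => V (c t)) t b,
    {for (q : leaf_space Wcu), continuous (V : leaf_space Wcu -> R)} &
    forall z z', V z = V z' <-> level q z = level q z'].
  have [a a0 [va ca]] := level_field q.
  have a20 : 0 < `|a| / 2 by rewrite half_gt0// normr_gt0.
  have [d d0 dP] := va _ a20.
  exists (d, fun z => level q z / a); split => //=.
  - move=> t t' td t'd; have := dP t t'; rewrite !subr0 => /(_ td t'd) E.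
    have -> : level q (f t q) / a - level q (f t' q) / a - (t - t') =
      (level q (f t q) - level q (f t' q) - (t - t') *: a) / a.
      by rewrite [_ *: _]mulrC -mulrBl [RHS]mulrBl [a * _]mulrC mulfK.
    rewrite normrM normfV ler_pdivrMr ?normr_gt0//.
    by rewrite (le_trans E)// mulrC mulrA mulrAC.
  - move=> c t u b lc ct Eq cv.
    have D := sderiv_scale (a^-1 : R^o) (ca c t u b lc ct Eq cv).
    have -> : b = (b * a) *: (a^-1 : R^o) by rewrite [_ *: _]mulfK.
    exact: D.
  - have := @continuous_comp (leaf_space Wcu) R R (level q) (fun x : R => x / a) q.
    by apply; [exact: level_continuous|exact: mulrr_continuous].
  - move=> z z'; split=> [|->//]; apply: mulIf; exact: invr_neq0.
have [dV H2] := choice H1; pose d q := (dV q).1; pose V q := (dV q).2.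
have d0 q : 0 < d q by case: (H2 q).
have Vf q t t' : `|t| < d q -> `|t'| < d q ->
  `|V q (f t q) - V q (f t' q) - (t - t')| <= `|t - t'| / 2 by case: (H2 q) => _ + _ _ _; exact.
have Vc q : {for (q : leaf_space Wcu), continuous (V q : leaf_space Wcu -> R)} by case: (H2 q).
have Vl q z z' : V q z = V q z' <-> level q z = level q z' by have [_ _ _ _] := H2 q; apply.
have inj q := half_inj (Vf q).
have H3 (w : M * M) : exists t, `|V w.1 w.2 - V w.1 w.1| <= d w.1 / 4 ->
    `|t| <= d w.1 / 2 /\ V w.1 (f t w.1) = V w.1 w.2.
  have [h|h] := leP `|V w.1 w.2 - V w.1 w.1| (d w.1 / 4); last by exists 0.
  have := half_ivt (d0 w.1) (@Vf w.1) (y := V w.1 w.2).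
  by rewrite (flow0 hf) => /(_ h)[t td tE]; exists t.
have [HH H4] := choice H3; pose H q z := HH (q, z).
pose N0 q : set (leaf_space Wcu) := [set z | level_dom q z /\ `|V q z - V q q| <= d q / 4].
have d40 q : 0 < d q / 4 by rewrite divr_gt0.
have N0n q : nbhs (q : leaf_space Wcu) (N0 q).
  by apply: nbhsI; [exact/level_dom_nbhs/level_dom_center|exact: cont_near (Vc q) (d40 q)].
have Hd q z : N0 q z -> `|H q z| < d q.
  move=> [_ qz]; have [h _] := H4 (q, z) qz.
  by apply: le_lt_trans h _; rewrite ltr_pdivrMr// ltr_pMr// ltr1n.
have HV q z : N0 q z -> V q (f (H q z) q) = V q z by move=> [_ qz]; have [] := H4 (q, z) qz.
have Hu q z t : N0 q z -> `|t| < d q -> V q (f t q) = V q z -> H q z = t.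
  move=> qz td E; have := inj q _ _ (Hd q z qz) td; rewrite HV// E subrr normr0 mulr0 normr_le0.
  by move/eqP/subr0_eq.
have Vq q : V q (f 0 q) = V q q by rewrite (flow0 hf).
have dn q : `|0 : R| < d q by rewrite normr0.
have N0q q : N0 q q.
  by split; [exact: level_dom_center|rewrite subrr normr0 (ltW (d40 q))].
have Hqq q : H q q = 0 by apply: Hu.
have Hc q : {for (q : leaf_space Wcu), continuous (H q : leaf_space Wcu -> R)}.
  apply: contN => e e0; rewrite Hqq.
  have := nbhsI (N0n q) (cont_near (Vc q) (half_gt0 e0)).
  apply: (@filterS _ _ (nbhs_filter (q : leaf_space Wcu))) => z [Nz Vz].
  rewrite /=; apply: le_trans (inj q _ _ (Hd q z Nz) (dn q)) _.
  by rewrite Vq HV//; lra.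
exists H => q; split=> //.
(* The cocycle identity: [z] and [f (H q z) q] have the same level, and by [flow_level] they still
   do after flowing for the time [H z z'], when the first has the level of [z']. Hence
   [H q z' = H z z' + H q z] by uniqueness of the time. *)
- have [e [N [e0 Nq NP]]] := flow_level q.
  have F1 : nbhs (q : leaf_space Wcu) [set z : leaf_space Wcu | `|H q z| < d q / 2].
    have : nbhs (q : leaf_space Wcu) [set z : leaf_space Wcu | `|H q z - H q q| <= d q / 4].
      exact: cont_near (Hc q) (d40 q).
    apply: (@filterS _ _ (nbhs_filter (q : leaf_space Wcu))) => z /=.
    by rewrite Hqq subr0 => h; have := d0 q; lra.
  have F2 : nbhs (q : leaf_space Wcu) [set z : leaf_space Wcu | N (f (H q z) q)].
    have : {for (q : leaf_space Wcu), continuous (fun z : leaf_space Wcu => f (H q z) q : leaf_space Wcu)}.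
      apply: (@continuous_comp (leaf_space Wcu) R (leaf_space Wcu) (H q) (fun t => f t q)) => //.
      exact: (orbit_lcont hf hM FX).
    by move/cont_nbhs; apply; rewrite Hqq (flow0 hf).
  have F3 := nbhsI (nbhsI (N0n q) Nq) (nbhsI F1 F2).
  have F4 := nbhs_interior F3.
  apply: (@filterS _ _ (nbhs_filter (q : leaf_space Wcu)) _ _ _ F4) => z Fz.
  have [[Nz0 Nz] [Hz Nfz]] := nbhs_singleton Fz.
  have wz := level_dom_fdom Nz0.1.
  have [G Gz GP] := fol_coherent (fdom_center Wu z) wz.
  have Gz' : nbhs (z : leaf_space Wcu) (G : set (leaf_space Wcu)).
    exact: leaf_nbhsW.
  have G1 : nbhs (z : leaf_space Wcu) [set z' : leaf_space Wcu | `|H z z'| < Num.min (d q / 2) e].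
    have e'0 : 0 < Num.min (d q / 2) e / 2 by rewrite half_gt0// lt_min e0 half_gt0.
    have : nbhs (z : leaf_space Wcu) [set z' : leaf_space Wcu | `|H z z' - H z z| <= Num.min (d q / 2) e / 2].
      exact: cont_near (Hc z) e'0.
    apply: (@filterS _ _ (nbhs_filter (z : leaf_space Wcu))) => z' /=.
    by rewrite Hqq subr0; set m := Num.min _ _ in e'0 *; lra.
  have G2 : nbhs (z : leaf_space Wcu) [set z' : leaf_space Wcu |
     [/\ level_dom q (f (H z z') z), level_dom z (f (H z z') z) & G (f (H z z') z)]].
    have : {for (z : leaf_space Wcu), continuous (fun z' : leaf_space Wcu => f (H z z') z : leaf_space Wcu)}.
      apply: (@continuous_comp (leaf_space Wcu) R (leaf_space Wcu) (H z) (fun t => f t z)) => //.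
      exact: (orbit_lcont hf hM FX).
    move/cont_nbhs => /(_ (level_dom q `&` (level_dom z `&` (G : set (leaf_space Wcu))))).
    rewrite Hqq (flow0 hf) => HG.
    have {}HG := HG (nbhsI (level_dom_nbhs Nz0.1) (nbhsI (level_dom_nbhs (level_dom_center z)) Gz')).
    by apply: (@filterS _ _ (nbhs_filter (z : leaf_space Wcu)) _ _ _ HG) => z' [? [? ?]]; split.
  have G3 := nbhsI (nbhsI Fz (nbhsI (N0n z) Gz')) (nbhsI G1 G2).
  apply: (@filterS _ _ (nbhs_filter (z : leaf_space Wcu)) _ _ _ G3) => z'.
  move=> [[[[Nz'0 Nz'] _] [Nzz' Gz'']] [Hzz' [qf zf Gf]]].
  have /andP[h1 h2] : (`|H z z'| < d q / 2) && (`|H z z'| < e) by rewrite -lt_min.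
  rewrite /= in Hz *.
  have E1 : trans Wu z (f (H z z') z) = trans Wu z z'.
    by apply/(level_eq zf Nzz'.1)/Vl/HV.
  have E2 : trans Wu q (f (H z z') z) = trans Wu q z' by apply: GP.
  have E3 : level q (f (H z z') z) = level q z' by apply/(level_eq qf Nz'0.1).
  have E4 : level q z = level q (f (H q z) q) by apply/esym/Vl/HV.
  have [_ _ E5] := NP z _ _ Nz Nfz E4 h2.
  have E6 : V q (f (H z z' + H q z) q) = V q z'.
    by apply/Vl; rewrite (flowD hf) -E5.
  rewrite (Hu q z' (H z z' + H q z)) ?addrK//.
  by rewrite (le_lt_trans (ler_normD _ _))//; lra.
(* [V] along the orbit of [q], with derivative 1, composed with the height gives [V] along [c];
   [sderiv_inverse] recovers the derivative of the height. *)
- move=> c t u b lc ct Eq cv.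
  have [_ _ Vd _ _] := H2 q.
  have D0 : sderiv (fun t => V q (f t q)) 0 1.
    apply: (Vd _ _ 0 1) => //; [exact: (orbit_lcont hf hM FX)|exact: (flow0 hf)|].
    by rewrite add0r scale1r; have := mderiv_orbit hf hM 0 q; rewrite (flow0 hf).
  have D1 := Vd c t u b lc ct Eq cv.
  have := @sderiv_inverse R R^o R^o (fun t => V q (f t q)) (fun t => H q (c t)) t b (fun h => h *: (1 : R^o)) id.
  apply=> //.
  + by rewrite ct Hqq; exact/sderiv_sdiff.
  + by exists 1 => // w; rewrite mul1r.
  + by move=> w; rewrite [_ *: _]mulr1.
  + apply: (@continuous_comp R (leaf_space Wcu) R c (H q)) => //; rewrite ct; exact: Hc.
  + apply: sderiv_near D1 _; have := cont_nbhs lc; rewrite ct => /(_ _ (N0n q)).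
    by apply: filterS => t' /HV.
- apply: (@filterS _ _ (nbhs_filter (q : leaf_space Wcu)) _ _ _ (N0n q)) => z Nz.
  have HE : H q z = 0 <-> V q z = V q q.
    split=> [E|E]; first by rewrite -(HV q z Nz) E Vq.
    by apply: Hu; rewrite // Vq.
  have LE := level_eq Nz.1 (level_dom_center q).
  by split=> [/HE/Vl/LE|/LE/Vl/HE].
Qed.

End heights.

(** * Universal covers *)

Section clamp.
Context {R : realType}.
Implicit Types (a b s t : R).

Lemma glue_continuous (T : topologicalType) (c c' : R -> T) (s : R) :
  continuous c -> continuous c' -> c s = c' s ->
  continuous (fun t => if t <= s then c t else c' t).
Proof.
move=> cc cc' E t N; rewrite /= => Nt.
have : (t <= s -> nbhs t [set u | N (c u)]) /\ (s <= t -> nbhs t [set u | N (c' u)]).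
  split=> h.
    by apply: cont_nbhs (cc t) _; move: Nt; rewrite h.
  apply: cont_nbhs (cc' t) _; move: Nt; case: leP => // h'.
  by have -> : t = s; [apply/eqP; rewrite eq_le h h'|rewrite E].
move=> [n1 n2]; change (nbhs t [set u | N (if u <= s then c u else c' u)]).
have [ts|st|ts] := ltgtP t s.
- have n3 : \forall u \near t, u < s by exact: lt_nbhsl.
  by apply: filterS2 (n1 (ltW ts)) n3 => u Nu /ltW us; rewrite /= us.
- have n3 : \forall u \near t, s < u by exact: lt_nbhsr.
  by apply: filterS2 (n2 (ltW st)) n3 => u Nu us; rewrite /= leNgt us.
- have h1 : t <= s by rewrite ts. have h2 : s <= t by rewrite ts.
  by apply: filterS2 (n1 h1) (n2 h2) => u ? ? /=; case: ifP.
Qed.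

(** The retraction of the line onto a segment, used to extend paths to all times. *)
Definition clamp (a b t : R) := Num.max a (Num.min t b).

Lemma clamp_itv a b t : a <= b -> a <= clamp a b t <= b.
Proof. by move=> ab; rewrite /clamp le_max lexx/= ge_max ab ge_min lexx orbT. Qed.

Lemma clamp_id a b t : a <= t <= b -> clamp a b t = t.
Proof. by move=> /andP[h1 h2]; rewrite /clamp (min_idPl h2) (max_idPr h1). Qed.

Lemma clamp_lip a b s t : `|clamp a b s - clamp a b t| <= `|s - t|.
Proof.
rewrite /clamp; have [h1|h1] := leP s b; have [h2|h2] := leP t b;
 [have [h3|h3] := leP a s; have [h4|h4] := leP a t
 |have [h3|h3] := leP a s; have [h4|h4] := leP a b
 |have [h3|h3] := leP a b; have [h4|h4] := leP a t
 |have [h3|h3] := leP a b; have [h4|h4] := leP a b];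
 rewrite ler_norml; have := ler_norm (s - t); have := ler_norm (t - s); rewrite (distrC t); lra.
Qed.

Lemma clamp_continuous a b : continuous (clamp a b).
Proof.
move=> t; apply/contP => e e0; exists e => // s; exact: le_lt_trans (clamp_lip _ _ _ _).
Qed.

End clamp.

Lemma within_retract (T V : topologicalType) (A : set T) (r : T -> T) (c : T -> V) :
  {within A, continuous c} -> continuous r -> (forall t, A (r t)) -> continuous (c \o r).
Proof.
move=> cc rc rA t N Nt.
have H : nbhs (r t) [set s | A s -> N (c s)].
  have := cc (r t) N Nt.
  by rewrite /nbhs/= -nbhs_subspace_in.
by apply: filterS (cont_nbhs (@rc t) H) => s; apply.
Qed.

(** * Lifting paths and flows to the cover *)

Section covering.
Context {R : realType} {U Y : topologicalType} (p : U -> Y) (L : set Y).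
Hypothesis pU : universal_cover R p L.
Implicit Types (w z : U) (c : R -> U).

Let pL w : L (p w).
Proof. by have [_ _ <- _] := pU; exists w. Qed.

Let pc : continuous p. Proof. by case: pU. Qed.

Lemma cover_sheets y : L y -> exists V, [/\ open V, V y &
  forall w, V (p w) -> exists S (h : Y -> U),
    [/\ open S, S w, forall y, V y -> [/\ {for y, continuous h}, S (h y) & p (h y) = y],
        forall z, S z -> h (p z) = z &
        forall w', p w' = p w -> w' <> w -> exists2 S', nbhs w' S' & forall z, S z -> ~ S' z]].
Proof.
move=> Ly; have [_ _ _ /(_ y Ly)[V [oV Vy [I [S [SV Sd oS hS]]]]]] := pU.
exists V; split=> // w Vw.
have Sw w' : V (p w') -> exists i, S i w'.
  move=> Vw'; have : (p @^-1` V) w' by [].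
  by rewrite SV => -[i _ Siw]; exists i.
have [i Siw] := Sw w Vw.
have [h [hc hV hK]] := hS i.
exists (S i), h; split=> // [y' Vy'|w' pw' ww'].
  by have [? ?] := hV y' Vy'; split=> //; exact: hc.
have [j Sjw'] : exists j, S j w' by apply: Sw; rewrite pw'.
exists (S j); first by apply: open_nbhs_nbhs.
move=> z Siz Sjz; apply: ww'.
have ij := Sd _ _ _ Siz Sjz; rewrite -ij in Sjw'.
by rewrite -(hK w' Sjw') pw' hK.
Qed.

Lemma cover_section w : exists V S (h : Y -> U),
  [/\ nbhs (p w) V, nbhs w S, forall y, V y -> {for y, continuous h} /\ p (h y) = y,
      forall z, S z -> V (p z) /\ h (p z) = z & S w].
Proof.
have [V [oV Vw H]] := cover_sheets (pL w); have [S [h [oS Sw hV hS _]]] := H w Vw.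
have nV : nbhs (p w) V by exact: open_nbhs_nbhs.
exists V, (S `&` (p @^-1` V)), h; split=> //.
- by apply: nbhsI; [exact: open_nbhs_nbhs|exact: pc].
- by move=> y /hV[].
- by move=> z [/hS].
Qed.

(** Agreement of the two lifts is open because nearby points lie in a common sheet, and closed by
    the separation of sheets; both say that the proposition [c t = c' t] is locally constant. *)
Lemma lift_unique c c' (a b t0 : R) :
  (forall t, a <= t <= b -> {for t, continuous c}) ->
  (forall t, a <= t <= b -> {for t, continuous c'}) ->
  (forall t, a <= t <= b -> p (c t) = p (c' t)) ->
  a <= t0 <= b -> c t0 = c' t0 -> forall t, a <= t <= b -> c t = c' t.
Proof.
move=> cc cc' E t0ab E0.
have main : forall t, a <= t <= b -> (c t = c' t) = (c a = c' a).
  apply: (@loc_const R Prop (fun t => c t = c' t)) => t tab.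
  have [V [oV Vt H]] := cover_sheets (pL (c t)).
  have [S [h [oS Sw hV hS hd]]] := H (c t) Vt.
  have S1 : nbhs (c t) S by exact: open_nbhs_nbhs.
  have n1 := cont_nbhs (cc t tab) S1.
  have [e|ne] := pselect (c t = c' t).
    have n2 : \forall s \near t, S (c' s) by apply: cont_nbhs (cc' t tab) _; rewrite -e.
    have [d d0 dP] := nbhs_exR (nbhsI n1 n2).
    exists d => // s sab sd; have [s1 s2] := dP s sd.
    by rewrite propeqE; split=> // _; rewrite -(hS _ s1) -(hS _ s2) E.
  have [S' S'n S'd] := hd (c' t) (esym (E t tab)) (fun e => ne (esym e)).
  have [d d0 dP] := nbhs_exR (nbhsI n1 (cont_nbhs (cc' t tab) S'n)).
  exists d => // s sab sd; have [s1 s2] := dP s sd.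
  by rewrite propeqE; split=> // e; exfalso; apply: (S'd _ s1); rewrite e.
by move=> t tab; rewrite main// -(main t0 t0ab).
Qed.

(** The starting point is part of the property propagated by [cousin], so that a short lift can be
    appended at the end of the previous one. *)
Lemma path_lift (g : R -> Y) (a b : R) w : continuous g -> (forall t, L (g t)) ->
  a <= b -> p w = g a -> exists c, [/\ continuous c, c a = w &
    forall t, a <= t <= b -> p (c t) = g t].
Proof.
move=> gc gL ab; move: w.
apply: (@cousin R (fun x y => forall w, p w = g x -> exists c, [/\ continuous c, c x = w &
    forall t, x <= t <= y -> p (c t) = g t]) a b) => //.
- move=> x y z ax xy yz zb Hxy Hyz w pw.
  have [c [cc cx cE]] := Hxy w pw.
  have [|c' [cc' cy cE']] := Hyz (c y); first by apply: cE; rewrite xy lexx.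
  exists (fun t => if t <= y then c t else c' t); split.
  + exact: glue_continuous.
  + by rewrite xy.
  + move=> t /andP[xt tz]; case: leP => h; first by apply: cE; rewrite xt.
    by apply: cE'; rewrite tz ltW.
- move=> t _; have [V [oV Vt H]] := cover_sheets (gL t).
  have [d d0 dP] := nbhs_exR (cont_nbhs (gc t) (open_nbhs_nbhs (conj oV Vt))).
  exists d => // x y _ xy _ xd yd w pw.
  have inV s : x <= s <= y -> V (g s).
    by move=> /andP[h1 h2]; apply: dP; move: xd yd; rewrite !ltr_norml; lra.
  have [|S [h [oS Sw hV hS _]]] := H w; first by rewrite pw; apply: inV; rewrite lexx.
  exists (fun s => h (g (clamp x y s))); split.
  + move=> s; have /inV/hV[hc _ _] := clamp_itv s xy.
    apply: (@continuous_comp R R U (clamp x y) (fun s => h (g s))); first exact: clamp_continuous.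
    by apply: (@continuous_comp R Y U g h); [exact: gc|exact: hc].
  + by rewrite clamp_id ?lexx// -pw hS.
  + move=> s sxy; rewrite clamp_id//; by have [] := hV _ (inV s sxy).
Qed.

Section flow.
Variable F : R -> Y -> Y.
Hypotheses (F0 : forall y, F 0 y = y) (FD : forall s t y, F (s + t) y = F s (F t y))
  (Fc : continuous (fun z : R * Y => F z.1 z.2)) (FL : forall t y, L y -> L (F t y)).

Let Ft y : continuous (fun t => F t y).
Proof.
move=> t; have Fc' : {for (t, y), continuous (fun z : R * Y => F z.1 z.2)} := @Fc (t, y).
have cp : {for t, continuous (fun t => (t, y))} by apply: continuous_pair; [exact: cvg_id|exact: cvg_cst].
exact: (@continuous_comp R (R * Y)%type Y _ _ t cp Fc').
Qed.

(** Orbits are lifted over each segment from [- T] to [T], forwards and backwards separately, and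
    lifts over different segments agree by uniqueness. Time [t] is read on the lift of radius
    [|t| + 1], leaving room on both sides for continuity. *)
Lemma flow_lift_exists : exists phi, flow_lift p F phi.
Proof.
have H (z : U * R) : exists c : R -> U, 0 <= z.2 -> [/\ continuous c, c 0 = z.1 &
    forall t, - z.2 <= t <= z.2 -> p (c t) = F t (p z.1)].
  case: z => w T /=; have [T0|T0] := leP 0 T; last by exists (fun=> w) => T1; exfalso; move: T1.
  have [||c1 [c1c c10 c1E]] := @path_lift (fun t => F t (p w)) 0 T w (@Ft (p w)) _ T0 _.
    by move=> t; exact: FL.
    by rewrite F0.
  have Fo : continuous (fun t => F (- t) (p w)).
    move=> t; apply: (@continuous_comp R R Y (fun t => - t) (fun t => F t (p w))); last exact: Ft.
    exact: opp_continuous.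
  have [||c2 [c2c c20 c2E]] := @path_lift (fun t => F (- t) (p w)) 0 T w Fo _ T0 _.
    by move=> t; exact: FL.
    by rewrite oppr0 F0.
  exists (fun t => if t <= 0 then c2 (- t) else c1 t) => _; split.
  - apply: glue_continuous => //; last by rewrite oppr0 c10.
    move=> t; apply: (@continuous_comp R R U (fun t => - t) c2); last exact: c2c.
    exact: opp_continuous.
  - by rewrite lexx oppr0.
  - move=> t /andP[t1 t2]; case: leP => h.
      by rewrite c2E ?opprK// oppr_ge0 h lerNl.
    by rewrite c1E// t2 ltW.
have [C HC] := choice H.
have CE w (T t T' : R) : 0 <= T' -> - T <= t <= T -> T <= T' -> C (w, T') t = C (w, T) t.
  move=> T'0 /andP[tT1 tT2] TT'; have T0 : 0 <= T by lra.
  have [c1 c10 c1E] := HC (w, T) T0; have [c2 c20 c2E] := HC (w, T') T'0.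
  rewrite /= in c10 c1E c20 c2E.
  apply: (@lift_unique (C (w, T')) (C (w, T)) (- T) T 0); rewrite ?tT1 ?tT2//.
  - by move=> s _; exact: c2.
  - by move=> s _; exact: c1.
  - by move=> s /andP[s1 s2]; rewrite c2E ?c1E ?s1 ?s2//; lra.
  - by rewrite oppr_le0 T0.
  - by rewrite c10 c20.
exists (fun t w => C (w, `|t| + 1) t).
have in1 (t : R) : - (`|t| + 1) <= t <= `|t| + 1.
  by rewrite -ler_norml; lra.
have n0 (t : R) : 0 <= `|t| + 1 by rewrite addr_ge0.
split.
- move=> w t; have T0 : 0 <= `|t| + 2 by rewrite addr_ge0.
  have [cc _ _] := HC (w, `|t| + 2) T0.
  have E : \forall s \near t, C (w, `|t| + 2) s = C (w, `|s| + 1) s.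
    have := near_dist (t : R^o) (ltr01 : 0 < (1 : R)); apply: filterS => s /= st.
    apply: CE => //; have := ler_normD (s - t) t; rewrite subrK; lra.
  have := cc t; rewrite /continuous_at (nbhs_singleton E) => H' N Nt.
  have {}Nt : \forall s \near t, N (C (w, `|t| + 2) s) := H' N Nt.
  by apply: filterS2 Nt E => s Ns /= <-.
- by move=> w; have [_ -> _] := HC (w, `|0| + 1) (n0 0).
- by move=> t w; have [_ _ E] := HC (w, `|t| + 1) (n0 t); exact: E (in1 t).
Qed.

Lemma flow_lift_curve phi (c : R -> U) w : flow_lift p F phi -> continuous c -> c 0 = w ->
  (forall t, p (c t) = F t (p w)) -> forall t, phi t w = c t.
Proof.
move=> [phic phi0 phiE] cc c0 cE t.
have n0 : 0 <= `|t| by [].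
apply: (@lift_unique (fun t => phi t w) c (- `|t|) `|t| 0) => //.
- by move=> s _; exact: phic.
- by move=> s _; exact: cc.
- by move=> s _; rewrite cE; exact: phiE.
- by rewrite oppr_le0 n0.
- by rewrite phi0.
- by rewrite -ler_norml.
Qed.

Section phi.
Variables (phi : R -> U -> U) (Fphi : flow_lift p F phi).

Lemma flow_liftD s t w : phi (s + t) w = phi s (phi t w).
Proof.
have [phic phi0 phiE] := Fphi.
apply/esym/(flow_lift_curve (c := fun s => phi (s + t) w) Fphi).
- move=> u; apply: (@continuous_comp R R U (fun s => s + t) (fun s => phi s w)); last exact: phic.
  by apply: cvgD; [exact: cvg_id|exact: cvg_cst].
- by rewrite add0r.
- by move=> u; rewrite !phiE FD.
Qed.

(** For small times the lift is a local section of the covering applied to the flow below, by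
    uniqueness of lifts. *)
Lemma flow_lift_continuous : continuous (fun z : R * U => phi z.1 z.2).
Proof.
have [phic phi0 phiE] := Fphi.
apply: local_flow_continuous => //; first exact: flow_liftD.
move=> w; have [V [S [h [nV nS hV hS Sw]]]] := cover_section w.
have [[B N] [/= B0 Nw] BN] : nbhs ((0 : R), p w) [set z : R * Y | V (F z.1 z.2)].
  have Fc' : {for ((0 : R), p w), continuous (fun z : R * Y => F z.1 z.2)} := @Fc (0, p w).
  by apply: (cont_nbhs Fc'); rewrite /= F0.
have [d d0 dB] := nbhs_exR B0.
have VF t z : `|t| < d -> N (p z) -> V (F t (p z)).
  by move=> td Nz; apply: (BN (t, p z)); split=> //=; apply: dB; rewrite subr0.
pose G := S `&` (p @^-1` N).
have nG : nbhs w G by apply: nbhsI => //; exact: (pc Nw).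
have E t z : `|t| < d -> G z -> phi t z = h (F t (p z)).
  move=> td [Sz Nz].
  have sd s : - `|t| <= s <= `|t| -> `|s| < d by rewrite -ler_norml => /le_lt_trans; apply.
  apply: (@lift_unique (fun t => phi t z) (fun t => h (F t (p z))) (- `|t|) `|t| 0) => //.
  - by move=> s _; exact: phic.
  - move=> s /sd s1; have [hc _] := hV _ (VF s z s1 Nz).
    by apply: (@continuous_comp R Y U (fun s => F s (p z)) h); [exact: Ft|exact: hc].
  - by move=> s /sd s1; rewrite phiE; have [_ ->] := hV _ (VF s z s1 Nz).
  - by rewrite oppr_le0 normr_ge0.
  - by rewrite phi0 F0 (hS z Sz).2.
  - by rewrite -ler_norml.
exists d => //; have nG' := nbhs_interior nG.
apply: filterS nG' => z /= Gz t td.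
have [Sz Nz] := nbhs_singleton Gz.
have [hc _] := hV _ (VF t z td Nz).
have cF : {for (t, z), continuous (fun y : R * U => h (F y.1 (p y.2)))}.
  apply: (@continuous_comp (R * U)%type Y U (fun y : R * U => F y.1 (p y.2)) h) => //.
  have c1 : {for (t, z), continuous (fun y : R * U => (y.1, p y.2))}.
    apply: continuous_pair; first exact: cvg_fst.
    by apply: (@continuous_comp (R * U)%type U Y snd p); [exact: cvg_snd|exact: pc].
  have Fc' : {for (t, p z), continuous (fun z : R * Y => F z.1 z.2)} := @Fc (t, p z).
  exact: (@continuous_comp (R * U)%type (R * Y)%type Y _ _ (t, z) c1 Fc').
have nE : nbhs (t, z) [set y : R * U | h (F y.1 (p y.2)) = phi y.1 y.2].
  exists ([set s | `|s| < d], G); last by move=> y [/= y1 y2]; rewrite E.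
  split=> //=.
  have := near_dist (t : R^o) (_ : 0 < d - `|t|); rewrite subr_gt0 => /(_ td); apply: filterS => s /= st.
  by have := ler_normD (s - t) t; rewrite subrK; lra.
move=> P /=; rewrite -(nbhs_singleton nE) => Pz.
by apply: filterS2 (cont_nbhs cF Pz) nE => y /= ? <-.
Qed.

End phi.
End flow.
End covering.

(** * Integration of a local cocycle on a simply connected space *)

Section primitive.
Context {R : realType} {U : topologicalType} (K : U -> U -> R).
Hypothesis K0 : forall w, K w w = 0.
Hypothesis Kloc : forall w, nbhs w [set z | nbhs z [set z' | K w z' - K w z = K z z']].
Implicit Types (c : R -> U) (b : R -> R).

(** [K w z] plays the role of the integral of a closed one-form along a short path from [w] to [z],
    and [b] that of its primitive along the curve [c]. *)
Definition primitive c b (x y : R) := forall t, x <= t <= y ->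
  exists2 d, 0 < d & forall s, x <= s <= y -> `|s - t| < d -> b s - b t = K (c t) (c s).

Lemma primitive_unique c b b' x y : x <= y ->
  primitive c b x y -> primitive c b' x y -> b y - b x = b' y - b' x.
Proof.
move=> xy bp bp'.
have : forall t, x <= t <= y -> b t - b' t = b x - b' x.
  apply: (@loc_const R R (fun t => b t - b' t)) => t txy.
  have [d d0 dP] := bp t txy; have [d' d'0 d'P] := bp' t txy.
  exists (Num.min d d'); first by rewrite lt_min d0.
  move=> s sxy; rewrite lt_min => /andP[sd sd'].
  by have := dP s sxy sd; have := d'P s sxy sd'; lra.
by move=> /(_ y); rewrite xy lexx => /(_ isT); lra.
Qed.

Lemma primitive_sub c b x y x' y' : x <= x' -> y' <= y ->
  primitive c b x y -> primitive c b x' y'.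
Proof.
move=> xx yy bp t /andP[t1 t2].
have [|d d0 dP] := bp t; first by rewrite (le_trans xx t1) (le_trans t2 yy).
by exists d => // s /andP[s1 s2]; apply: dP; rewrite (le_trans xx s1) (le_trans s2 yy).
Qed.

Lemma primitive_ext c c' b x y : (forall t, x <= t <= y -> c t = c' t) ->
  primitive c b x y -> primitive c' b x y.
Proof.
move=> E bp t txy; have [d d0 dP] := bp t txy; exists d => // s sxy sd.
by rewrite -!E// dP.
Qed.

Lemma primitive_affine c b x y x' y' (m q : R) :
  (forall t, x' <= t <= y' -> x <= m * t + q <= y) -> primitive c b x y ->
  primitive (fun t => c (m * t + q)) (fun t => b (m * t + q)) x' y'.
Proof.
move=> H bp t txy; have [d d0 dP] := bp _ (H t txy).
have m0 : 0 < `|m| + 1 by rewrite ltr_wpDl.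
exists (d / (`|m| + 1)); first by rewrite divr_gt0.
move=> s sxy; rewrite ltr_pdivlMr// => sd; apply: dP; first exact: H.
have -> : m * s + q - (m * t + q) = m * (s - t) by ring.
by rewrite normrM (le_lt_trans _ sd)// mulrC ler_wpM2l// lerDl.
Qed.

Lemma primitive_local c x y w :
  (forall t, x <= t <= y -> {for t, continuous c}) ->
  (forall t, x <= t <= y -> nbhs (c t) [set z' | K w z' - K w (c t) = K (c t) z']) ->
  primitive c (fun s => K w (c s)) x y.
Proof.
move=> cc Nc t txy; have [d d0 dP] := nbhs_exR (cont_nbhs (cc t txy) (Nc t txy)).
by exists d => // s _ /dP.
Qed.

Lemma primitive_exists c x y : continuous c -> x <= y -> exists b, primitive c b x y.
Proof.
move=> cc; apply: (@cousin R (fun x y => exists b, primitive c b x y) x y).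
- move=> x1 y1 z1 _ xy yz _ [b bp] [b' bp'].
  exists (fun t => if t <= y1 then b t else b' t - b' y1 + b y1) => t /andP[t1 t2].
  have [ty|yt|E] := ltgtP t y1.
  + have [|d d0 dP] := bp t; first by rewrite t1 ltW.
    exists (Num.min d (y1 - t)); first by rewrite lt_min d0 subr_gt0.
    move=> s /andP[s1 s2]; rewrite lt_min => /andP[sd sy].
    have sy1 : s <= y1 by move: sy; rewrite ltr_norml; lra.
    by rewrite sy1; apply: dP; rewrite ?s1.
  + have [|d d0 dP] := bp' t; first by rewrite t2 ltW.
    exists (Num.min d (t - y1)); first by rewrite lt_min d0 subr_gt0.
    move=> s /andP[s1 s2]; rewrite lt_min => /andP[sd sy].
    have sy1 : y1 < s by move: sy; rewrite ltr_norml; lra.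
    rewrite leNgt sy1/= -(dP s)//; first by ring.
    by rewrite s2 ltW.
  + have [|d d0 dP] := bp t; first by rewrite t1 E lexx.
    have [|d' d'0 d'P] := bp' t; first by rewrite t2 E lexx.
    exists (Num.min d d'); first by rewrite lt_min d0.
    move=> s /andP[s1 s2]; rewrite lt_min => /andP[sd sd'].
    case: leP => sy.
      by apply: dP; rewrite ?s1.
    by have := d'P s; rewrite s2 (ltW sy) => /(_ isT sd') <-; rewrite -E; ring.
- move=> t _.
  have [d d0 dP] := nbhs_exR (cont_nbhs (cc t) (Kloc (c t))).
  exists d => // x1 y1 _ xy _ xd yd; exists (fun s => K (c t) (c s)).
  apply: primitive_local => s /andP[s1 s2]; first exact: cc.
  by apply: dP; move: xd yd; rewrite !ltr_norml; lra.
Qed.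

Hypothesis sc : simply_connected R U.

(** Homotopy invariance of the integral: along a contraction of the loop the increment [V s] is
    locally constant in [s], and it is zero for the constant loop. *)
Lemma primitive_loop01 c b : continuous c -> c 0 = c 1 -> primitive c b 0 1 -> b 1 = b 0.
Proof.
move=> cc c01 bp; have [_ _ /(_ c)] := sc.
move=> /(_ (continuous_subspaceT cc) c01)[H [Hc H0 H1 Hs]].
pose r (z : R * R) := (clamp 0 1 z.1, clamp 0 1 z.2).
have rI (t : R) : clamp 0 1 t \in `[0, 1] by rewrite in_itv/= clamp_itv.
have rc : continuous r.
  move=> z; apply: (@continuous_pair (R * R)%type R R (fun z => clamp 0 1 z.1) (fun z => clamp 0 1 z.2) z).
    apply: (@continuous_comp (R * R)%type R R fst (clamp 0 1)); [exact: cvg_fst|exact: clamp_continuous].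
  apply: (@continuous_comp (R * R)%type R R snd (clamp 0 1)); [exact: cvg_snd|exact: clamp_continuous].
have hc : continuous (H \o r).
  by apply: within_retract Hc rc _ => z; split; exact: rI.
pose h s t := H (r (s, t)).
have hct s : continuous (h s).
  move=> t; have hc' : {for (s, t), continuous (H \o r)} := @hc (s, t).
  have cp : {for t, continuous (fun t => (s, t))} by apply: continuous_pair; [exact: cvg_cst|exact: cvg_id].
  exact: (@continuous_comp R (R * R)%type U _ _ t cp hc').
have hcs t : continuous (h^~ t).
  move=> s; have hc' : {for (s, t), continuous (H \o r)} := @hc (s, t).
  have cp : {for s, continuous (fun s => (s, t))} by apply: continuous_pair; [exact: cvg_id|exact: cvg_cst].
  exact: (@continuous_comp R (R * R)%type U _ _ s cp hc').
have hE s t : 0 <= s <= 1 -> 0 <= t <= 1 -> h s t = H (s, t).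
  by move=> s01 t01; rewrite /h /r/= !clamp_id.
have in1 : 0 <= (1 : R) <= 1 by rewrite ler01 lexx.
have in0 : 0 <= (0 : R) <= 1 by rewrite ler01 lexx.
have hs0 s : h s 0 = c 0.
  by rewrite /h /r/= (clamp_id in0); have [] := Hs _ (rI s).
have hs1 s : h s 1 = c 0.
  by rewrite /h /r/= (clamp_id in1); have [] := Hs _ (rI s).
have [B BP] := choice (fun s => primitive_exists (hct s) (@ler01 R)).
pose V s := B s 1 - B s 0.
have Vc : forall s, 0 <= s <= 1 -> V s = V 0.
  apply: loc_const => s0 _.
  (* On a subinterval, the increments for [s] and [s0] differ by [K] at its two ends. These terms
     telescope when intervals are joined, and vanish at 0 and 1, where the homotopy is fixed. *)
  pose Q x y := exists2 d, 0 < d & forall s, `|s - s0| < d -> forall b, primitive (h s) b x y ->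
    b y - b x = B s0 y - B s0 x + K (h s0 y) (h s y) - K (h s0 x) (h s x).
  suff [d d0 dP] : Q 0 1.
    exists d => // s _ sd; have := dP s sd _ (BP s).
    by rewrite /V !hs0 !hs1 !K0 addr0 subr0.
  apply: (@cousin R Q 0 1 _ _ (@ler01 R)).
  - move=> x y z x0 xy yz z1 [d d0 dP] [d' d'0 d'P].
    exists (Num.min d d'); first by rewrite lt_min d0.
    move=> s; rewrite lt_min => /andP[sd sd'] b' b'p.
    have := dP s sd b' (primitive_sub (lexx _) yz b'p).
    have := d'P s sd' b' (primitive_sub xy (lexx _) b'p); lra.
  - move=> t0 _; pose w := h s0 t0.
    have hc' : {for (s0, t0), continuous (H \o r)} := @hc (s0, t0).
    have [[C D] [/= C0 D0] CD] := cont_nbhs hc' (Kloc w).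
    have [d1 d10 C1] := nbhs_exR C0; have [d2 d20 D1] := nbhs_exR D0.
    exists d2 => // x y x0 xy y1 xd yd.
    have inD t : x <= t <= y -> D t.
      by move=> /andP[h1 h2]; apply: D1; move: xd yd; rewrite !ltr_norml; lra.
    have inN s t : `|s - s0| < d1 -> x <= t <= y ->
        nbhs (h s t) [set z' | K w z' - K w (h s t) = K (h s t) z'].
      by move=> sd txy; apply: (CD (s, t)); split=> /=; [exact: C1|exact: inD].
    have s0d : `|s0 - s0| < d1 by rewrite subrr normr0.
    have xI : x <= x <= y by rewrite lexx. have yI : x <= y <= y by rewrite lexx xy.
    have [e1 e10 E1] := nbhs_exR (cont_nbhs (@hcs x s0) (inN s0 x s0d xI)).
    have [e2 e20 E2] := nbhs_exR (cont_nbhs (@hcs y s0) (inN s0 y s0d yI)).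
    exists (Num.min d1 (Num.min e1 e2)); first by rewrite !lt_min d10 e10.
    move=> s; rewrite !lt_min => /andP[sd /andP[se1 se2]] b' b'p.
    have L s' : `|s' - s0| < d1 -> primitive (h s') (fun t => K w (h s' t)) x y.
      by move=> s'd; apply: primitive_local => t txy; [exact: hct|exact: inN].
    have := primitive_unique xy b'p (L s sd).
    have := primitive_unique xy (primitive_sub x0 y1 (BP s0)) (L s0 s0d).
    by have /= := E1 s se1; have /= := E2 s se2; lra.
have V0 : V 0 = b 1 - b 0.
  apply: primitive_unique (BP 0) _ => //; apply: primitive_ext bp => t t01.
  by rewrite hE// H0// in_itv.
have V1 : V 1 = 0.
  have cp : primitive (h 1) (fun=> 0) 0 1.
    by move=> t t01; exists 1 => // s s01 _; rewrite !hE// !H1 ?in_itv// K0 subr0.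
  by have := primitive_unique (@ler01 R) (BP 1) cp; rewrite subr0.
by have := Vc 1 in1; rewrite V0 V1; lra.
Qed.

Lemma primitive_loop c b x y : continuous c -> x <= y -> c x = c y ->
  primitive c b x y -> b y = b x.
Proof.
move=> cc xy cxy bp.
have bp' : primitive (fun t => c ((y - x) * t + x)) (fun t => b ((y - x) * t + x)) 0 1.
  apply: primitive_affine bp => t /andP[t0 t1].
  have h1 : 0 <= (y - x) * t by rewrite mulr_ge0// subr_ge0.
  have : (y - x) * t <= (y - x) * 1 by rewrite ler_wpM2l// subr_ge0.
  by rewrite mulr1; lra.
have := primitive_loop01 _ _ bp'; rewrite !mulr0 !mulr1 !add0r !subrK; apply=> //.
move=> t; apply: (@continuous_comp R R U (fun t => (y - x) * t + x) c); last exact: cc.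
apply: cvgD; last exact: cvg_cst.
exact: mulrl_continuous.
Qed.

Hypothesis lpc : forall w N, nbhs w N -> nbhs w [set z | exists c, [/\ continuous c,
  c 0 = w, c 1 = z & forall t, N (c t)]].

Lemma primitive_global : exists B : U -> R, forall w, nbhs w [set z | B z - B w = K w z].
Proof.
have [[w0 _] pathc _] := sc.
have H w : exists z : (R -> U) * (R -> R), [/\ continuous z.1, z.1 0 = w0, z.1 1 = w &
    primitive z.1 z.2 0 1].
  have [c [cc c0 c1]] := pathc w0 w.
  have cc' : continuous (c \o clamp 0 1).
    apply: within_retract cc (@clamp_continuous _ _ _) _ => t /=.
    by rewrite in_itv/= clamp_itv.
  have [b bp] := primitive_exists cc' (@ler01 R).
  exists (c \o clamp 0 1, b); split=> //=; rewrite clamp_id ?lexx ?ler01//.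
have [P PP] := choice H.
pose B w := (P w).2 1 - (P w).2 0.
exists B => w; have Hl := lpc (Kloc w); apply: filterS Hl => z [e [ec e0 e1 eN]] /=.
have [pc p0 p1 pp] := PP w; have [qc q0 q1 qp] := PP z.
set p := (P w).1 in pc p0 p1 pp; set q := (P z).1 in qc q0 q1 qp.
(* The loop follows the chosen path to [w] on [0, 1], the short path to [z] on [1, 2], and the
   chosen path to [z] backwards on [2, 3]. *)
pose e' t := e (1 * t + -1); pose q' t := q (-1 * t + 3).
have aff (c : R -> U) (m a : R) : continuous c -> continuous (fun t => c (m * t + a)).
  move=> cc t; apply: (@continuous_comp R R U (fun t => m * t + a) c); last exact: cc.
  by apply: cvgD; [exact: mulrl_continuous|exact: cvg_cst].
pose c1 t := if t <= 2 then e' t else q' t.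
pose c t := if t <= 1 then p t else c1 t.
have c1c : continuous c1.
  apply: glue_continuous; [exact: aff|exact: aff|rewrite /e' /q'].
  have -> : 1 * 2 + -1 = 1 :> R by ring.
  have -> : -1 * 2 + 3 = 1 :> R by ring.
  by rewrite e1 q1.
have cc : continuous c.
  apply: glue_continuous => //; rewrite /c1 /e' ler1n/= p1.
  have -> : 1 * 1 + -1 = 0 :> R by ring.
  by rewrite e0.
have [b bp] := primitive_exists cc (ler0n R 3).
have cE1 t : 0 <= t <= 1 -> c t = p t by move=> /andP[_ h]; rewrite /c h.
have cE2 t : 0 <= t <= 1 -> c (1 * t + 1) = e t.
  move=> /andP[h0 h1]; rewrite /c; case: leP => h.
    have -> : t = 0 by lra.
    by rewrite mulr0 add0r p1 e0.
  rewrite /c1 /e'; have -> : (1 * t + 1 <= 2) = true by lra.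
  by congr e; ring.
have cE3 t : 0 <= t <= 1 -> c (-1 * t + 3) = q t.
  move=> /andP[h0 h1]; rewrite /c; have -> : (-1 * t + 3 <= 1) = false by apply/negbTE; rewrite -ltNge; lra.
  rewrite /c1; case: leP => h.
    have -> : t = 1 by lra.
    by rewrite /e' q1 -e1; congr e; ring.
  by rewrite /q'; congr q; ring.
have E1 : b 1 - b 0 = B w.
  apply: (@primitive_unique p b (P w).2 0 1) => //.
  apply: primitive_ext cE1 _; apply: primitive_sub bp => //; by rewrite ler1n.
have E2 : b (1 * 1 + 1) - b (1 * 0 + 1) = K w (e 1) - K w (e 0).
  apply: (@primitive_unique e (fun t => b (1 * t + 1)) (fun t => K w (e t)) 0 1) => //.
    apply: primitive_ext cE2 _; apply: primitive_affine bp => t; lra.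
  by apply: primitive_local => t _; [exact: ec|exact: eN].
have E3 : b (-1 * 1 + 3) - b (-1 * 0 + 3) = B z.
  apply: (@primitive_unique q (fun t => b (-1 * t + 3)) (P z).2 0 1) => //.
  by apply: primitive_ext cE3 _; apply: primitive_affine bp => t; lra.
have E4 : b 3 = b 0.
  apply: (@primitive_loop c b 0 3) => //.
  rewrite cE1 ?lexx ?ler01// p0 -q0 -cE3 ?lexx ?ler01//; congr c; ring.
move: E1 E2 E3; rewrite e1 e0 K0 !mulr0 !mulr1 !add0r.
have -> : 1 + 1 = 2 :> R by ring.
have -> : -1 + 3 = 2 :> R by ring.
by rewrite E4; lra.
Qed.

End primitive.

(** * Lengths of curves *)

Section antiderivative.
Context {R : realType}.
Implicit Types (F G s : R -> R) (a b t : R).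

(** Small intervals satisfy the inequality up to a slack proportional to their length, which is
    additive, so [cousin] applies. Length estimates then reduce to comparing derivatives. *)
Lemma sderiv_le F G a b : a <= b -> (forall t, a <= t <= b -> exists x y,
    [/\ sderiv F t x, sderiv G t y & x <= y]) -> F b - F a <= G b - G a.
Proof.
move=> ab H; apply/ler_addgt0Pr => e e0.
have d0 : 0 < b - a + 1 by lra.
suff : F b - F a <= G b - G a + e / (b - a + 1) * (b - a).
  move=> /le_trans; apply; rewrite lerD2l mulrAC ler_pdivrMr// ler_wpM2l//; first exact: ltW.
  by lra.
set k := e / _; have k0 : 0 < k by rewrite divr_gt0.
apply: (@cousin R (fun x y => F y - F x <= G y - G x + k * (y - x)) a b _ _ ab).
- by move=> x y z _ _ _ _; lra.
- move=> t /H[x [y [Fx Gy xy]]]; have k2 := half_gt0 k0.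
  have [d1 d10 D1] := Fx _ k2; have [d2 d20 D2] := Gy _ k2.
  exists (Num.min d1 d2); first by rewrite lt_min d10.
  move=> u v _ uv _; rewrite !lt_min => /andP[u1 u2] /andP[v1 v2].
  have vu : 0 <= v - u by rewrite subr_ge0.
  have := D1 v u v1 u1; have := D2 v u v2 u2.
  rewrite (ger0_norm vu) !ler_norml => /andP[h1 _] /andP[_ h2].
  have : (v - u) * x <= (v - u) * y by rewrite ler_wpM2l.
  by move: h1 h2; rewrite ![_ *: _]/GRing.scale/=; lra.
Qed.

Lemma sderiv_eq F G a b : a <= b -> (forall t, a <= t <= b -> exists2 x,
    sderiv F t x & sderiv G t x) -> F b - F a = G b - G a.
Proof.
move=> ab H; apply/eqP; rewrite eq_le; apply/andP; split; apply: sderiv_le => // t /H[x Fx Gx];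
  by exists x, x; split.
Qed.

Lemma is_derive_sderiv F s t : (\near t, is_derive t (1 : R) F (s t)) ->
  {for t, continuous s} -> sderiv F t (s t).
Proof.
move=> Fs sc e e0; have [d d0 dP] := nbhs_exR Fs.
have [d' d'0 d'P] := (contP (W := R) (V := R^o) s t).1 sc e e0.
exists (Num.min d d'); first by rewrite lt_min d0.
have main a b : a <= b -> `|a - t| < Num.min d d' -> `|b - t| < Num.min d d' ->
    `|F b - F a - (b - a) * s t| <= e * (b - a).
  rewrite !lt_min => ab /andP[ad ad'] /andP[bd bd'].
  have := @mean_value_R R (fun u => F u - u * s t) (fun u => s u - s t) a b e ab.
  have -> : F b - b * s t - (F a - a * s t) = F b - F a - (b - a) * s t by ring.
  have H u : a <= u <= b -> `|u - t| < d /\ `|u - t| < d'.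
    by move=> /andP[u1 u2]; move: ad ad' bd bd'; rewrite !ltr_norml; lra.
  apply.
  - move=> u /H[/dP Fu _].
    have sid : is_derive u (1 : R) (fun u : R => u * s t) (s t).
      have := sderiv_is_derive (sderiv_scalel (s t : R^o) u); exact.
    exact: is_deriveB.
  - by move=> u /H[_ /d'P/ltW].
move=> a b ad bd; have [ab|/ltW ab] := leP a b.
  have -> : `|a - b| = b - a by rewrite distrC ger0_norm ?subr_ge0.
  have := main a b ab ad bd; rewrite -normrN; congr (`|_| <= _).
  by rewrite [_ *: _]/GRing.scale/=; ring.
have -> : `|a - b| = a - b by rewrite ger0_norm ?subr_ge0.
exact: main.
Qed.

Lemma antiderivative_segment s T : 0 < T -> continuous s -> exists S : R -> R,
  S 0 = 0 /\ forall t, `|t| < T -> sderiv S t (s t).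
Proof.
move=> T0 sc.
have int : (@lebesgue_measure R).-integrable `[- T, T] (EFin \o s).
  apply: continuous_compact_integrable; first exact: segment_compact.
  exact: continuous_subspaceT.
pose F x := (\int[@lebesgue_measure R]_(t in `[- T, x]) s t)%R.
have Fd t : `|t| < T -> is_derive t (1 : R) F (s t).
  rewrite ltr_norml => /andP[t1 t2].
  have [] := continuous_FTC1_closed t2 int t1 (sc t).
  by rewrite derive1E => h <-; exact: DeriveDef.
exists (fun x => F x - F 0); split; first by rewrite subrr.
move=> t tT; have FS : sderiv F t (s t).
  apply: is_derive_sderiv (sc t).
  have := near_dist (t : R^o) (_ : 0 < T - `|t|); rewrite subr_gt0 => /(_ tT).
  apply: filterS => u ut; apply: Fd.
  by have := ler_normD (u - t) t; rewrite subrK; lra.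
by rewrite -[s t]addr0; apply: sderivD FS (sderiv_cst _ _).
Qed.

Lemma antiderivative s : continuous s -> exists S : R -> R, forall t, sderiv S t (s t).
Proof.
move=> sc.
have T0 (t : R) : 0 < `|t| + 1 by rewrite ltr_wpDl.
have [S SP] := choice (fun t => antiderivative_segment (T0 t) sc).
have S0 t : S t 0 = 0 by case: (SP t).
have SE u t t' : `|u| < `|t| + 1 -> `|u| < `|t'| + 1 -> S t u = S t' u.
  move=> ut ut'; have [u0|u0] := leP 0 u.
    have := @sderiv_eq (S t) (S t') 0 u u0; rewrite !S0 !subr0; apply => v /andP[v0 vu].
    have vu' : `|v| <= `|u| by rewrite !ger0_norm.
    by exists (s v); apply: (SP _).2; lra.
  have := @sderiv_eq (S t) (S t') u 0 (ltW u0); rewrite !S0 !sub0r.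
  move=> H; apply: oppr_inj; apply: H => v /andP[v0 vu].
  have vu' : `|v| <= `|u| by rewrite (ltr0_norm u0) ler0_norm// lerN2.
  by exists (s v); apply: (SP _).2; lra.
exists (fun t => S t t) => t.
have St : sderiv (S t) t (s t) by apply: (SP t).2; lra.
apply: sderiv_near St _.
have := near_dist (t : R^o) (@ltr01 R); apply: filterS => u ut.
apply: SE; last by lra.
by have := ler_normD (u - t) t; rewrite subrK; lra.
Qed.

(** A C^1 reparametrization that stops at both ends, obtained by integrating t (1 - t) on [0, 1] and
    normalizing. It lets curves be concatenated and extended to the whole line without losing
    differentiability. *)
Lemma smoothstep : exists l l' : R -> R, [/\ forall t, sderiv l t (l' t),
  forall t, 0 <= l' t /\ 0 <= l t <= 1,
  forall t, t <= 0 -> l t = 0 /\ l' t = 0 & forall t, 1 <= t -> l t = 1 /\ l' t = 0].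
Proof.
pose k t : R := clamp 0 1 t * (1 - clamp 0 1 t).
have k0 t : 0 <= k t.
  by have /andP[h1 h2] := clamp_itv t (@ler01 R); rewrite mulr_ge0// subr_ge0.
have kc : continuous k.
  move=> t; apply: (@continuousM R R (clamp 0 1) (fun t => 1 - clamp 0 1 t)); first exact: clamp_continuous.
  by apply: cvgB; [exact: cvg_cst|exact: clamp_continuous].
have kn t : t <= 0 -> k t = 0.
  by move=> t0; rewrite /k /clamp (min_idPl (le_trans t0 ler01)) (max_idPl t0) mul0r.
have kp t : 1 <= t -> k t = 0.
  by move=> t1; rewrite /k /clamp (min_idPr t1) (max_idPr ler01) subrr mulr0.
have [S SP] := antiderivative kc.
have Sm a b : a <= b -> 0 <= S b - S a.
  move=> ab; have := @sderiv_le (fun=> 0) S a b ab; rewrite subrr; apply => t _.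
  by exists 0, (k t); split=> //; exact: sderiv_cst.
have Sc a b : a <= b -> (forall t, a <= t <= b -> k t = 0) -> S b = S a.
  move=> ab H; have := @sderiv_eq S (fun=> 0) a b ab; rewrite subrr => E.
  apply/subr0_eq/E => t /H kt; exists 0; last exact: sderiv_cst.
  by rewrite -kt.
(* The integrand is at least 3/16 on the middle half of [0, 1]. *)
have I0 : 0 < S 1 - S 0.
  have h1 : (1/4 : R) <= 3/4 by lra.
  have h2 : (0 : R) <= 1/4 by lra. have h3 : (3/4 : R) <= 1 by lra.
  have := Sm _ _ h2; have := Sm _ _ h3.
  have := @sderiv_le (fun t => 3/16 * t) S _ _ h1 _.
  have H t : 1/4 <= t <= 3/4 -> exists x y : R,
      [/\ sderiv (fun t : R => 3/16 * t) t x, sderiv S t y & x <= y].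
    move=> /andP[t1 t2]; exists (3/16), (k t); split=> //; first exact: sderiv_mull.
    rewrite /k clamp_id; last by lra.
    have : 0 <= (t - 1/4) * (3/4 - t) by rewrite mulr_ge0// subr_ge0.
    lra.
  by move=> /(_ H); lra.
exists (fun t => (S t - S 0) / (S 1 - S 0)), (fun t => k t / (S 1 - S 0)); split.
- move=> t; have D := sderivD (SP t) (sderiv_cst (- S 0) t); rewrite addr0 in D.
  exact: (sderiv_scale ((S 1 - S 0)^-1 : R^o) D).
- move=> t; split; first by rewrite divr_ge0// ltW.
  have [t0|t0] := leP t 0.
    by rewrite (Sc t 0 t0) ?subrr ?mul0r ?lexx ?ler01// => u /andP[_]; exact: kn.
  rewrite divr_ge0 ?Sm ?(ltW t0) ?(ltW I0)//= ler_pdivrMr// mul1r lerD2r.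
  have [t1|t1] := leP t 1; first by rewrite -subr_ge0; exact: Sm.
  by rewrite (Sc 1 t (ltW t1))// => u /andP[+ _]; exact: kp.
- move=> t t0; rewrite kn// mul0r (Sc t 0 t0) ?subrr ?mul0r//.
  by move=> u /andP[_]; exact: kn.
- move=> t t1; rewrite kp// mul0r (Sc 1 t t1) ?divff ?gt_eqF//.
  by move=> u /andP[+ _]; exact: kp.
Qed.

End antiderivative.

Section mderiv.
Context {R : realType} {n r : nat} {M : topologicalType} (A : atlas R n r.+2 M).
Implicit Types (c : R -> M).

Lemma mderiv_reparam c (l : R -> R) t l' v : sderiv l t l' -> mderiv A c (l t) v ->
  mderiv A (fun t => c (l t)) t (l' *: v).
Proof.
move=> ll [cc cv]; split.
  apply: (@continuous_comp R R M l c) => //; exact: sderiv_continuous ll.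
have := @sderiv_comp R R^o _ l (fun u => coord A (c (l t)) (c u)) t l' (fun h : R => h *: v) ll.
by apply; exact/sderiv_sdiff.
Qed.

Lemma mderiv_glue c c' t v : mderiv A c t v -> mderiv A c' t v -> c t = c' t ->
  continuous (fun s => if s <= t then c s else c' s) ->
  mderiv A (fun s => if s <= t then c s else c' s) t v.
Proof.
move=> [_ cv] [_ c'v] E gc; split; first exact: gc.
rewrite lexx.
rewrite -E in c'v.
have E' : coord A (c t) (c t) = coord A (c t) (c' t) by rewrite -E.
have D := @sderiv_glue R _ (fun s => coord A (c t) (c s)) (fun s => coord A (c t) (c' s)) t v cv c'v E'.
apply: sderiv_near D _.
by apply: nbhsW => s; case: ifP.
Qed.

End mderiv.

(** * Arcs, their lengths and the distance *)

Section arcs.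
Context {R : realType} {n r : nat} {M : topologicalType} (A : atlas R n r.+2 M).
Variables (g : M -> 'M[R]_n).
Hypothesis gR : riemannian_metric A r.+1 g.
Context {U : topologicalType} (p : U -> M).
Implicit Types (c : R -> U) (l : R -> R) (y z : U) (P : set U).

(** The arc length is carried as a function [l] whose derivative is the speed, so lengths are
    differences of values of [l]; integrals return only in [arc_length]. *)
Definition arc c l := continuous c /\ forall t, exists2 v,
  mderiv A (fun t => p (c t)) t v & sderiv l t (tnorm g (p (c t)) v).

Lemma arc_exists c : continuous c -> (forall t, exists v, mderiv A (fun t => p (c t)) t v) ->
  exists l, arc c l.
Proof.
move=> cc /choice[v cv].
have sc : continuous (fun t => tnorm g (p (c t)) (v t)).
  by move=> t; apply: (speed_continuous gR); exact: nbhsW.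
have [l ll] := antiderivative sc.
by exists l; split=> // t; exists (v t).
Qed.

Lemma arc_mono c l a b : arc c l -> a <= b -> l a <= l b.
Proof.
move=> [_ cl] ab; rewrite -subr_ge0.
have := @sderiv_le R (fun=> 0) l a b ab; rewrite subrr; apply => t _.
have [v _ lv] := cl t; exists 0, (tnorm g (p (c t)) v); split=> //; first exact: sderiv_cst.
exact: tnorm_ge0.
Qed.

Lemma arc_reparam c l (m m' : R -> R) : arc c l ->
  (forall t, sderiv m t (m' t)) -> (forall t, 0 <= m' t) ->
  arc (fun t => c (m t)) (fun t => l (m t)).
Proof.
move=> [cc cl] mm m0; split.
  move=> t; apply: (@continuous_comp R R U m c); [exact: sderiv_continuous (mm t)|exact: cc].
move=> t; have [v cv lv] := cl (m t); exists (m' t *: v).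
  exact: (mderiv_reparam (mm t) cv).
rewrite tnormZ (ger0_norm (m0 t)).
have := @sderiv_comp R R^o R^o m l t (m' t) (fun h : R => h *: (tnorm g (p (c (m t))) v : R^o)) (mm t).
by apply; exact/sderiv_sdiff.
Qed.

Lemma arc_rev c l : arc c l -> arc (fun t => c (1 - t)) (fun t => - l (1 - t)).
Proof.
move=> [cc cl].
have mm (t : R) : sderiv (fun t : R => 1 - t) t (-1).
  have D := sderivD (sderiv_cst (1 : R^o) t) (sderiv_mull (-1) t); rewrite add0r in D.
  by apply: sderiv_near D _; apply: nbhsW => s; rewrite mulN1r.
split.
  move=> t; apply: (@continuous_comp R R U (fun t => 1 - t) c); [exact: sderiv_continuous (mm t)|exact: cc].
move=> t; have [v cv lv] := cl (1 - t); exists (-1 *: v).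
  exact: (mderiv_reparam (mm t) cv).
rewrite tnormZ normrN1 mul1r.
have := @sderiv_comp R R^o R^o (fun t => 1 - t) l t (-1)
  (fun h : R => h *: (tnorm g (p (c (1 - t))) v : R^o)) (mm t).
move=> /(_ (proj1 (sderiv_sdiff _ _ _) lv)) D.
have D' := sderiv_scale (-1 : R^o) D.
have E (x : R) : x = (-1 *: (x : R^o)) *: (-1 : R^o) by rewrite [RHS]mulrN1 [_ *: _]mulN1r opprK.
rewrite [X in sderiv _ _ X]E.
by apply: sderiv_near D' _; apply: nbhsW => s; rewrite [_ *: _]mulrN1.
Qed.

Lemma arc_glue c c' l l' s : arc c l -> arc c' l' -> c s = c' s ->
  mderiv A (fun t => p (c t)) s 0 -> mderiv A (fun t => p (c' t)) s 0 ->
  continuous (fun t => p (if t <= s then c t else c' t)) ->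
  arc (fun t => if t <= s then c t else c' t)
      (fun t => if t <= s then l t else l' t - l' s + l s).
Proof.
move=> [cc cl] [cc' cl'] E c0 c'0 pc.
have ifE t : p (if t <= s then c t else c' t) = if t <= s then p (c t) else p (c' t).
  by case: ifP.
split; first exact: glue_continuous.
have l'D t v : sderiv l' t v -> sderiv (fun t => l' t - l' s + l s) t v.
  move=> lv; rewrite -[v]addr0; apply: sderivD (sderiv_cst _ _).
  by rewrite -[v]addr0; apply: sderivD lv (sderiv_cst _ _).
move=> t; have [ts|st|ts] := ltgtP t s.
- have n3 : \forall u \near t, u < s by exact: lt_nbhsl.
  have [v cv lv] := cl t; exists v.
    by apply: mderiv_near cv _; apply: filterS n3 => u /ltW ->.
  by apply: sderiv_near lv _; apply: filterS n3 => u /ltW ->.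
- have n3 : \forall u \near t, s < u by exact: lt_nbhsr.
  have [v cv lv] := cl' t; exists v.
    by apply: mderiv_near cv _; apply: filterS n3 => u; rewrite leNgt => ->.
  by apply: sderiv_near (l'D _ _ lv) _; apply: filterS n3 => u; rewrite leNgt => ->.
- rewrite ts; exists 0.
    have := @mderiv_glue R n r M A (fun t => p (c t)) (fun t => p (c' t)) s 0 c0 c'0.
    rewrite E => /(_ erefl) D; have {}D : mderiv A (fun t => if t <= s then p (c t) else p (c' t)) s 0.
      by apply: D => u; have := pc u; rewrite /continuous_at; under eq_fun do rewrite ifE; rewrite ifE.
    by apply: mderiv_near D _; apply: nbhsW => u; rewrite ifE.
  have l0 : sderiv l s 0.
    by have [v cv lv] := cl s; rewrite (mderiv_unique cv c0) tnorm0 in lv.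
  have l'0 : sderiv l' s 0.
    by have [v cv lv] := cl' s; rewrite (mderiv_unique cv c'0) tnorm0 in lv.
  rewrite tnorm0; apply: sderiv_glue l0 (l'D _ _ l'0) _.
  by rewrite subrr add0r.
Qed.

(** With [P] a level set of the height this stands for a level distance at most [L], without taking
    an infimum. *)
Definition joined P y z (L : R) := exists c l, [/\ arc c l, forall t, P (c t),
  c 0 = y, c 1 = z & l 1 - l 0 <= L].

Lemma joined_le P y z L L' : L <= L' -> joined P y z L -> joined P y z L'.
Proof. by move=> LL [c [l [cl cP c0 c1 lL]]]; exists c, l; split=> //; exact: le_trans LL. Qed.

Lemma joined_sub P P' y z L : P `<=` P' -> joined P y z L -> joined P' y z L.
Proof. by move=> PP [c [l [cl cP c0 c1 lL]]]; exists c, l; split=> // t; exact: PP. Qed.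

Lemma mderiv_cst (x : M) t : mderiv A (fun=> x) t 0.
Proof. by split; [exact: cvg_cst|exact: sderiv_cst]. Qed.

Lemma joined_refl P y : P y -> joined P y y 0.
Proof.
move=> Py; exists (fun=> y), (fun=> 0); split=> //; rewrite ?subrr//.
split=> t; first exact: cvg_cst.
by exists 0; [exact: mderiv_cst|rewrite tnorm0; exact: sderiv_cst].
Qed.

Lemma joined_sym P y z L : joined P y z L -> joined P z y L.
Proof.
move=> [c [l [cl cP c0 c1 lL]]]; exists (fun t => c (1 - t)), (fun t => - l (1 - t)).
split=> //; [exact: arc_rev|by rewrite subr0|by rewrite subrr|].
by rewrite subrr subr0 opprK addrC.
Qed.

Hypothesis pc : continuous p.

(** Both arcs are slowed down by [smoothstep] so as to stop where they meet, at time 1/2; the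
    junction then has velocity zero on both sides. *)
Lemma joined_trans P x y z L L' : joined P x y L -> joined P y z L' -> joined P x z (L + L').
Proof.
move=> [c [l [cl cP c0 c1 lL]]] [c' [l' [cl' cP' c'0 c'1 lL']]].
have [m [m' [mm mb m0 m1]]] := @smoothstep R.
have aff (a b : R) : 0 <= a -> (forall t, sderiv (fun t => m (a * t + b)) t (m' (a * t + b) * a)) /\
    forall t, 0 <= m' (a * t + b) * a.
  move=> a0; split=> t; last by rewrite mulr_ge0//; case: (mb (a * t + b)).
  have D : sderiv (fun t : R => a * t + b) t a.
    by rewrite -[X in sderiv _ _ X]addr0; apply: sderivD (sderiv_mull a t) (sderiv_cst _ _).
  have := @sderiv_comp R R^o R^o (fun t : R => a * t + b) m t a
    (fun h : R => h *: (m' (a * t + b) : R^o)) D (proj1 (sderiv_sdiff _ _ _) (mm _)).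
  by rewrite [_ *: _]mulrC.
have h20 : 0 <= 2 :> R by [].
have [d1 p1] := aff 2 0 h20; have [d2 p2] := aff 2 (-1) h20.
have a1 := arc_reparam cl d1 p1; have a2 := arc_reparam cl' d2 p2.
have n2 : 2%:R != 0 :> R by rewrite pnatr_eq0.
have h1 : 2 * 2^-1 + 0 = 1 :> R by rewrite mulfV// addr0.
have h2 : 2 * 2^-1 + -1 = 0 :> R by rewrite mulfV// subrr.
have E : c (m (2 * 2^-1 + 0)) = c' (m (2 * 2^-1 + -1)).
  by rewrite h1 h2 (m1 1 (lexx _)).1 (m0 0 (lexx _)).1 c1 c'0.
have v1 : mderiv A (fun t => p (c (m (2 * t + 0)))) 2^-1 0.
  have [v cv _] := cl.2 (m (2 * 2^-1 + 0)).
  have := mderiv_reparam (d1 2^-1) cv; rewrite h1 (m1 1 (lexx _)).2 mul0r scale0r; exact.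
have v2 : mderiv A (fun t => p (c' (m (2 * t + -1)))) 2^-1 0.
  have [v cv _] := cl'.2 (m (2 * 2^-1 + -1)).
  have := mderiv_reparam (d2 2^-1) cv; rewrite h2 (m0 0 (lexx _)).2 mul0r scale0r; exact.
have gc := glue_continuous a1.1 a2.1 E.
have pgc : continuous (fun t : R => p (if t <= 2^-1 then c (m (2 * t + 0)) else c' (m (2 * t + -1)))).
  by move=> t; apply: (@continuous_comp R U M _ p); [exact: gc|exact: pc].
have a3 := arc_glue a1 a2 E v1 v2 pgc.
eexists _, _; split; first exact: a3.
- by move=> t /=; case: ifP.
- rewrite /=; have -> : ((0 : R) <= 2^-1) by rewrite invr_ge0.
  by rewrite mulr0 addr0 (m0 0 (lexx _)).1.
- rewrite /=; have -> : ((1 : R) <= 2^-1) = false by apply/negbTE; rewrite -ltNge; lra.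
  have -> : 2 * 1 + -1 = 1 :> R by ring.
  by rewrite (m1 1 (lexx _)).1.
- rewrite /=; have -> : ((1 : R) <= 2^-1) = false by apply/negbTE; rewrite -ltNge; lra.
  have -> : ((0 : R) <= 2^-1) by rewrite invr_ge0.
  rewrite h1 h2 mulr0 addr0; have -> : 2 * 1 + -1 = 1 :> R by ring.
  by rewrite (m1 1 (lexx _)).1 (m0 0 (lexx _)).1; lra.
Qed.

Lemma arc_joined P c l a b : arc c l -> (forall t, P (c t)) -> a <= b ->
  joined P (c a) (c b) (l b - l a).
Proof.
move=> cl cP ab.
have D t : sderiv (fun t : R => (b - a) * t + a) t (b - a).
  by rewrite -[X in sderiv _ _ X]addr0; apply: sderivD (sderiv_mull _ t) (sderiv_cst _ _).
have ba t : 0 <= (fun _ : R => b - a) t by rewrite subr_ge0.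
exists (fun t => c ((b - a) * t + a)), (fun t => l ((b - a) * t + a)); split=> //.
- exact: arc_reparam D ba.
- by rewrite mulr0 add0r.
- by rewrite mulr1 subrK.
- by rewrite mulr0 mulr1 add0r subrK.
Qed.

Lemma arc_length c l : arc c l -> curve_length A g (fun t => p (c t)) = l 1 - l 0.
Proof.
move=> cl.
pose s t := tnorm g (p (c t)) (velocity A (fun t => p (c t)) t).
have sE t : sderiv l t (s t).
  by have [v cv lv] := cl.2 t; rewrite /s (mderiv_velocity cv).
have sc : continuous s.
  move=> t; apply: (speed_continuous gR); apply: nbhsW => u.
  by have [v cv lv] := cl.2 u; rewrite (mderiv_velocity cv).
have lc : continuous l by move=> t; exact: sderiv_continuous (sE t).
rewrite /curve_length /Rintegral -/s.
have -> : (\int[lebesgue_measure]_(t in `[0%R, 1%R]) (s t)%:E = (l 1)%:E - (l 0)%:E)%E.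
  apply: continuous_FTC2 => //.
  - exact: continuous_subspaceT.
  - split; [|apply: cvg_at_right_filter; exact: lc|apply: cvg_at_left_filter; exact: lc].
    by move=> t _; have [] := sderiv_is_derive (sE t).
  - by move=> t _; rewrite derive1E; have [_ ->] := sderiv_is_derive (sE t).
by rewrite -EFinB.
Qed.

Local Notation d := (cover_dist A g p).
Local Notation curves y z := ([set curve_length A g (fun t => p (c t)) | c in
  [set c : R -> U | [/\ continuous c, C1_curve A (fun t => p (c t)), c 0 = y & c 1 = z]]]).

Lemma curves_joined y z x : curves y z x -> 0 <= x /\ joined setT y z x.
Proof.
move=> [c [cc /C1_curveP[_ cv] c0 c1] <-].
have [l cl] := arc_exists cc cv; rewrite (arc_length cl); split.
  by rewrite subr_ge0; exact: arc_mono cl (ler01).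
by exists c, l; split.
Qed.

Lemma curves_lbound y z : has_lbound (curves y z).
Proof. by exists 0 => x /curves_joined[]. Qed.

Lemma joined_curves P y z L : joined P y z L -> exists2 x, curves y z x & x <= L.
Proof.
move=> [c [l [cl _ c0 c1 lL]]]; exists (l 1 - l 0) => //.
exists c; last exact: arc_length.
split=> //; first by case: cl.
apply/C1_curveP; split.
  by move=> t; apply: (@continuous_comp R U M c p); [case: cl => cc _; exact: cc|exact: pc].
by move=> t; have [v cv _] := cl.2 t; exists v.
Qed.

Lemma joined_dist P y z L : joined P y z L -> d y z <= L.
Proof.
move=> /joined_curves[x yzx xL]; apply: le_trans xL; apply: ge_inf yzx.
exact: curves_lbound.
Qed.

Hypothesis conn : forall y z, exists L, joined setT y z L.

(** Connectedness matters here: the infimum of an empty set of lengths would have a default value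
    that no curve approaches. *)
Lemma dist_joined y z L : d y z < L -> joined setT y z L.
Proof.
move=> dL; have [L0 /joined_curves[x0 yzx0 _]] := conn y z.
have hi : has_inf (curves y z) by split; [exists x0|exact: curves_lbound].
have e0 : 0 < L - d y z by rewrite subr_gt0.
have [x yzx] := inf_adherent e0 hi.
rewrite -/(d y z) addrC subrK => xL.
by have [_] := curves_joined yzx; apply: joined_le; exact: ltW.
Qed.

Lemma dist_sym y z : d y z = d z y.
Proof.
have H u v : d u v <= d v u.
  apply/ler_addgt0Pr => e e0; apply: (@joined_dist setT); apply: joined_sym.
  by apply: dist_joined; rewrite ltrDl.
by apply/eqP; rewrite eq_le !H.
Qed.

Lemma dist_triangle x y z : d x z <= d x y + d y z.
Proof.
apply/ler_addgt0Pr => e e0; have e2 := half_gt0 e0.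
have H u v : joined setT u v (d u v + e / 2) by apply: dist_joined; rewrite ltrDl.
by have := joined_dist (joined_trans (H x y) (H y z)); lra.
Qed.

End arcs.

Section norm_comparison.
Context {R : realType}.

Lemma sderiv_norm_le (W : normedModType R) (F : R -> W) (G : R -> R) (a b : R) : a <= b ->
  (forall t, a <= t <= b -> exists w y, [/\ sderiv F t w, sderiv G t y & `|w| <= y]) ->
  `|F b - F a| <= G b - G a.
Proof.
move=> ab H; apply/ler_addgt0Pr => e e0.
have d0 : 0 < b - a + 1 by lra.
suff : `|F b - F a| <= G b - G a + e / (b - a + 1) * (b - a).
  move=> /le_trans; apply; rewrite lerD2l mulrAC ler_pdivrMr// ler_wpM2l//; first exact: ltW.
  by lra.
set k := e / _; have k0 : 0 < k by rewrite divr_gt0.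
apply: (@cousin R (fun x y => `|F y - F x| <= G y - G x + k * (y - x)) a b _ _ ab).
- by move=> x y z _ _ _ _ h1 h2; have := ler_distD (F y) (F z) (F x); lra.
- move=> t /H[w [y [Fw Gy wy]]]; have k2 := half_gt0 k0.
  have [d1 d10 D1] := Fw _ k2; have [d2 d20 D2] := Gy _ k2.
  exists (Num.min d1 d2); first by rewrite lt_min d10.
  move=> u v _ uv _; rewrite !lt_min => /andP[u1 u2] /andP[v1 v2].
  have vu : 0 <= v - u by rewrite subr_ge0.
  have := D1 v u v1 u1; have := D2 v u v2 u2.
  rewrite (ger0_norm vu) => h2 h1.
  have h3 : `|F v - F u| <= `|(v - u) *: w| + `|F v - F u - (v - u) *: w|.
    by rewrite -[X in `|X| <= _](subrK ((v - u) *: w)) addrC ler_normD.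
  have h4 : `|(v - u) *: w| <= (v - u) * y by rewrite normrZ (ger0_norm vu) ler_wpM2l.
  move: h2; rewrite ler_norml => /andP[+ _]; rewrite [_ *: _]/GRing.scale/=.
  by move: h1 h3 h4; lra.
Qed.

Lemma sderiv_norm_bound (W : normedModType R) (F : R -> W) (G : R -> R) (K t : R) w y :
  0 <= K -> sderiv F t w -> sderiv G t y ->
  (\forall u \near t, `|F u - F t| <= K * `|G u - G t|) -> `|w| <= K * `|y|.
Proof.
move=> K0 Fw Gy H; apply/ler_addgt0Pr => e e0.
have k0 : 0 < e / (K + 1) by rewrite divr_gt0// ltr_wpDl.
set k := e / (K + 1) in k0.
have ek : e = (K + 1) * k by rewrite /k mulrC divfK// gt_eqF// ltr_wpDl.
have [d1 d10 D1] := Fw _ k0; have [d2 d20 D2] := Gy _ k0; have [d3 d30 D3] := nbhs_exR H.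
pose h := Num.min d1 (Num.min d2 d3) / 2.
have m0 : 0 < Num.min d1 (Num.min d2 d3) by rewrite !lt_min d10 d20.
have h0 : 0 < h by exact: half_gt0.
have hm : h < Num.min d1 (Num.min d2 d3) by rewrite /h; lra.
have [h1 h2 h3] : [/\ h < d1, h < d2 & h < d3].
  by move: hm; rewrite !lt_min => /and3P.
have ht : `|t + h - t| = h by rewrite addrAC subrr add0r gtr0_norm.
have tt d : 0 < d -> `|t - t| < d by rewrite subrr normr0.
have := D1 (t + h) t; rewrite ht => /(_ h1 (tt _ d10)) E1.
have := D2 (t + h) t; rewrite ht => /(_ h2 (tt _ d20)) E2.
have := D3 (t + h); rewrite ht => /(_ h3) E3.
have th : t + h - t = h by ring.
rewrite th in E1 E2.
have F1 : `|h *: w| <= `|F (t + h) - F t| + k * h.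
  rewrite -[h *: w](subKr (F (t + h) - F t)) (le_trans (ler_normB _ _))// lerD2l//.
have F2 : `|G (t + h) - G t| <= h * `|y| + k * h.
  rewrite -[G (t + h) - G t](subrK (h *: (y : R^o))) addrC (le_trans (ler_normD _ _))//.
  by rewrite lerD//; rewrite normrZ gtr0_norm.
have F3 : K * `|G (t + h) - G t| <= K * (h * `|y| + k * h) by rewrite ler_wpM2l.
rewrite -(ler_pM2l h0) -{1}(gtr0_norm h0) -normrZ.
move: F1 E3 F3; set x1 := `|_|; set x2 := `|_|; set x3 := `|_|; set x4 := `|_| => F1 E3 F3.
rewrite ek; lra.
Qed.

End norm_comparison.

(** * Length control inside plaques *)

Section leaf_lengths.
Context {R : realType} {n r : nat} {M : topologicalType} (A : atlas R n r.+2 M).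
Variables (g : M -> 'M[R]_n).
Hypotheses (gR : riemannian_metric A r.+1 g) (hM : hausdorff_space M).
Context {k l m : nat} (F : foliation A k l m.+1).
Implicit Types (q x z : M).

Let leaf_id : leaf_space F -> M := fun x => x.

(* The constants only depend on q, so they apply to curves in infinitely many
   plaques accumulating at q; this is where compactness of M enters later on. *)
Lemma leaf_length_control q : exists (d K : R) (Y : set 'rV[R]_l),
  [/\ 0 < d, 0 < K, nbhs (trans F q q) Y,
    forall s y, `|s - along F q q| < 2 * d -> Y y -> ball 0 1 s /\ ball 0 1 y &
    forall (c : R -> leaf_space F) ln, arc A g leaf_id c ln ->
      fdom F q (c 0) -> `|along F q (c 0) - along F q q| < d -> Y (trans F q (c 0)) ->
      K * (ln 1 - ln 0) < d -> forall t, 0 <= t <= 1 -> exists2 s,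
        `|s - along F q (c 0)| <= K * (ln t - ln 0) &
        c t = plaque F q s (trans F q (c 0))].
Proof.
have qq := fdom_center F q; have [a1 t1] := fdom_cube qq.
set s0 := along F q q in a1 *; set y0 := trans F q q in t1 *.
have px : dom A q (plaque F q s0 y0) by rewrite fchartK//; exact: dom_center.
have [cb [K' [d1 [cb0 _ d10 BL]]]] := plaque_bilipschitz a1 t1 px.
have [kk [K'' [kk0 _ ME]]] := metric_equiv gR q.
pose G := [set x | dom A q x /\ forall w, kk * `|w| <= tnorm g x (from_components A q x w)].
have Gq : nbhs q G.
  apply: filterS2 (dom_nbhs (dom_center A q)) ME => x qx h; split=> // w.
  by case/andP: (h w).
have [[C Y1] [/= Cs Yy] CY] : nbhs (s0, y0)
    [set z : 'rV[R]_k * 'rV[R]_l | [/\ ball 0 1 z.1, ball 0 1 z.2 & G (plaque F q z.1 z.2)]].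
  have H1 : nbhs (s0, y0) [set z : 'rV[R]_k * 'rV[R]_l | G (plaque F q z.1 z.2)].
    have pc := @plaque_continuous _ _ _ _ _ _ _ _ F q (s0, y0) a1 t1.
    have E : plaque F q s0 y0 = q := fchartK qq.
    have Gq' : nbhs (plaque F q s0 y0) G by rewrite E.
    exact: (cont_nbhs pc Gq').
  have H2 : nbhs (s0, y0) [set z : 'rV[R]_k * 'rV[R]_l | ball 0 1 z.1 /\ ball 0 1 z.2].
    exists (ball 0 1, ball 0 1) => //; split; apply: open_nbhs_nbhs; split => //; exact: ball_open.
  by apply: filterS2 H1 H2 => z h [].
have [d2 d20 dC] := nbhs_ex Cs.
pose D := Num.min d1 d2; have D0 : 0 < D by rewrite lt_min d10.
pose d := D / 2; have d0 : 0 < d by exact: half_gt0.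
have dD : 2 * d = D by rewrite /d mulrC divfK// pnatr_eq0.
(* From plaque coordinates to chart coordinates costs [cb], from there to the metric [kk]. *)
pose K := (cb * kk)^-1; have K0 : 0 < K by rewrite invr_gt0 mulr_gt0.
pose Y := Y1 `&` [set y | forall a b, `|a - s0| < d1 -> `|b - s0| < d1 ->
   cb * `|a - b| <= `|coord A q (plaque F q a y) - coord A q (plaque F q b y)|
      <= K' * `|a - b|].
have inG s y : `|s - s0| < 2 * d -> Y y -> [/\ ball 0 1 s, ball 0 1 y & G (plaque F q s y)].
  move=> sd [Y1y _]; apply: (CY (s, y)); split=> //=; apply: dC.
  by apply: lt_le_trans sd _; rewrite dD ge_min lexx orbT.
exists d, K, Y; split=> //; first exact: filterI.
  by move=> s y sd /(inG _ _ sd)[].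
move=> c ln cl qc0 cd Yc0 Kd.
set y := trans F q (c 0) in Yc0 *; set b0 := along F q (c 0) in cd *.
have c0E : c 0 = plaque F q b0 y by rewrite fchartK.
have lnm a b : a <= b -> ln a <= ln b by exact: arc_mono cl.
(* [Q] confines the curve to the larger ball, where the uniform constants hold; [P] is the sharp
   estimate. By [est], [Q] up to a time gives [P] there, and [P] leaves room for [Q] to persist a
   little longer. *)
pose Q t := exists2 s, `|s - s0| < 2 * d & c t = plaque F q s y.
pose P t := exists2 s, `|s - b0| <= K * (ln t - ln 0) & c t = plaque F q s y.
have PQ t : t <= 1 -> P t -> Q t.
  move=> tl [s sb cE]; exists s => //.
  have h : K * (ln t - ln 0) <= K * (ln 1 - ln 0) by rewrite ler_pM2l// lerD2r lnm.
  by have := ler_distD b0 s s0; lra.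
have Qfd t : Q t -> [/\ fdom F q (c t), trans F q (c t) = y & `|along F q (c t) - s0| < 2 * d].
  move=> [s sd cE]; have [b1 b2 _] := inG s y sd Yc0.
  by rewrite cE (plaqueK F q b1 b2).1 (plaqueK F q b1 b2).2; split=> //; exact: plaque_fdom.
have est u : 0 <= u -> (forall v, 0 <= v <= u -> Q v) -> P u.
  move=> u0 HQ; have [s sd cE] : Q u by apply: HQ; rewrite u0 lexx.
  exists s => //.
  have L : `|coord A q (c u) - coord A q (c 0)| <= kk^-1 * ln u - kk^-1 * ln 0.
    apply: (@sderiv_norm_le R _ (fun t => coord A q (c t)) (fun t => kk^-1 * ln t)) => // t tu.
    have [s' s'd cE'] := HQ t tu; have [_ _ [qct ctG]] := inG s' y s'd Yc0.
    rewrite -cE' in qct ctG.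
    have [v cv lv] := cl.2 t.
    exists (components A q (c t) v), (kk^-1 * tnorm g (c t) v); split.
    - exact: mderiv_chart qct cv.
    - have := sderiv_scale (kk^-1 : R^o) lv; rewrite [_ *: _]mulrC => D'.
      by apply: sderiv_near D' _; apply: nbhsW => z; rewrite [_ *: _]mulrC.
    - rewrite mulrC ler_pdivlMr// mulrC; apply: le_trans (ctG _) _.
      rewrite /from_components /components -/(transition A (c t) q (c t) v).
      rewrite -/(transition A q (c t) (c t) _) transition_comp ?transition_id//; exact: dom_center.
  have Dd1 (z : 'rV[R]_k) : `|z - s0| < 2 * d -> `|z - s0| < d1.
    by move=> h; apply: lt_le_trans h _; rewrite dD ge_min lexx.
  have cd' : `|b0 - s0| < 2 * d by lra.
  have /andP[+ _] := Yc0.2 s b0 (Dd1 _ sd) (Dd1 _ cd').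
  rewrite -cE -c0E => h; rewrite /K invfM.
  rewrite -mulrA mulrC ler_pdivlMr// mulrC; apply: le_trans h _.
  by apply: le_trans L _; rewrite mulrBr.
apply: (@real_ind R P 0 1) => t /andP[t0 t01] IH.
- have [->|tn] := eqVneq t 0; first by exists b0; rewrite ?subrr ?normr0 ?mulr0.
  have tp : 0 < t by rewrite lt_neqAle eq_sym tn.
  have clo : closed ((fun s => plaque F q s y) @` [set s | `|s - b0| <= K * (ln t - ln 0)]).
    apply: image_cball_closed => // s sb.
    have h : K * (ln t - ln 0) <= K * (ln 1 - ln 0) by rewrite ler_pM2l// lerD2r lnm.
    have sd : `|s - s0| < 2 * d by have := ler_distD b0 s s0; lra.
    by have [b1 b2 _] := inG s y sd Yc0; exact: plaque_continuous_along.
  have cM : {for t, continuous (fun t => c t : M)} := lcont_cont (@cl.1 t).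
  have [|s sb sE] := closed_limit clo cM tp; last by exists s.
  move=> u /andP[u0 ut]; have [|s sb cE] := IH u; first by rewrite u0.
  exists s => //=; apply: le_trans sb _; rewrite ler_pM2l// lerD2r; exact: lnm (ltW ut).
- have Pt : P t by apply: IH; rewrite t0 lexx.
  have [fd tr al] := Qfd t (PQ t (ltW t01) Pt).
  have lc : {for t, continuous (c : R -> leaf_space F)} := @cl.1 t.
  have H1 : \forall u \near t, fdom F q (c u) by apply: (cont_nbhs (lcont_cont lc)); exact: fdom_nbhs.
  have H2 := lcont_trans fd lc.
  have H3 : \forall u \near t, `|along F q (c u) - along F q (c t)| <= (2 * d - `|along F q (c t) - s0|) / 2.
    apply: cont_near; last by rewrite half_gt0// subr_gt0.
    apply: (@continuous_comp R M _ (fun t => c t : M) (along F q)); first exact: lcont_cont lc.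
    exact: along_continuous.
  have [e e0 eP] := nbhs_exR (filterI H1 (filterI H2 H3)).
  exists e => // u /andP[tu ute] u1; apply: est; first by lra.
  move=> v /andP[v0 vu]; have [vt|tv] := leP v t.
    by apply: PQ; [lra|apply: IH; rewrite v0].
  have [|h1 [h2 h3]] := eP v; first by rewrite gtr0_norm ?subr_gt0//; lra.
  exists (along F q (c v)); last by rewrite -[in RHS]tr -h2 fchartK.
  by have := ler_distD (along F q (c t)) (along F q (c v)) s0; lra.
Qed.

(** The arc is a straight segment in plaque coordinates, run with [smoothstep]; being constant
    outside [0, 1] it stays in [N] for all times of the line. *)
Lemma leaf_segment x (N : set (leaf_space F)) (e : R) : nbhs (x : leaf_space F) N -> 0 < e ->
  nbhs (x : leaf_space F) [set z : leaf_space F | joined A g leaf_id N x z e].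
Proof.
move=> Nx e0; have xx := fdom_center F x; have [a1 t1] := fdom_cube xx.
set s0 := along F x x in a1 *; set y0 := trans F x x in t1 *.
have px : dom A x (plaque F x s0 y0) by rewrite fchartK//; exact: dom_center.
have [cb [K [d1 [_ K0 d10 BL]]]] := plaque_bilipschitz a1 t1 px.
have [kk [K' [_ K'0 ME]]] := metric_equiv gR x.
pose G := [set z | dom A x z /\ forall w, tnorm g z (from_components A x z w) <= K' * `|w|].
have Gx : nbhs x G.
  apply: filterS2 (dom_nbhs (dom_center A x)) ME => z xz h; split=> // w.
  by case/andP: (h w).
have GN : nbhs (x : leaf_space F) (N `&` (G : set (leaf_space F))).
  apply: nbhsI => //; have idc := @leaf_id_continuous R n r M A k l m F x.
  exact: (@cont_nbhs (leaf_space F) M (fun x => x) x G idc Gx).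
have [d2 d20 D2] := leaf_nbhs_plaque xx GN.
have KK0 : 0 < K * K' by rewrite mulr_gt0.
pose d := Num.min (Num.min d1 d2) (e / (K * K')).
have d0 : 0 < d by rewrite !lt_min d10 d20 divr_gt0.
apply: (@filterS _ _ (nbhs_filter (x : leaf_space F)) _ _ _ (nbhs_plaque_nbhd xx d0)).
move=> z [s1 [s11 sd zE]].
have [mu [mu' [mm mb m0 m1]]] := @smoothstep R.
pose s t := s0 + mu t *: (s1 - s0).
have sB t : `|s t - s0| < d.
  rewrite /s addrC addrA addNr add0r normrZ; apply: le_lt_trans sd.
  have [_ /andP[h0 h1]] := mb t.
  by rewrite (ger0_norm h0) -[leRHS]mul1r ler_wpM2r.
have [sB1 [sB2 sB3]] : (forall t, `|s t - s0| < d1) /\ (forall t, `|s t - s0| < d2) /\ `|s1 - s0| <= e / (K * K').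
  split; [|split] => [t|t|].
  - by apply: lt_le_trans (sB t) _; rewrite !ge_min lexx.
  - by apply: lt_le_trans (sB t) _; rewrite !ge_min lexx orbT.
  - by apply: le_trans (ltW sd) _; rewrite !ge_min lexx orbT.
have s1b t : ball 0 1 (s t) by apply/ball01; have [] := D2 _ (sB2 t).
have sdv t : sderiv s t (mu' t *: (s1 - s0)).
  rewrite -[X in sderiv _ _ X]add0r; apply: sderivD; first exact: sderiv_cst.
  exact: sderiv_scale (mm t).
pose c t : leaf_space F := plaque F x (s t) y0.
have cc : continuous c.
  by move=> t; apply: lcont_plaque; [exact: s1b|exact: t1|exact: sderiv_continuous (sdv t)].
have cG t : G (c t) by have [_ []] := D2 _ (sB2 t).
have cv t := @mderiv_plaque _ _ _ _ A _ _ _ F s y0 t x _ (s1b t) t1 (sdv t).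
have [||ln cl] := @arc_exists R n r M A g gR (leaf_space F) leaf_id c; first exact: cc.
  by move=> t; eexists; exact: cv t.
exists c, ln; split=> //.
- by move=> t; have [_ []] := D2 _ (sB2 t).
- by rewrite /c /s (m0 0 (lexx _)).1 scale0r addr0 fchartK.
- by rewrite /c /s (m1 1 (lexx _)).1 scale1r addrC subrK zE.
- have H : ln 1 - ln 0 <= K * K' * `|s1 - s0| * mu 1 - K * K' * `|s1 - s0| * mu 0.
    apply: (@sderiv_le R ln (fun t => K * K' * `|s1 - s0| * mu t) 0 1 ler01) => t _.
    have [v vv lv] := cl.2 t.
    exists (tnorm g (c t) v), (K * K' * `|s1 - s0| * mu' t); split=> //.
      have := sderiv_scale (K * K' * `|s1 - s0| : R^o) (mm t); rewrite [_ *: _]mulrC => D'.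
      by apply: sderiv_near D' _; apply: nbhsW => u; rewrite [_ *: _]mulrC.
    have [xct ctG] := cG t.
    have wB : `|components A x (c t) v| <= K * `|s1 - s0| * `|mu' t|.
      apply: (sderiv_norm_bound _ (mderiv_chart xct vv) (mm t)); first by rewrite mulr_ge0// ltW.
      apply: nbhsW => u; have /andP[_] := nbhs_singleton BL (s u) (s t) (sB1 u) (sB1 t).
      move=> /le_trans; apply; rewrite -mulrA ler_pM2l// mulrC -normrZ.
      by rewrite /s (_ : s0 + _ - _ = (mu u - mu t) *: (s1 - s0))//; zmod.
    have -> : tnorm g (c t) v = tnorm g (c t) (from_components A x (c t) (components A x (c t) v)).
      rewrite /from_components /components -/(transition A (c t) x (c t) v).
      by rewrite -/(transition A x (c t) (c t) _) transition_comp ?transition_id//; exact: dom_center.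
    apply: le_trans (ctG _) _.
    rewrite -(ger0_norm (mb t).1) (_ : K * K' * _ * _ = K' * (K * `|s1 - s0| * `|mu' t|)); last by ring.
    by rewrite ler_pM2l.
  apply: le_trans H _; rewrite (m1 1 (lexx _)).1 (m0 0 (lexx _)).1 mulr1 mulr0 subr0.
  by rewrite mulrC -ler_pdivlMr.
Qed.

End leaf_lengths.

(** * Separation and completeness of the cover *)

Section cover_lengths.
Context {R : realType} {n r : nat} {M : topologicalType} (A : atlas R n r.+2 M).
Variables (g : M -> 'M[R]_n).
Hypotheses (gR : riemannian_metric A r.+1 g) (hM : hausdorff_space M).
Context {k l m : nat} (F : foliation A k l m.+1).
Context (x0 : M) {U : topologicalType} (p : U -> leaf_space F).
Hypothesis pU : universal_cover R p (leaf F x0).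
Implicit Types (y z w : U).

Let pM : U -> M := p.

Let pc : continuous p. Proof. by case: pU. Qed.

Lemma cover_arc c ln : arc A g pM c ln ->
  arc A g (fun x : leaf_space F => x : M) (fun t => p (c t)) ln.
Proof.
move=> [cc cl]; split=> // t.
by apply: (@continuous_comp R U (leaf_space F) c p); [exact: cc|exact: pc].
Qed.

(** A short segment in the leaf is lifted by a local section of the covering. *)
Lemma joined_near w (N : set U) (e : R) : nbhs w N -> 0 < e ->
  nbhs w [set z | joined A g pM N w z e].
Proof.
move=> Nw e0; have [V [S [h [nV nS hV hS Sw]]]] := cover_section pU w.
have [Vw hw] := hS w Sw; have [hc _] := hV _ Vw.
have nN : nbhs (p w) (V `&` [set y | N (h y)]).
  by apply: nbhsI => //; apply: cont_nbhs hc _; rewrite hw.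
have H := cont_nbhs (@pc w) (leaf_segment gR nN e0).
apply: filterS2 nS H => z Sz [c [ln [cl cN c0 c1 le]]].
exists (fun t => h (c t)), ln; split=> //.
- split.
    move=> t; apply: (@continuous_comp R (leaf_space F) U c h); first exact: cl.1.
    by have [Vc _] := cN t; exact: (hV _ Vc).1.
  move=> t; have [v cv lv] := cl.2 t.
  have E t' : pM (h (c t')) = c t' by have [Vc _] := cN t'; exact: (hV _ Vc).2.
  exists v; last by rewrite E.
  by apply: mderiv_near cv _; apply: nbhsW => t'; rewrite E.
- by move=> t; have [] := cN t.
- by rewrite c0.
- by rewrite c1 (hS z Sz).2.
Qed.

Lemma cover_connected y z : exists L, joined A g pM setT y z L.
Proof.
have [[_ pathc _] pcc _ _] := pU.
have pMc : continuous pM.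
  move=> w; apply: (@continuous_comp U (leaf_space F) M p (fun x => x)); first exact: pc.
  exact: leaf_id_continuous.
have [c [cc c0 c1]] := pathc y z.
have cc' : continuous (c \o clamp 0 1).
  apply: within_retract cc (@clamp_continuous _ _ _) _ => t /=.
  by rewrite in_itv/= clamp_itv.
rewrite -c0 -c1 -[in c 0](@clamp_id R 0 1 0) ?lexx ?ler01// -[in c 1](@clamp_id R 0 1 1) ?lexx ?ler01//.
apply: (@cousin R (fun a b => exists L, joined A g pM setT ((c \o clamp 0 1) a) ((c \o clamp 0 1) b) L) 0 1 _ _ ler01).
- move=> a b b' _ _ _ _ [L1 j1] [L2 j2]; exists (L1 + L2).
  exact: (joined_trans pMc j1 j2).
- move=> t _; have J := joined_near (@filterT _ _ (nbhs_filter ((c \o clamp 0 1) t))) (@ltr01 R).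
  have [d d0 dP] := nbhs_exR (cont_nbhs (@cc' t) J).
  exists d => // a b _ _ _ ad bd; exists (1 + 1).
  exact: (joined_trans pMc (joined_sym (dP a ad)) (dP b bd)).
Qed.

(** By uniqueness of lifts, an arc whose projection stays in an evenly covered set remains in the
    sheet where it starts. *)
Lemma arc_section c ln (V : set (leaf_space F)) (h : leaf_space F -> U) : arc A g pM c ln ->
  (forall y : leaf_space F, V y -> {for y, continuous h} /\ p (h y) = y) ->
  (forall t, 0 <= t <= 1 -> V (p (c t))) -> h (p (c 0)) = c 0 ->
  c 1 = h (p (c 1)).
Proof.
move=> cl hV cV h0.
apply: (@lift_unique R U _ p (leaf F x0) pU c (fun t => h (p (c t))) 0 1 0) => //.
- by move=> t _; exact: cl.1.
- move=> t /cV/hV[hc _].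
  by apply: (@continuous_comp R (leaf_space F) U (fun t => p (c t)) h); [exact: (cover_arc cl).1|exact: hc].
- by move=> t /cV/hV[_ ->].
- by rewrite lexx ler01.
- by rewrite ler01 lexx.
Qed.

(** An arc of length [e] from [y] stays in the plaque of [p y], within [K * e] of it, and in the
    sheet of [y]. Letting [e] tend to 0 gives first [p z = p y], then [z = y]. *)
Lemma joined_eq0 y z : (forall e : R, 0 < e -> joined A g pM setT y z e) -> y = z.
Proof.
move=> yz; pose q : M := p y.
have [d [K [Y [d0 K0 nY _ ctl]]]] := leaf_length_control gR hM F q.
have [V [S [h [nV nS hV hS Sy]]]] := cover_section pU y.
have qq := fdom_center F q.
have [d1 d10 D1] := leaf_nbhs_plaque qq nV.
pose d2 := Num.min d d1; have d20 : 0 < d2 by rewrite lt_min d0.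
have arc_z (e : R) : 0 < e -> K * e < d2 -> exists s, [/\ `|s - along F q q| <= K * e,
    p z = plaque F q s (trans F q q) & z = h (p z)].
  move=> e0 Ke; have [c [ln [cl _ c0 c1 le]]] := yz e e0.
  have := ctl _ _ (cover_arc cl); rewrite c0 subrr normr0 => /(_ qq d0 (nbhs_singleton nY)).
  have lee : K * (ln 1 - ln 0) <= K * e by rewrite ler_pM2l.
  move=> /(_ (le_lt_trans lee (lt_le_trans Ke _))); rewrite /d2 ge_min lexx => /(_ isT) H.
  have sB t : 0 <= t <= 1 -> K * (ln t - ln 0) <= K * e.
    move=> /andP[_ t1]; apply: le_trans lee; rewrite ler_pM2l// lerD2r; exact: arc_mono cl t1.
  have I1 : 0 <= (1 : R) <= 1 by rewrite lexx ler01.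
  have [s sd cE] := H 1 I1.
  exists s; split; [exact: le_trans sd lee|by rewrite -c1|].
  rewrite -c1; apply: (@arc_section c ln V h) => //.
  + move=> t t01; have [s' s'd ->] := H t t01; apply: (D1 s' _).2.
    apply: le_lt_trans s'd (le_lt_trans (sB t t01) (lt_le_trans Ke _)).
    by rewrite /d2 ge_min lexx orbT.
  + by rewrite c0 (hS y Sy).2.
have small (e : R) : 0 < e -> e < d2 -> exists s, [/\ `|s - along F q q| <= e,
    p z = plaque F q s (trans F q q) & z = h (p z)].
  move=> e0 ed; have [||s [s1 s2 s3]] := arc_z (e / K); first by rewrite divr_gt0.
    by rewrite mulrC divfK// gt_eqF.
  by exists s; split=> //; move: s1; rewrite mulrC divfK// gt_eqF.
have d20' := half_gt0 d20.
have [||s [sd pz zh]] := small (d2 / 2) => //; first by lra.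
have [b1 b2] : ball 0 1 s /\ ball 0 1 (trans F q q).
  split; last by case: (fdom_cube qq).
  by apply/ball01; apply: (D1 s _).1; apply: le_lt_trans sd _; apply: lt_le_trans (_ : d2 / 2 < d2) _; [lra|rewrite /d2 ge_min lexx orbT].
have pq : p z = q.
  have sE : along F q (p z) = along F q q.
    apply/subr0_eq/eqP; rewrite -normr_le0; apply/ler_addgt0Pr => e e0; rewrite add0r.
    have e'0 : 0 < Num.min e (d2 / 2) by rewrite lt_min e0.
    have [|s' [s'd pz' _]] := small _ e'0; first by rewrite gt_min; apply/orP; right; lra.
    have [b1' _] : ball 0 1 s' /\ True.
      split=> //; apply/ball01; apply: (D1 s' _).1; apply: le_lt_trans s'd _.
      apply: le_lt_trans (_ : _ <= d2 / 2) _; first by rewrite ge_min lexx orbT.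
      by apply: lt_le_trans (_ : d2 / 2 < d2) _; [lra|rewrite /d2 ge_min lexx orbT].
    rewrite pz' (plaqueK F q b1' b2).1; apply: le_trans s'd _; by rewrite ge_min lexx.
  have := plaqueK F q b1 b2; rewrite -pz sE => -[sE' _].
  by rewrite pz -sE' fchartK.
by rewrite zh pq -(hS y Sy).2.
Qed.

(** The projections accumulate at some [q] of the compact [M]. By the uniform constants of
    [leaf_length_control] the tail lies in one plaque near [q], where its coordinates converge, and
    an evenly covered neighbourhood of the limit lifts the convergence. *)
Lemma joined_complete (u : nat -> U) : compact [set: M] ->
  (forall e : R, 0 < e -> exists N, forall i j, (N <= i)%N -> (N <= j)%N ->
    joined A g pM setT (u i) (u j) e) ->
  exists w, forall O, nbhs w O -> exists N, forall i, (N <= i)%N -> O (u i).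
Proof.
move=> cM uC.
have [q [_ clq]] := cM (fmap (fun i => p (u i) : M) \oo) _ (@filterT _ _ _).
have [d [K [Y [d0 K0 nY YB ctl]]]] := leaf_length_control gR hM F q.
have qq := fdom_center F q.
pose N2 := fdom F q `&` ([set x | `|along F q x - along F q q| <= d / 2] `&` [set x | Y (trans F q x)]).
have N2q : nbhs q N2.
  apply: filterI; first exact: fdom_nbhs.
  apply: filterI; first by apply: cont_near (along_continuous qq) (half_gt0 d0).
  exact: (cont_nbhs (trans_continuous qq)).
pose e0 := d / 4 / K; have e00 : 0 < e0 by rewrite !divr_gt0.
have Ke0 : K * e0 = d / 4 by rewrite /e0 mulrC divfK// gt_eqF.
have [N0 N0P] := uC e0 e00.
have [i0 [iN [qi0 [ai0 Yi0]]]] : exists i, (N0 <= i)%N /\ N2 (p (u i)).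
  have H : (fmap (fun i => p (u i) : M) \oo) [set p (u i) | i in [set i | (N0 <= i)%N]].
    by exists N0 => // i /= Ni; exists i.
  by have [x [[i Ni <-] xN2]] := clq _ _ H N2q; exists i.
(* The tail lies in the plaque of [u i0], which need not be that of [q]: the leaf may pass near [q]
   infinitely often. *)
set y := trans F q (p (u i0)) in Yi0.
set a := along F q q in ai0 *.
have pl j : (N0 <= j)%N -> exists2 s, `|s - a| <= d / 2 + d / 4 & p (u j) = plaque F q s y.
  move=> Nj; have [c [ln [cl _ c0 c1 le]]] := N0P i0 j iN Nj.
  have := ctl _ _ (cover_arc cl); rewrite c0 => /(_ qi0 (le_lt_trans ai0 _) Yi0).
  move=> /(_ _); have h1 : d / 2 < d by lra.
  move=> /(_ h1); have h2 : K * (ln 1 - ln 0) <= d / 4 by rewrite -Ke0 ler_pM2l.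
  move=> /(_ (le_lt_trans h2 _)); have h3 : d / 4 < d by lra.
  move=> /(_ h3 1); rewrite lexx ler01 => /(_ isT)[s sd]; rewrite c1 => cE.
  exists s => //; have := ler_distD (along F q (p (u i0))) s a; move: sd; rewrite /= in ai0; lra.
have plB s : `|s - a| <= d / 2 + d / 4 -> ball 0 1 s /\ ball 0 1 y.
  by move=> sa; apply: YB => //; apply: le_lt_trans sa _; lra.
pose s j := along F q (p (u j)).
have sP j : (N0 <= j)%N -> [/\ `|s j - a| <= d / 2 + d / 4, p (u j) = plaque F q (s j) y,
    fdom F q (p (u j)) & trans F q (p (u j)) = y].
  move=> /pl[s' s'a E]; have [b1 b2] := plB s' s'a.
  by rewrite /s E (plaqueK F q b1 b2).1 (plaqueK F q b1 b2).2; split=> //; exact: plaque_fdom.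
have ctl' j c ln (e : R) : (N0 <= j)%N -> arc A g pM c ln -> c 0 = u j -> ln 1 - ln 0 <= e -> K * e < d ->
    forall t, 0 <= t <= 1 -> exists2 s', `|s' - s j| <= K * e & p (c t) = plaque F q s' y.
  move=> Nj cl c0 le Ke t t01; have [sa pE fd tr] := sP j Nj.
  have := ctl _ _ (cover_arc cl); rewrite c0 tr => /(_ fd (le_lt_trans sa _) Yi0).
  move=> /(_ _); have h1 : d / 2 + d / 4 < d by lra.
  move=> /(_ h1); have h2 : K * (ln 1 - ln 0) <= K * e by rewrite ler_pM2l.
  move=> /(_ (le_lt_trans h2 Ke) t t01)[s' s'd E]; exists s' => //.
  apply: le_trans s'd (le_trans _ h2); rewrite ler_pM2l// lerD2r.
  by case/andP: t01 => _; exact: arc_mono cl.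
have sC (e : R) : 0 < e -> exists2 N, (N0 <= N)%N & forall i j, (N <= i)%N -> (N <= j)%N -> `|s j - s i| <= e.
  move=> e1; pose e' := Num.min (e / K) (d / 2 / K).
  have e'0 : 0 < e' by rewrite lt_min !divr_gt0.
  have Ke' : K * e' <= e by rewrite mulrC -ler_pdivlMr// ge_min lexx.
  have Ke'd : K * e' < d.
    by apply: le_lt_trans (_ : K * e' <= d / 2) _; [rewrite mulrC -ler_pdivlMr// ge_min lexx orbT|lra].
  have [N NP] := uC e' e'0; exists (maxn N0 N) => [|i j]; first exact: leq_maxl.
  rewrite !geq_max => /andP[i1 i2] /andP[j1 j2].
  have [c [ln [cl _ c0 c1 le]]] := NP i j i2 j2.
  have [|s' s'd] := ctl' i c ln e' i1 cl c0 le Ke'd 1; first by rewrite lexx ler01.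
  rewrite c1 => E; have [sja pE _ _] := sP j j1; have [sia _ _ _] := sP i i1.
  suff -> : s j = s' by apply: le_trans s'd Ke'.
  have b1 : ball 0 1 s'.
    have [b1 _] : ball 0 1 s' /\ ball 0 1 y.
      apply: YB => //; have := ler_distD (s i) s' a.
      have : K * e' <= d / 2 by rewrite mulrC -ler_pdivlMr// ge_min lexx orbT.
      by move: sia s'd; lra.
    exact: b1.
  have [_ b2] := plB _ sja.
  by rewrite /s E (plaqueK F q b1 b2).1.
have Hc : (fmap s \oo) [set s | `|s - a| <= d / 2 + d / 4].
  by exists N0 => // i /= /sP[].
have [s1 [s1a cls]] := @compact_cball _ _ a (d / 2 + d / 4) (fmap s \oo) _ Hc.
have sconv (e : R) : 0 < e -> exists2 N, (N0 <= N)%N & forall j, (N <= j)%N -> `|s j - s1| <= e.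
  move=> e1; have [N NN NP] := sC _ (half_gt0 e1); exists N => // j Nj.
  have H1 : (fmap s \oo) [set s i | i in [set i | (N <= i)%N]].
    by exists N => // i /= Ni; exists i.
  have H2 := near_dist s1 (half_gt0 e1).
  have [_ [[i Ni <-] /= si]] := cls _ _ H1 H2.
  by have := ler_distD (s i) (s j) s1; have := NP i j Ni Nj; lra.
have [b1 b2] := plB _ s1a.
pose q1 : M := plaque F q s1 y.
have [al1 tr1] := plaqueK F q b1 b2.
have fd1 : fdom F q q1 by exact: plaque_fdom.
have Lq1 : leaf F x0 q1.
  have Lu : leaf F x0 (p (u i0)) by have [_ _ <- _] := pU; exists (u i0).
  by apply: (leaf_step Lu qi0 fd1); rewrite tr1.
have [V [oV Vq1 VH]] := cover_sheets pU Lq1.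
have nV : nbhs (q1 : leaf_space F) V by exact: open_nbhs_nbhs.
have [d3 d30 D3] := leaf_nbhs_plaque fd1 nV; rewrite al1 tr1 in D3.
have d340 : 0 < d3 / 4 by rewrite divr_gt0.
(* Arcs of length [e1] from [u j1], itself within [d3 / 4] of the limit, project into the evenly
   covered [V], so the whole tail lies in one sheet. *)
pose e1 := Num.min (d / 2 / K) (d3 / 4 / K).
have e10 : 0 < e1 by rewrite lt_min !divr_gt0.
have Ke1 : K * e1 <= d3 / 4 by rewrite mulrC -ler_pdivlMr// ge_min lexx orbT.
have Ke1d : K * e1 < d.
  by apply: le_lt_trans (_ : K * e1 <= d / 2) _; [rewrite mulrC -ler_pdivlMr// ge_min lexx|lra].
have [N1 N1P] := uC e1 e10; have [N3 N30 N3P] := sconv _ d340.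
pose j1 := maxn N1 N3.
have j11 : (N1 <= j1)%N by exact: leq_maxl.
have j13 : (N3 <= j1)%N by exact: leq_maxr.
have j10 : (N0 <= j1)%N by exact: leq_trans j13.
have inV s' : `|s' - s j1| <= K * e1 -> V (plaque F q s' y).
  move=> s'd; apply: (D3 s' _).2; have := ler_distD (s j1) s' s1; have := N3P j1 j13; lra.
have Vj1 : V (p (u j1)).
  by have [_ -> _ _] := sP j1 j10; apply: inV; rewrite subrr normr0 mulr_ge0// ltW.
have [S [h [_ Sj1 hV hS _]]] := VH (u j1) Vj1.
have hV' (z : leaf_space F) : V z -> {for z, continuous h} /\ p (h z) = z by move=> /hV[].
have uE j : (j1 <= j)%N -> u j = h (p (u j)).
  move=> jj; have [c [ln [cl _ c0 c1 le]]] := N1P j1 j j11 (leq_trans j11 jj).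
  rewrite -c1; apply: (arc_section cl hV').
    move=> t t01; have [s' s'd ->] := ctl' j1 c ln e1 j10 cl c0 le Ke1d t t01.
    exact: inV.
  by rewrite c0; exact: hS.
exists (h q1) => O nO.
have [hc _] := hV' _ Vq1.
have nO' := cont_nbhs hc nO.
have [d4 d40 D4] := leaf_nbhs_plaque fd1 nO'; rewrite al1 tr1 in D4.
have [N4 N40 N4P] := sconv _ (half_gt0 d40).
exists (maxn j1 N4) => j; rewrite geq_max => /andP[jj1 jN4].
rewrite (uE j jj1); have [_ -> _ _] := sP j (leq_trans N40 jN4).
by apply: (D4 _ _).2; have := N4P j jN4; lra.
Qed.

End cover_lengths.

Lemma sderiv_expR {R : realType} (c : R -> R) (t v : R) :
  sderiv c t v -> sderiv (fun s => expR (c s)) t (expR (c t) * v).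
Proof.
move=> cv; rewrite mulrC.
have e1 : sderiv (@expR R) (c t) (expR (c t)).
  by apply: is_derive_sderiv; [apply: nbhsW => s; exact: is_derive_expR|exact: continuous_expR].
exact: (@sderiv_comp R R^o R^o c (@expR R) t v _ cv (proj1 (sderiv_sdiff _ _ _) e1)).
Qed.

Lemma sderivN {R : realType} (W : normedModType R) (c : R -> W) (t : R) (v : W) :
  sderiv c t v -> sderiv (fun s => - c s) t (- v).
Proof.
move=> cv e e0; have [d d0 D] := cv e e0; exists d => // a b ad bd.
by rewrite -normrN; have := D a b ad bd; congr (`|_| <= _); zmod.
Qed.

(** * Level sets of the height *)

Section levels.
Context {R : realType} {n r : nat} {M : topologicalType} (A : atlas R n r.+2 M).
Variables (g : M -> 'M[R]_n) (f : R -> M -> M) (X : M -> 'rV[R]_n).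
Hypotheses (gR : riemannian_metric A r.+1 g) (hf : flow_of_class A r.+1 f X)
  (hM : hausdorff_space M) (cM : compact [set: M]).
Hypothesis X1 : forall x, tnorm g x (X x) = 1.
Context {k l : nat} (Wcu : foliation A k.+1 l r.+1) (Wu : foliation A k l.+1 1).
Variables (Eu : M -> set 'rV[R]_n) (Cu au Au : R).
Hypotheses (Cu1 : 1 <= Cu) (au0 : 0 < au) (auAu : au <= Au).
Hypothesis EuS : forall x, subspace_pred (Eu x).
Hypothesis cuE : forall x,
  tangent_space Wcu x = [set u + v | u in Eu x & v in line (X x)].
Hypothesis uX : forall x u v, Eu x u -> line (X x) v -> inner g x u v = 0.
Hypothesis Eu_inv : forall t x, tangent_map A (f t) x @` Eu x = Eu (f t x).
Hypothesis Eu_exp : forall t x v, 0 <= t -> Eu x v ->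
  Cu^-1 * expR (au * t) * tnorm g x v
    <= tnorm g (f t x) (tangent_map A (f t) x v)
    <= Cu * expR (Au * t) * tnorm g x v.
Variable H : M -> M -> R.
Hypothesis HP : forall q,
  [/\ H q q = 0,
      nbhs (q : leaf_space Wcu) [set z : leaf_space Wcu |
        nbhs (z : leaf_space Wcu) [set z' : leaf_space Wcu | H q z' - H q z = H z z']],
      forall (c : R -> M) t u b, {for t, continuous (c : R -> leaf_space Wcu)} ->
        c t = q -> Eu q u -> mderiv A c t (u + b *: X q) ->
        sderiv (fun t => H q (c t)) t b &
      nbhs (q : leaf_space Wcu) [set z : leaf_space Wcu |
        (H q z = 0 <-> trans Wu q z = trans Wu q q)]].
Context (x0 : M) {U : topologicalType} (p : U -> leaf_space Wcu).
Hypothesis pU : universal_cover R p (leaf Wcu x0).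
Implicit Types (y z w : U) (c : R -> U) (t h L : R).

Let pM : U -> M := p.

Let pc : continuous p. Proof. by case: pU. Qed.

Let Cu0 : 0 < Cu. Proof. exact: lt_le_trans Cu1. Qed.

Lemma cover_map_continuous : continuous pM.
Proof.
move=> w; apply: (@continuous_comp U (leaf_space Wcu) M p (fun x => x)); first exact: pc.
exact: leaf_id_continuous.
Qed.

Lemma Eu_growth t x v : Eu x v ->
  tnorm g (f t x) (tangent_map A (f t) x v) <=
    Cu * expR ((if 0 <= t then Au else au) * t) * tnorm g x v.
Proof.
move=> Ev; have [t0|t0] := leP 0 t; first by have /andP[] := Eu_exp t0 Ev.
(* For negative [t], expansion from [f t x] forward to [x] is contraction at the rate [au]. *)
have Ev' : Eu (f t x) (tangent_map A (f t) x v) by rewrite -Eu_inv; exists v.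
have nt : 0 <= - t by rewrite oppr_ge0 ltW.
have /andP[+ _] := Eu_exp nt Ev'.
rewrite (tangent_map_flow hf) -(flowD hf) addNr (flow0 hf) (tangent_map_flow0 hf).
by rewrite mulrN expRN -invfM ler_pdivrMl ?mulr_gt0 ?expR_gt0.
Qed.

Lemma height_global : exists B : U -> R, forall w,
  nbhs w [set z | B z - B w = H (p w) (p z)].
Proof.
have sc : simply_connected R U by case: pU.
apply: (primitive_global (K := fun w z => H (p w) (p z))) => //.
- by move=> w; case: (HP (p w)).
- move=> w; have [_ H2 _ _] := HP (p w).
  have G := cont_nbhs (@pc w) H2; apply: filterS G => z Hz.
  exact: (cont_nbhs (@pc z) Hz).
- move=> w N Nw; have J := joined_near gR pU Nw (@ltr01 R).
  apply: filterS J => z [c [ln [[cc _] cN c0 c1 _]]].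
  by exists c; split.
Qed.

Variable B : U -> R.
Hypothesis BH : forall w, nbhs w [set z | B z - B w = H (p w) (p z)].

Lemma height_deriv c t u b : {for t, continuous c} -> Eu (p (c t)) u ->
  mderiv A (fun t => p (c t)) t (u + b *: X (p (c t))) -> sderiv (fun t => B (c t)) t b.
Proof.
move=> cc Eut cv; have [_ _ H3 _] := HP (p (c t)).
have lc : {for t, continuous ((fun t => p (c t)) : R -> leaf_space Wcu)}.
  by apply: (@continuous_comp R U (leaf_space Wcu) c p); [exact: cc|exact: pc].
have D := H3 (fun t => p (c t)) t u b lc erefl Eut cv.
have D' := sderivD (sderiv_cst (B (c t) : R^o) t) D; rewrite add0r in D'.
apply: sderiv_near D' _; have := cont_nbhs cc (BH (c t)).
by apply: filterS => s /= <-; rewrite addrC subrK.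
Qed.

(** The velocity is decomposed along [Eu] and [X]; by orthogonality each part is bounded by the
    speed, and the part along [X] is the derivative of the height. *)
Lemma arc_split c ln t : arc A g pM c ln -> exists u b s,
  [/\ Eu (p (c t)) u, mderiv A (fun t => p (c t)) t (u + b *: X (p (c t))),
      sderiv (fun t => B (c t)) t b, sderiv ln t s &
      tnorm g (p (c t)) u <= s /\ `|b| <= s].
Proof.
move=> cl; have [v cv lv] := cl.2 t.
have [lc' _] := cover_arc pU cl.
have lc : {for t, continuous ((fun t => p (c t)) : R -> leaf_space Wcu)} := @lc' t.
have : tangent_space Wcu (p (c t)) v := tangent_spaceP lc cv.
rewrite cuE => -[u Eut [w [b _ bX] uw]].
have vE : v = u + b *: X (p (c t)) by rewrite bX.
exists u, b, (tnorm g (pM (c t)) v); split=> //.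
- by rewrite -vE.
- by apply: height_deriv Eut _; [exact: cl.1|rewrite -vE].
have o : inner g (p (c t)) u (b *: X (p (c t))) = 0 by apply: uX => //; exists b.
have E := tnorm_orth gR o; rewrite -vE in E.
have n0 := tnorm_ge0 g (p (c t)).
split; rewrite -ler_sqr ?nnegrE ?n0 ?normr_ge0// E.
  by rewrite lerDl sqr_ge0.
by rewrite tnormZ X1 mulr1 lerDr sqr_ge0.
Qed.

Lemma arc_height c ln a b : arc A g pM c ln -> a <= b ->
  `|B (c b) - B (c a)| <= ln b - ln a.
Proof.
move=> cl ab; apply: (@sderiv_norm_le R R^o (fun t => B (c t)) ln) => // t _.
have [u [v [s [_ _ Bd ld [_ vs]]]]] := arc_split t cl.
by exists v, s.
Qed.

Lemma joined_height (P : set U) y z L : joined A g pM P y z L -> `|B z - B y| <= L.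
Proof.
move=> [c [ln [cl _ <- <- le]]]; apply: le_trans le; exact: arc_height ler01.
Qed.

Lemma height_continuous : continuous B.
Proof.
move=> w; apply: contN => e e0.
have := joined_near gR pU (@filterT _ _ (nbhs_filter w)) e0.
by apply: filterS => z /joined_height.
Qed.

Variable phi : R -> U -> U.
Hypothesis Fphi : flow_lift pM f phi.

Let FX : forall x, tangent_space Wcu x (X x).
Proof.
move=> x; rewrite cuE; exists 0; first by case: (EuS x).
by exists (X x); rewrite ?add0r//; exists 1; rewrite ?scale1r.
Qed.

Let lfc := leaf_flow_continuous hf hM FX.

Let lfl (t : R) (y : leaf_space Wcu) : leaf Wcu x0 y -> leaf Wcu x0 (f t y) :=
  @leaf_flow R n r M A f X hf hM k.+1 l r Wcu FX x0 y t.

Lemma phiD s t w : phi (s + t) w = phi s (phi t w).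
Proof. exact: (@flow_liftD R U (leaf_space Wcu) p (leaf Wcu x0) pU (f : R -> leaf_space Wcu -> leaf_space Wcu) (flowD hf) phi Fphi). Qed.

Lemma phi0 w : phi 0 w = w. Proof. by case: Fphi. Qed.

Lemma phi_continuous : continuous (fun z : R * U => phi z.1 z.2).
Proof. exact: (@flow_lift_continuous R U (leaf_space Wcu) p (leaf Wcu x0) pU (f : R -> leaf_space Wcu -> leaf_space Wcu) (flow0 hf) (flowD hf) lfc phi Fphi). Qed.

Lemma phi_arc w : arc A g pM (fun t => phi t w) id.
Proof.
have [phic _ phiE] := Fphi; split; first exact: phic.
move=> t; exists (X (f t (p w))).
  by apply: mderiv_near (mderiv_orbit hf hM t (p w)) _; apply: nbhsW => s; rewrite phiE.
by rewrite phiE X1; exact: sderiv_id.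
Qed.

Lemma phi_height t w : B (phi t w) = B w + t.
Proof.
have [phic _ phiE] := Fphi.
have D s : sderiv (fun t => B (phi t w)) s 1.
  apply: (@height_deriv (fun t => phi t w) s 0 1); first exact: phic.
    by case: (EuS (p (phi s w))).
  rewrite add0r scale1r; have E : p (phi s w) = f s (p w) by exact: phiE.
  rewrite E; apply: mderiv_near (mderiv_orbit hf hM s (p w)) _; apply: nbhsW => s'; exact/esym/phiE.
have E a b : a <= b -> B (phi b w) - B (phi a w) = b - a.
  move=> ab; apply: (@sderiv_eq R (fun t => B (phi t w)) id) => // s _.
  by exists 1; [exact: D|exact: sderiv_id].
have [t0|/ltW t0] := leP 0 t; have := E _ _ t0; rewrite phi0; lra.
Qed.

Lemma phi_joined s t w : joined A g pM setT (phi s w) (phi t w) `|s - t|.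
Proof.
have H1 a b : a <= b -> joined A g pM setT (phi a w) (phi b w) (b - a).
  by move=> ab; exact: (arc_joined (phi_arc w) (fun=> I) ab).
have [st|/ltW ts] := leP s t; first by rewrite distrC ger0_norm ?subr_ge0//; exact: H1.
by rewrite ger0_norm ?subr_ge0//; apply: joined_sym; exact: H1.
Qed.

(* The part of the velocity along X is cancelled by the change of time. *)
Lemma arc_project c ln h : arc A g pM c ln -> exists ln',
  arc A g pM (fun t => phi (h - B (c t)) (c t)) ln' /\
  forall t, exists s s', [/\ sderiv ln t s, sderiv ln' t s', 0 <= s &
    s' <= Cu * expR ((if B (c t) <= h then Au else au) * (h - B (c t))) * s].
Proof.
move=> cl; have [phic _ phiE] := Fphi.
have [v vP] : exists v : R -> 'rV[R]_n * R, forall t, exists2 s,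
    mderiv A (fun t => p (phi (h - B (c t)) (c t))) t (v t).1 &
    [/\ sderiv ln t s, (v t).2 = s, 0 <= s & tnorm g (p (phi (h - B (c t)) (c t))) (v t).1 <=
    Cu * expR ((if B (c t) <= h then Au else au) * (h - B (c t))) * s].
  suff /choice[v vP] : forall t, exists v : 'rV[R]_n * R, exists2 s,
    mderiv A (fun t => p (phi (h - B (c t)) (c t))) t v.1 &
    [/\ sderiv ln t s, v.2 = s, 0 <= s & tnorm g (p (phi (h - B (c t)) (c t))) v.1 <=
    Cu * expR ((if B (c t) <= h then Au else au) * (h - B (c t))) * s] by exists v.
  move=> t; have [u [b [s [Eut cv Bd ld [us _]]]]] := arc_split t cl.
  set th := h - B (c t).
  have thd : sderiv (fun t => h - B (c t)) t (- b).
    rewrite -[- b]add0r; apply: (@sderivD R R^o); first exact: sderiv_cst.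
    exact: (@sderivN R R^o).
  have E s' : p (phi (h - B (c s')) (c s')) = f (h - B (c s')) (p (c s')) by exact: phiE.
  have s0 : 0 <= s by apply: le_trans us; exact: tnorm_ge0.
  exists (tangent_map A (f th) (p (c t)) u, s), s => /=.
    have D := mderiv_flow hf hM thd cv.
    have vE : tangent_map A (f th) (p (c t)) (u + b *: X (p (c t))) + - b *: X (f th (p (c t))) =
        tangent_map A (f th) (p (c t)) u.
      rewrite addrC [u + _]addrC (tangent_map_lin (flow_Ck hf th)) (tangent_map_field hf hM).
      by rewrite scaleNr addKr.
    rewrite vE in D; apply: mderiv_near D _; apply: nbhsW => s'; exact/esym/E.
  split=> //; rewrite E -/th; apply: le_trans (Eu_growth th Eut) _.
  rewrite {1}/th subr_ge0 ler_wpM2l// mulr_ge0 ?expR_ge0//; exact: ltW.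
have cc : continuous (fun t => phi (h - B (c t)) (c t)).
  move=> t; have Bc : {for t, continuous (fun t => h - B (c t))}.
    apply: (@continuousB R R^o); first exact: cst_continuous.
    by apply: (@continuous_comp R U R c B); [exact: cl.1|exact: height_continuous].
  have cp := continuous_pair Bc (@cl.1 t).
  have fc : {for (h - B (c t), c t), continuous (fun z : R * U => phi z.1 z.2)} := @phi_continuous (h - B (c t), c t).
  exact: (@continuous_comp R (R * U)%type U _ _ t cp fc).
have [|ln' cl'] := @arc_exists R n r M A g gR U pM _ cc.
  by move=> t; have [s mv _] := vP t; exists (v t).1.
exists ln'; split=> // t; have [s mv [ls vs s0 le]] := vP t; have [v' mv' lv'] := cl'.2 t.
exists s, (tnorm g (pM (phi (h - B (c t)) (c t))) v'); split=> //.
by rewrite (mderiv_unique mv' mv).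
Qed.

Definition level_joined h y z L := joined A g pM [set w | B w = h] y z L.

Lemma project_level h c t : B (phi (h - B (c t)) (c t)) = h.
Proof. by rewrite phi_height addrC subrK. Qed.

Lemma sderiv_scaled (a : R) (F : R -> R) t s : sderiv F t s -> sderiv (fun t => a * F t) t (a * s).
Proof.
move=> Fs; have D := sderiv_scale (a : R^o) Fs; rewrite [_ *: _]mulrC in D.
by apply: sderiv_near D _; apply: nbhsW => u; rewrite [_ *: _]mulrC.
Qed.

Lemma level_flow h t y z L : level_joined h y z L -> level_joined (h + t) (phi t y) (phi t z)
  (Cu * expR ((if 0 <= t then Au else au) * t) * L).
Proof.
move=> [c [ln [cl cP c0 c1 le]]].
have [ln' [cl' lP]] := arc_project (h + t) cl.
have E s : h + t - B (c s) = t by rewrite cP addrAC subrr add0r.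
exists (fun s => phi (h + t - B (c s)) (c s)), ln'; split=> //.
- by move=> s; exact: (project_level (h + t) c s).
- by rewrite E c0.
- by rewrite E c1.
set C := Cu * _; have C0 : 0 <= C by rewrite mulr_ge0 ?expR_ge0// ltW.
apply: (@le_trans _ _ (C * ln 1 - C * ln 0)); last by rewrite -mulrBr ler_wpM2l.
apply: (@sderiv_le R ln' (fun s => C * ln s) 0 1 ler01) => s _.
have [v [v' [lv lv' _]]] := lP s; rewrite E cP lerDl => vv.
by exists v', (C * v); split=> //; exact: sderiv_scaled.
Qed.

(** A crude bound valid at every level. It supplies some curve inside the level and shows that short
    arcs project to short ones. *)
Lemma joined_project h y z L : joined A g pM setT y z L ->
  level_joined h (phi (h - B y) y) (phi (h - B z) z) (Cu * expR (Au * (`|h - B y| + L)) * L).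
Proof.
move=> [c [ln [cl _ c0 c1 le]]].
have [ln' [cl' lP]] := arc_project h cl.
exists (fun s => phi (h - B (c s)) (c s)), ln'; split=> //.
- by move=> s; exact: project_level.
- by rewrite c0.
- by rewrite c1.
set C := Cu * _; have C0 : 0 <= C by rewrite mulr_ge0 ?expR_ge0// ltW.
apply: (@le_trans _ _ (C * ln 1 - C * ln 0)); last by rewrite -mulrBr ler_wpM2l.
apply: (@sderiv_le R ln' (fun s => C * ln s) 0 1 ler01) => s /andP[s0 s1].
have [v [v' [lv lv' v0 vv]]] := lP s.
exists v', (C * v); split=> //; first exact: sderiv_scaled.
apply: le_trans vv _; rewrite ler_wpM2r// /C ler_wpM2l ?(ltW Cu0)// ler_expR.
have := arc_height cl s0; rewrite c0 => hb.
have := arc_mono cl s1 => lm.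
have Au0 : 0 < Au by exact: lt_le_trans auAu.
have lb : `|h - B (c s)| <= `|h - B y| + L by have := ler_distD (B y) h (B (c s)); rewrite (distrC (B y)); lra.
have [hB|hB] := leP (B (c s)) h.
  by rewrite ler_pM2l//; apply: le_trans lb; exact: ler_norm.
apply: (@le_trans _ _ 0); first by rewrite mulr_ge0_le0// ?ltW//; lra.
by rewrite mulr_ge0 ?(ltW Au0)//; apply: le_trans lb.
Qed.

(** After an arc length a the height is at least [B y - a], so the projected speed is at most Cu exp
    (au (h - B y + a)) times the speed. Its integral [G] is the origin of the factor [Cu / au]. *)
Lemma joined_project_down h y w L : joined A g pM setT y w L -> h <= B y - L ->
  level_joined h (phi (h - B y) y) (phi (h - B w) w) (Cu / au * expR (- (au * (B y - L - h)))).
Proof.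
move=> [c [ln [cl _ c0 c1 le]]] hL.
have [ln' [cl' lP]] := arc_project h cl.
exists (fun s => phi (h - B (c s)) (c s)), ln'; split=> //.
- by move=> s; exact: project_level.
- by rewrite c0.
- by rewrite c1.
pose G s := Cu / au * expR (au * (h - B y + (ln s - ln 0))).
have Ca : 0 <= Cu / au by rewrite divr_ge0 ?ltW.
apply: (@le_trans _ _ (G 1 - G 0)).
  apply: (@sderiv_le R ln' G 0 1 ler01) => s /andP[s0 s1].
  have [v [v' [lv lv' v0 vv]]] := lP s.
  exists v', (Cu / au * (expR (au * (h - B y + (ln s - ln 0))) * (au * v))); split=> //.
    apply: sderiv_scaled; apply: sderiv_expR; apply: sderiv_scaled.
    rewrite -[v]add0r; apply: (@sderivD R R^o); first exact: sderiv_cst.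
    by rewrite -[v]addr0; apply: (@sderivD R R^o _ _ _ _ _ lv); exact: sderiv_cst.
  apply: le_trans vv _.
  have -> : Cu / au * (expR (au * (h - B y + (ln s - ln 0))) * (au * v)) =
      Cu * expR (au * (h - B y + (ln s - ln 0))) * v by field; rewrite gt_eqF.
  rewrite ler_wpM2r// ler_wpM2l ?(ltW Cu0)// ler_expR.
  have := arc_height cl s0; rewrite c0 ler_norml => /andP[hb _].
  have lm := arc_mono cl s1.
  (* The curve never goes below the level [h], so the other rate can only occur with exponent 0. *)
  have [hB|hB] := leP (B (c s)) h; last by rewrite ler_pM2l//; lra.
  have -> : h - B (c s) = 0 by lra.
  by rewrite mulr0 mulr_ge0 ?(ltW au0)//; lra.
rewrite /G subrr; apply: le_trans (_ : Cu / au * expR (au * (h - B y + (ln 1 - ln 0))) <= _).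
  by rewrite gerBl mulr_ge0 ?expR_ge0.
by rewrite ler_wpM2l// ler_expR -mulrN ler_pM2l//; lra.
Qed.

Lemma joined_cut (P : set U) y z L a : joined A g pM P y z L -> 0 <= a <= L ->
  exists w, joined A g pM P y w a /\ joined A g pM P w z (L - a).
Proof.
move=> [c [ln [cl cP c0 c1 le]]] /andP[a0 aL].
have [la|al] := leP (ln 1 - ln 0) a.
  exists z; split; first by exists c, ln; split.
  have Pz : P z by rewrite -c1.
  have J := @joined_refl R n r M A g U pM P z Pz.
  by apply: joined_le J; rewrite subr_ge0.
have lc : {within `[0, 1], continuous ln}.
  apply: continuous_subspaceT => t; have [v _ lv] := cl.2 t; exact: sderiv_continuous lv.
have [t + tE] : exists2 t, t \in `[0, 1] & ln t = ln 0 + a.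
  apply: IVT => //; have m := arc_mono cl (@ler01 R).
  rewrite ge_min le_max; apply/andP; split; apply/orP; [left|right]; lra.
rewrite in_itv/= => /andP[t0 t1].
exists (c t); split.
  by have := arc_joined cl cP t0; rewrite c0 tE addrAC subrr add0r.
have := arc_joined cl cP t1; rewrite c1; apply: joined_le; rewrite tE; lra.
Qed.

Lemma projection_bound h y z L : joined A g pM setT y z L -> L <= B y + B z - 2 * h ->
  level_joined h (phi (h - B y) y) (phi (h - B z) z)
    (2 * Cu / au * expR (- (au * ((B y + B z - 2 * h - L) / 2)))).
Proof.
move=> yz Lh; have := joined_height yz; rewrite ler_norml => /andP[h1 h2].
(* The cut is placed where the lower bounds for the height, lost at unit rate from [y] and from [z],
   agree; both halves then stay above [(B y + B z - L) / 2]. *)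
have [|w [yw wz]] := joined_cut yz (a := (B y - B z + L) / 2).
  by apply/andP; split; lra.
have J1 := joined_project_down (h := h) yw _.
have J2 := joined_project_down (h := h) (joined_sym wz) _.
have E1 : B y - (B y - B z + L) / 2 - h = (B y + B z - 2 * h - L) / 2 by lra.
have E2 : B z - (L - (B y - B z + L) / 2) - h = (B y + B z - 2 * h - L) / 2 by lra.
rewrite E1 in J1; rewrite E2 in J2.
have {}J1 := J1 ltac:(lra); have {}J2 := J2 ltac:(lra).
have := joined_trans cover_map_continuous J1 (joined_sym J2).
apply: joined_le; rewrite -mulrDl -mulrDl; have -> : Cu + Cu = 2 * Cu by ring.
by [].
Qed.

(** The limit exists in the cover; projecting short arcs to the level turns convergence there into
    convergence inside the level. Capping [e'] by 1 keeps their expansion factor below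
    [Cu * expR Au]. *)
Lemma level_complete (u : nat -> U) h : (forall i, B (u i) = h) ->
  (forall e : R, 0 < e -> exists N, forall i j, (N <= i)%N -> (N <= j)%N ->
    level_joined h (u i) (u j) e) ->
  exists w, B w = h /\ forall e : R, 0 < e -> exists N, forall i, (N <= i)%N ->
    level_joined h (u i) w e.
Proof.
move=> uh uC.
have [|w wP] := joined_complete gR hM pU cM (u := u).
  by move=> e /uC[N NP]; exists N => i j Ni Nj; apply: joined_sub (NP i j Ni Nj).
have near_w (e : R) : 0 < e -> exists N, forall i, (N <= i)%N -> joined A g pM setT (u i) w e.
  move=> e0; have [N NP] := wP _ (joined_near gR pU (@filterT _ _ (nbhs_filter w)) e0).
  by exists N => i /NP; exact: joined_sym.
have Bw : B w = h.
  apply/subr0_eq/eqP; rewrite -normr_le0; apply/ler_addgt0Pr => e e0; rewrite add0r.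
  have [N NP] := near_w e e0; rewrite -(uh N); exact: joined_height (NP N (leqnn N)).
exists w; split=> // e e0.
have C0 : 0 < Cu * expR Au by rewrite mulr_gt0 ?expR_gt0.
pose e' := Num.min 1 (e / (Cu * expR Au)).
have e'0 : 0 < e' by rewrite lt_min ltr01 divr_gt0.
have [N NP] := near_w e' e'0; exists N => i Ni.
have := joined_project h (NP i Ni); rewrite uh Bw !subrr !phi0 normr0 add0r.
apply: joined_le.
have Au0 : 0 < Au by exact: lt_le_trans auAu.
apply: (@le_trans _ _ (Cu * expR Au * e')).
  rewrite ler_wpM2r ?(ltW e'0)// ler_wpM2l ?(ltW Cu0)// ler_expR -[leRHS]mulr1 ler_pM2l//.
  by rewrite ge_min lexx.
by rewrite mulrC -ler_pdivlMr// ge_min lexx orbT.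
Qed.

Lemma level_eq0 h y z : (forall e : R, 0 < e -> level_joined h y z e) -> y = z.
Proof. by move=> yz; apply: (joined_eq0 gR hM pU) => e /yz; apply: joined_sub. Qed.

Section sigma.
Variables (x : M) (sigma : M -> U).
Hypothesis sP : leaf_lift Wu x pM sigma.
Hypothesis sub_trans : forall q, exists2 N, nbhs q N &
  forall z z' : M, N z -> N z' -> trans Wu q z = trans Wu q z' ->
    trans Wcu q z = trans Wcu q z'.

(** Induction on the chain of plaques. Along a straight segment of one plaque the height of the lift
    is locally constant, because [H] vanishes on each local leaf of [Wu]. *)
Lemma sigma_height (y : M) : leaf Wu x y -> B (sigma y) = B (sigma x).
Proof.
elim=> // q y' z xy IH qy qz tt; rewrite -IH.
have [a1 t1] := fdom_cube qy; have [a2 _] := fdom_cube qz.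
set b := trans Wu q y' in t1 tt.
pose s (t : R) := along Wu q y' + t *: (along Wu q z - along Wu q y').
have sd t : sderiv s t (along Wu q z - along Wu q y').
  by rewrite -[X in sderiv _ _ X]add0r; apply: sderivD; [exact: sderiv_cst|exact: sderiv_scalel].
pose c (t : R) := plaque Wu q (s t) b.
have s1 t : 0 <= t <= 1 -> ball 0 1 (s t).
  move=> /andP[t0 t1']; apply/ball01.
  have -> : s t = (1 - t) *: along Wu q y' + t *: along Wu q z by rewrite /s; zmod.
  move: a1 a2 => /ball01 a1 /ball01 a2.
  rewrite (le_lt_trans (ler_normD _ _))// !normrZ !ger0_norm ?subr_ge0//.
  have [->|tn] := eqVneq t 0; first by rewrite subr0 mul1r mul0r addr0.
  have tp : 0 < t by rewrite lt_neqAle eq_sym tn.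
  have : t * `|along Wu q z| < t * 1 by rewrite ltr_pM2l.
  have : (1 - t) * `|along Wu q y'| <= (1 - t) * 1 by rewrite ler_wpM2l ?subr_ge0// ltW.
  by lra.
have c0 : c 0 = y' by rewrite /c /s scale0r addr0 fchartK.
have c1 : c 1 = z by rewrite /c /s scale1r addrC subrK tt fchartK.
have lc t : 0 <= t <= 1 -> {for t, continuous (c : R -> leaf_space Wu)}.
  by move=> /s1 s1'; apply: lcont_plaque; [exact: s1'|exact: t1|exact: sderiv_continuous (sd t)].
have cx t : 0 <= t <= 1 -> leaf Wu x (c t).
  move=> t01; have /andP[t0 t1'] := t01.
  apply: (leaf_lcont t0 (c := c)); last by rewrite c0.
  by move=> u /andP[u0 ut]; apply: lc; rewrite u0 (le_trans ut).
have := @loc_const R R (fun t => B (sigma (c t))) 0 1.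
have I1 : 0 <= (1 : R) <= 1 by rewrite lexx ler01.
move=> /(_ _ 1 I1); rewrite c0 c1; apply=> t t01.
have [pst sct] := sP (cx t t01).
have scc : {for t, continuous (fun t => sigma (c t))}.
  by apply: (@continuous_comp R (leaf_space Wu) U c sigma); [exact: lc|exact: sct].
have E1 := cont_nbhs scc (BH (sigma (c t))).
have [_ _ _ H4] := HP (c t).
have E2 := cont_nbhs (lcont_sub sub_trans (lc t t01)) H4.
have E3 := lcont_trans (fdom_center Wu (c t)) (lc t t01).
have [d d0 dP] := nbhs_exR (filterI E1 (filterI E2 E3)).
exists d => // u u01 ud; have [e1 [e2 e3]] := dP u ud.
have pE (w : M) : leaf Wu x w -> p (sigma w) = w by move=> /sP[].
apply/subr0_eq; rewrite e1 !pE; [exact: e2.2|exact: cx|exact: cx].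
Qed.

(** A curve of constant height projects into a leaf of [Wu], since [H] vanishes only on the local
    leaf; by uniqueness of lifts it coincides with its lift through [sigma]. *)
Lemma level_sigma (y : M) h L : leaf Wu x y -> B (sigma y) = h -> forall z,
  level_joined h (sigma y) z L -> leaf Wu x (p z) /\ z = sigma (p z).
Proof.
move=> xy yh z [c [ln [cl cP c0 c1 _]]].
have lc t : {for t, continuous ((fun t => p (c t)) : R -> leaf_space Wu)}.
  refine (proj2 (@lcontP R n r M A k l.+1 0 Wu R (fun t => p (c t) : M) t (p (c t)) (fdom_center Wu (p (c t)))) _).
  split; first by apply: (@continuous_comp R U M c pM); [exact: cl.1|exact: cover_map_continuous].
  have [lc' _] := cover_arc pU cl.
  have lcu : {for t, continuous ((fun t => p (c t)) : R -> leaf_space Wcu)} := @lc' t.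
  have [_ _ _ H4] := HP (p (c t)).
  have E1 := cont_nbhs (@cl.1 t) (BH (c t)); have E2 := cont_nbhs lcu H4.
  by apply: filterS2 E1 E2 => s e1 e2; apply/e2; rewrite -e1 !cP subrr.
have [ps _] := sP xy.
have cx t : 0 <= t -> leaf Wu x (p (c t)).
  move=> t0; apply: (leaf_lcont t0 (c := fun t => p (c t) : M)) => //.
  by rewrite c0 [p _]ps.
have I1 : 0 <= (1 : R) <= 1 by rewrite lexx ler01.
split; first by rewrite -c1; exact: cx.
rewrite -c1; apply: (@lift_unique R U _ p (leaf Wcu x0) pU c (fun t => sigma (p (c t))) 0 1 0) => //.
- by move=> t _; exact: cl.1.
- move=> t /andP[t0 _]; have [_ sc] := sP (cx t t0).
  by apply: (@continuous_comp R (leaf_space Wu) U (fun t => p (c t)) sigma); [exact: lc|exact: sc].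
- by move=> t /andP[t0 _]; have [] := sP (cx t t0).
- by rewrite lexx ler01.
- by rewrite c0 [p _]ps.
Qed.

End sigma.
End levels.

(** * Hyperbolicity and the boundary *)

(* a, b, c, e, s, t are the heights at which the six pairs among four points
   merge. *)
Lemma four_point {R : realType} (a b c e s t K : R) :
  Num.min a c - K <= s -> Num.min e b - K <= s ->
  Num.min a e - K <= t -> Num.min c b - K <= t ->
  a + b <= s + t + 2 * K \/ c + e <= s + t + 2 * K.
Proof.
move=> a1 a2 a3 a4; have [h|h] := leP (a + b) (s + t + 2 * K); first by left.
right; move: a1 a2 a3 a4.
have [ac|ac] := leP a c; have [eb|eb] := leP e b;
  have [ae|ae] := leP a e; have [cb|cb] := leP c b; lra.
Qed.

Section hyperbolicity.
Context {R : realType} {U : Type}.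
Variables (d : U -> U -> R) (B : U -> R) (phi : R -> U -> U)
  (J : R -> U -> U -> R -> Prop) (Cu au Au : R).
Hypotheses (Cu1 : 1 <= Cu) (au0 : 0 < au).
Hypotheses (dsym : forall y z, d y z = d z y)
  (dtri : forall x y z, d x z <= d x y + d y z)
  (dB : forall y z, `|B z - B y| <= d y z).
Hypotheses (phi0 : forall y, phi 0 y = y)
  (phiD : forall s t y, phi (s + t) y = phi s (phi t y))
  (phiB : forall t y, B (phi t y) = B y + t)
  (phid : forall s t y, d (phi s y) (phi t y) <= `|s - t|).
Hypotheses (Jd : forall h y z L, J h y z L -> d y z <= L)
  (Jle : forall h y z L L', L <= L' -> J h y z L -> J h y z L')
  (Jsym : forall h y z L, J h y z L -> J h z y L)
  (Jtrans : forall h x y z L L', J h x y L -> J h y z L' -> J h x z (L + L'))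
  (Jex : forall y z, B y = B z -> exists L, J (B z) y z L)
  (Jflow : forall h t y z L, J h y z L -> J (h + t) (phi t y) (phi t z)
     (Cu * expR ((if 0 <= t then Au else au) * t) * L))
  (Jproj : forall h y z L, d y z < L -> L <= B y + B z - 2 * h ->
     J h (phi (h - B y) y) (phi (h - B z) z)
       (2 * Cu / au * expR (- (au * ((B y + B z - 2 * h - L) / 2)))))
  (Jeq0 : forall h y z, (forall e : R, 0 < e -> J h y z e) -> y = z)
  (Jcomplete : forall (u : nat -> U) h, (forall i, B (u i) = h) ->
     (forall e : R, 0 < e -> exists N, forall i j, (N <= i)%N -> (N <= j)%N ->
       J h (u i) (u j) e) ->
     exists w, B w = h /\ forall e : R, 0 < e -> exists N, forall i, (N <= i)%N ->
       J h (u i) w e).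
Implicit Types (x y z w : U) (h t s L : R).

Let Cu0 : 0 < Cu. Proof. exact: lt_le_trans Cu1. Qed.

(** The drop in height that contracts a length [c] to at most 1, or 0 if none is needed. *)
Definition descent (c : R) := Num.max 0 (ln c / au).

Lemma descent_ge0 c : 0 <= descent c. Proof. by rewrite /descent le_max lexx. Qed.

Lemma descentP c s : 0 < c -> descent c <= s -> c * expR (- (au * s)) <= 1.
Proof.
move=> c0 cs; rewrite expRN ler_pdivrMr ?expR_gt0// mul1r -[leLHS]lnK ?posrE// ler_expR.
by rewrite mulrC -ler_pdivrMr//; apply: le_trans cs; rewrite /descent le_max lexx orbT.
Qed.

Lemma descent_le c e s : 0 < c -> 0 < e -> descent (c / e) <= s ->
  c * expR (- (au * s)) <= e.
Proof.
move=> c0 e0 /(descentP (divr_gt0 c0 e0)).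
by rewrite mulrAC ler_pdivrMr// mul1r.
Qed.

Definition proj h y := phi (h - B y) y.

Lemma proj_height h y : B (proj h y) = h.
Proof. by rewrite phiB addrC subrK. Qed.

Lemma phi_proj t h y : phi t (proj h y) = proj (h + t) y.
Proof. by rewrite /proj -phiD; congr phi; ring. Qed.

Lemma phiE t y : phi t y = proj (B y + t) y.
Proof. by rewrite /proj addrAC subrr add0r. Qed.

Lemma proj_phi h t y : proj h (phi t y) = proj h y.
Proof. by rewrite /proj -phiD phiB; congr phi; ring. Qed.

Lemma proj_lip h h' y : d (proj h y) (proj h' y) <= `|h - h'|.
Proof. by apply: le_trans (phid _ _ _) _; rewrite opprB addrA subrK. Qed.

Lemma proj_id y : proj (B y) y = y.
Proof. by rewrite /proj subrr phi0. Qed.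

Lemma proj_dist h y : d y (proj h y) <= `|B y - h|.
Proof. by rewrite /proj -{1}(phi0 y) (le_trans (phid _ _ _))// sub0r opprB. Qed.

(** The bounds by [B y] and [B z] keep the set bounded above and make both points descend to the
    level [h]. *)
Definition close y z := [set h | [/\ h <= B y, h <= B z & J h (proj h y) (proj h z) 1]].

Lemma down h h' y z L : h' <= h -> J h (proj h y) (proj h z) L ->
  J h' (proj h' y) (proj h' z) (Cu * expR (- (au * (h - h'))) * L).
Proof.
move=> hh /(@Jflow h (h' - h)); rewrite !phi_proj addrC subrK.
have -> : (if 0 <= h' - h then Au else au) * (h' - h) = - (au * (h - h')).
  case: ifP => [h0|_]; last by ring.
  have -> : h = h' by apply/eqP; rewrite eq_le hh andbT -subr_ge0.
  by rewrite subrr !mulr0 oppr0.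
by [].
Qed.

Lemma close_nonempty y z : exists h, close y z h.
Proof.
pose m := Num.min (B y) (B z).
have [L JL] : exists L, J m (proj m y) (proj m z) L.
  have [|L] := Jex (y := proj m y) (z := proj m z); first by rewrite !proj_height.
  by rewrite proj_height; exists L.
pose L' := Num.max L 1; have L'0 : 0 < Cu * L' by rewrite mulr_gt0// lt_max ltr01 orbT.
have {}JL := Jle (_ : L <= L') JL; have {}JL := JL ltac:(by rewrite le_max lexx).
exists (m - descent (Cu * L')); split.
- by rewrite (le_trans (_ : _ <= m)) ?gerBl ?descent_ge0// ge_min lexx.
- by rewrite (le_trans (_ : _ <= m)) ?gerBl ?descent_ge0// ge_min lexx orbT.
apply: Jle (down (_ : m - descent (Cu * L') <= m) JL); last by rewrite gerBl descent_ge0.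
rewrite mulrAC; apply: descentP => //; lra.
Qed.

Definition merge y z := sup (close y z).

(** Both are drops down to length 1: [K0] from the constant of [Jproj], and [K1] from two curves of
    length [Cu] put end to end, with the further factor [Cu] of [down]. *)
Let K0 := descent (2 * Cu / au).
Let K1 := descent (2 * Cu * Cu).

Lemma merge_sup y z : has_sup (close y z).
Proof.
by split; [exact: close_nonempty|exists (B y) => h []].
Qed.

Lemma merge_adherent y z (e : R) : 0 < e -> exists2 h, close y z h & merge y z - e < h.
Proof. by move=> e0; exact: sup_adherent e0 (merge_sup y z). Qed.

Lemma merge_ge y z h : close y z h -> h <= merge y z.
Proof. by move=> ch; apply: ub_le_sup ch; case: (merge_sup y z). Qed.

Lemma merge_sym y z : merge y z = merge z y.
Proof.
suff H u v : merge u v <= merge v u by apply/eqP; rewrite eq_le !H.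
apply: ge_sup; first exact: close_nonempty.
by move=> h [hu hv Jh]; apply: merge_ge; split=> //; exact: Jsym.
Qed.

(** Descend from [y] almost to the merging level, cross there at cost at most 1, and climb to
    [z]. *)
Lemma dist_le_merge y z : d y z <= B y + B z - 2 * merge y z + 1.
Proof.
apply/ler_addgt0Pr => e e0; have [h [hy hz Jh] mh] := merge_adherent y z (half_gt0 e0).
have H1 := proj_dist h y; have H2 := proj_dist h z.
rewrite ger0_norm ?subr_ge0// in H1; rewrite ger0_norm ?subr_ge0// in H2.
have := dtri y (proj h y) z; have := dtri (proj h y) (proj h z) z.
have := Jd Jh; rewrite (dsym (proj h z) z); lra.
Qed.

Lemma merge_le_dist y z : B y + B z - 2 * merge y z <= d y z + 2 * K0.
Proof.
(* This [h] makes the exponent in [Jproj] equal to [au * K0], so the projections to it are at level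
   distance at most 1. *)
apply/ler_addgt0Pr => e e0; pose L := d y z + e; pose h := (B y + B z - L) / 2 - K0.
have dL : d y z < L by rewrite ltrDl.
have k0 : 0 <= K0 := descent_ge0 _.
have := dB y z; rewrite ler_norml => /andP[b1 b2].
have Jh := @Jproj h y z L dL; have {}Jh := Jh ltac:(rewrite /h; lra).
have hK : (B y + B z - 2 * h - L) / 2 = K0 by rewrite /h; lra.
rewrite hK in Jh.
have ch : close y z h.
  split; [rewrite /h; lra|rewrite /h; lra|].
  by apply: Jle Jh; apply: descentP => //; rewrite divr_gt0// mulr_gt0.
have := merge_ge ch; rewrite /h /L; lra.
Qed.

(** At the lower of the two merging levels the outer points are within [2 * Cu], and a further drop
    of [K1] brings them within 1. *)
Lemma merge_ultra x y z : Num.min (merge x y) (merge y z) - K1 <= merge x z.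
Proof.
apply/ler_addgt0Pr => e e0.
have [h1 [h1x h1y J1] m1] := merge_adherent x y e0.
have [h2 [h2y h2z J2] m2] := merge_adherent y z e0.
pose h := Num.min h1 h2.
have hh1 : h <= h1 by rewrite ge_min lexx.
have hh2 : h <= h2 by rewrite ge_min lexx orbT.
have bd h' : h <= h' -> Cu * expR (- (au * (h' - h))) * 1 <= Cu.
  move=> hh; rewrite mulr1 -[leRHS]mulr1 ler_wpM2l ?(ltW Cu0)// -(@expR0 R) ler_expR oppr_le0.
  by rewrite mulr_ge0 ?(ltW au0)// subr_ge0.
have {}J1 := Jle (bd _ hh1) (down hh1 J1); have {}J2 := Jle (bd _ hh2) (down hh2 J2).
have J3 := Jtrans J1 J2.
have k1 : 0 <= K1 := descent_ge0 _.
have hK : h - K1 <= h by lra.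
have ch : close x z (h - K1).
  split; [lra|lra|]; apply: Jle (down hK J3).
  have -> : Cu * expR (- (au * (h - (h - K1)))) * (Cu + Cu) = 2 * Cu * Cu * expR (- (au * (h - (h - K1)))) by ring.
  by apply: descentP; [rewrite !mulr_gt0|rewrite subKr].
have := merge_ge ch.
have : Num.min (merge x y) (merge y z) - e < h.
  rewrite /h lt_min; apply/andP; split.
    apply: le_lt_trans m1; rewrite lerD2r ge_min lexx//.
  by apply: le_lt_trans m2; rewrite lerD2r ge_min lexx orbT.
by lra.
Qed.

(** In four-point form the inequality compares two sums of two distances. The heights cancel, two
    distances are bounded above with error 1 and two below with error [2 * K0], and the ultrametric
    inequality costs [4 * K1]; the constant leaves some room. *)
Lemma hyperbolic : gromov_hyperbolic d (2 * K1 + 3 * (1 + 2 * K0)).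
Proof.
move=> x y z w; rewrite /gromov_product.
have k0 : 0 <= K0 := descent_ge0 _.
have u1 := dist_le_merge x y; have u2 := dist_le_merge y z; have u3 := dist_le_merge x z.
have u4 := dist_le_merge x w; have u5 := dist_le_merge y w; have u6 := dist_le_merge z w.
have l1 := merge_le_dist x y; have l2 := merge_le_dist y z; have l3 := merge_le_dist x z.
have l4 := merge_le_dist x w; have l5 := merge_le_dist y w; have l6 := merge_le_dist z w.
have a1 := merge_ultra x y z; have a2 := merge_ultra x w z.
have a3 := merge_ultra y x w; have a4 := merge_ultra y z w.
rewrite (merge_sym w z) in a2; rewrite (merge_sym y x) in a3.
rewrite lerBlDr ge_min; apply/orP.
suff : merge x y + merge z w <= merge x z + merge y w + 2 * K1 \/
       merge y z + merge x w <= merge x z + merge y w + 2 * K1.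
  by case=> h; [left|right]; lra.
exact: four_point a1 a2 a3 a4.
Qed.

Lemma forward_geodesic z : geodesic_ray d (fun t => phi t z).
Proof.
move=> s t _ _; apply/eqP; rewrite eq_le phid/=.
by have := dB (phi s z) (phi t z); rewrite !phiB distrC; congr (`|_| <= _); ring.
Qed.

Lemma backward_geodesic z : geodesic_ray d (fun t => phi (- t) z).
Proof.
move=> s t _ _; apply/eqP; rewrite eq_le; apply/andP; split.
  by rewrite (le_trans (phid _ _ _))// opprK addrC distrC.
by have := dB (phi (- s) z) (phi (- t) z); rewrite !phiB; congr (`|_| <= _); ring.
Qed.

Lemma asymptotic_sym c c' : asymptotic d c c' -> asymptotic d c' c.
Proof. by move=> [K HK]; exists K => t t0; rewrite dsym; exact: HK. Qed.

Lemma asymptotic_trans c c' c'' : asymptotic d c c' -> asymptotic d c' c'' -> asymptotic d c c''.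
Proof.
move=> [K HK] [K' HK']; exists (K + K') => t t0.
by apply: le_trans (dtri _ (c' t) _) _; rewrite lerD// ?HK ?HK'.
Qed.

Lemma ray_class_eq c c' : asymptotic d c c' -> ray_class d c = ray_class d c'.
Proof.
move=> cc'; apply/seteqP; split => e [eg ce]; split=> //.
  exact: asymptotic_trans (asymptotic_sym cc') ce.
exact: asymptotic_trans cc' ce.
Qed.

Lemma ray_class_inj c c' : geodesic_ray d c' -> ray_class d c = ray_class d c' -> asymptotic d c c'.
Proof.
move=> gc' E; have : ray_class d c' c'.
  split=> //; exists 0 => t t0; rewrite (gc' t t t0 t0) subrr normr0//.
by rewrite -E => -[].
Qed.

(** Level curves contract downwards up to the factor [Cu], so besides their length only the initial
    difference of heights remains. *)
Lemma backward_asymptotic y z : asymptotic d (fun t => phi (- t) y) (fun t => phi (- t) z).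
Proof.
have [|L JL] := Jex (y := proj (B z) y) (z := proj (B z) z); first by rewrite !proj_height.
rewrite proj_height in JL.
have L0 : 0 <= L by apply: le_trans (Jd JL); apply: le_trans (dB _ _).
exists (`|B y - B z| + Cu * L) => t t0; rewrite !phiE.
apply: le_trans (dtri _ (proj (B z - t) y) _) _; apply: lerD.
  by apply: le_trans (proj_lip _ _ _) _; rewrite opprB addrA subrK.
have h1 : B z - t <= B z by rewrite gerBl.
apply: le_trans (Jd (down h1 JL)) _; rewrite ler_wpM2r// -[leRHS]mulr1 ler_wpM2l ?(ltW Cu0)//.
rewrite -(@expR0 R) ler_expR oppr_le0 mulr_ge0 ?(ltW au0)//; lra.
Qed.

Lemma forward_backward y z : ~ asymptotic d (fun t => phi t y) (fun t => phi (- t) z).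
Proof.
move=> [K HK]; pose t := `|K| + `|B y| + `|B z| + 1.
have t0 : 0 <= t by rewrite !addr_ge0.
have := le_trans (dB _ _) (HK t t0); rewrite !phiB ler_norml => /andP[h _].
have := ler_norm K; have := ler_norm (B z); have := ler_norm (- B y); rewrite normrN.
have := normr_ge0 K; have := normr_ge0 (B y); have := normr_ge0 (B z).
by move: h; rewrite /t; lra.
Qed.

(** At a late time the orbits are less than [K + 1] apart; projecting that far down again contracts
    this to a level distance below any [e]. *)
Lemma forward_inj y z : B y = B z -> asymptotic d (fun t => phi t y) (fun t => phi t z) -> y = z.
Proof.
move=> yz [K HK]; apply: (Jeq0 (h := B y)) => e e0.
pose c := 2 * Cu / au; have c0 : 0 < c by rewrite divr_gt0// mulr_gt0.
have k0 := descent_ge0 (c / e).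
pose t := descent (c / e) + (`|K| + 1).
have t0 : 0 <= t by rewrite !addr_ge0.
have nK := ler_norm K; have nK0 := normr_ge0 K.
have dK : d (phi t y) (phi t z) < K + 1 by have := HK t t0; lra.
have := Jproj (h := B y) dK; rewrite !phiB.
have E w : phi (B y - (B w + t)) (phi t w) = proj (B y) w.
  by rewrite -(proj_phi _ t) /proj phiB.
have Ez : proj (B y) z = z by rewrite yz proj_id.
rewrite !E proj_id Ez => J1; have {}J1 := J1 ltac:(rewrite -yz /t; lra).
apply: Jle J1; apply: descent_le => //.
by rewrite -yz /t; lra.
Qed.

(** * Geodesic rays *)

Section ray.
Variable c : R -> U.
Hypothesis gc : geodesic_ray d c.

Lemma ray_height s t : 0 <= s -> 0 <= t -> `|B (c t) - B (c s)| <= `|s - t|.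
Proof. by move=> s0 t0; rewrite -(gc s0 t0). Qed.

Lemma ray_forward m h0 : (forall t, 0 <= t -> m <= B (c t) - t) ->
  exists w, B w = h0 /\ asymptotic d (fun t => phi t w) c.
Proof.
move=> bm; pose C := 2 * Cu / au; have C0 : 0 < C by rewrite divr_gt0// mulr_gt0.
(* The shift [1 / 2] is half of the unit added to [t - s] to obtain a length strictly above the
   distance. *)
have step s t h : 0 <= s -> s <= t -> h <= s + m - 1 / 2 ->
    J h (proj h (c s)) (proj h (c t)) (C * expR (- (au * (s + m - 1 / 2 - h)))).
  move=> s0 st hs; have t0 := le_trans s0 st.
  have b1 := bm s s0; have b2 := bm t t0.
  have dL : d (c s) (c t) < t - s + 1.
    by rewrite gc// distrC ger0_norm ?subr_ge0//; lra.
  have J1 := Jproj (h := h) dL; have {}J1 := J1 ltac:(lra).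
  apply: Jle J1; rewrite ler_wpM2l ?(ltW C0)// ler_expR lerN2 ler_pM2l//; lra.
pose s0 := `|h0 - m| + 1; have s00 : 0 <= s0 by rewrite addr_ge0.
have hs0 : h0 <= s0 + m - 1 / 2 by have := ler_norm (h0 - m); rewrite /s0; lra.
pose u (i : nat) := proj h0 (c (s0 + i%:R)).
have uC (e : R) : 0 < e -> exists N, forall i j, (N <= i)%N -> (N <= j)%N -> J h0 (u i) (u j) e.
  move=> e0; have ce0 : 0 < C / e by rewrite divr_gt0.
  exists (Num.bound (descent (C / e))) => i j Ni Nj.
  wlog ij : i j Ni Nj / (i <= j)%N.
    by move=> W; case/orP: (leq_total i j) => ij; [exact: W|apply: Jsym; exact: W].
  have st : s0 + i%:R <= s0 + j%:R by rewrite lerD2l ler_nat.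
  have si0 : 0 <= s0 + i%:R by rewrite addr_ge0.
  have i0 : (0 : R) <= i%:R by [].
  have J1 := step _ _ h0 si0 st; have {}J1 := J1 ltac:(lra).
  apply: Jle J1; have Nd := archi_boundP (descent_ge0 (C / e)).
  have Ni' : (Num.bound (descent (C / e)))%:R <= i%:R :> R by rewrite ler_nat.
  have h : descent (C / e) <= s0 + i%:R + m - 1 / 2 - h0 by lra.
  exact: descent_le.
have [|w [wh wP]] := Jcomplete (u := u) (h := h0) _ uC; first by move=> i; exact: proj_height.
exists w; split=> //; apply: asymptotic_sym.
(* The first two terms bound the vertical distance from [c s] to the level [h], the terms [C + 1] a
   path inside that level to the orbit of [w], and the last one the shift of time along this
   orbit. *)
exists (`|B (c 0) - m| + 1 + (C + 1) + `|m - 1 / 2 - h0|) => s s0'.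
pose h := s + m - 1 / 2.
pose a := Cu * expR ((if 0 <= h - h0 then Au else au) * (h - h0)).
have a0 : 0 < a by rewrite mulr_gt0 ?expR_gt0.
(* Flowing from [h0] to [h] multiplies level lengths by at most [a], so the convergence in level
   [h0] is asked to precision [1 / a]; the error in level [h] is then at most 1. *)
have [|N NP] := wP a^-1; first by rewrite invr_gt0.
pose i := maxn N (Num.bound s).
have J2 : J h (proj h (c (s0 + i%:R))) (phi (h - h0) w) 1.
  have := Jflow (h - h0) (NP i (leq_maxl _ _)); rewrite phi_proj [h0 + _]addrC subrK -/a.
  by rewrite mulfV ?gt_eqF.
have si : s <= s0 + i%:R.
  have h1 := archi_boundP s0'; have h2 : (Num.bound s)%:R <= i%:R :> R by rewrite ler_nat leq_maxr.
  by lra.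
have J1 := step s _ h s0' si (lexx _); rewrite subrr mulr0 oppr0 expR0 mulr1 in J1.
have D1 := Jd (Jtrans J1 J2).
have D2 := proj_dist h (c s).
have D3 := phid (h - h0) s w.
have b1 := bm s s0'.
have b2 := ray_height (lexx 0) s0'.
have E : h - h0 - s = m - 1 / 2 - h0 by rewrite /h; ring.
rewrite E in D3.
have D4 : `|B (c s) - h| <= `|B (c 0) - m| + 1.
  move: b2; rewrite sub0r normrN (ger0_norm s0') ler_norml => /andP[_ b2].
  rewrite ger0_norm /h; last by lra.
  by have := ler_norm (B (c 0) - m); lra.
have := dtri (c s) (proj h (c s)) (phi s w); have := dtri (proj h (c s)) (phi (h - h0) w) (phi s w).
by lra.
Qed.

(** Up to constants a geodesic ray cannot descend again after rising, so a ray whose height falls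
    behind time without bound descends at unit speed from the start. *)
Lemma ray_backward : (forall m, exists2 t, 0 <= t & B (c t) - t < m) ->
  asymptotic d (fun t => phi (- t) (c 0)) c.
Proof.
move=> unb; have k0 : 0 <= K0 := descent_ge0 _; have k1 : 0 <= K1 := descent_ge0 _.
pose E := 1 + 2 * K0 + 2 * K1.
exists (2 * (E + K0 + 1) + 1) => t t0.
(* [B (c t) - t] is nonincreasing, so [T] comes after [t]. In [merge_ultra] for the times 0, t and T
   the minimum cannot be the merging level of the first pair, by [bT]; when it is that of the second
   pair, [bt] follows. *)
have [T T0 bT] := unb (B (c t) - t - E).
have tT : t <= T.
  rewrite leNgt; apply/negP => Tt; have := ray_height t0 T0.
  by rewrite [`|t - T|]gtr0_norm ?subr_gt0// ler_norml => /andP[h _]; rewrite /E in bT; lra.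
have d1 : d (c 0) (c t) = t by rewrite gc// sub0r normrN ger0_norm.
have d2 : d (c 0) (c T) = T by rewrite gc// sub0r normrN ger0_norm.
have d3 : d (c t) (c T) = T - t by rewrite gc// distrC ger0_norm ?subr_ge0.
have m1 := merge_le_dist (c 0) (c t); have m2 := dist_le_merge (c 0) (c T).
have m3 := merge_le_dist (c t) (c T); rewrite d1 in m1; rewrite d2 in m2; rewrite d3 in m3.
have bt : B (c t) + t <= B (c 0) + E.
  have := merge_ultra (c 0) (c t) (c T); rewrite /E in bT *.
  by have [] := leP (merge (c 0) (c t)) (merge (c t) (c T)) => ? ?; lra.
have b2 := ray_height (lexx 0) t0.
move: b2; rewrite sub0r normrN (ger0_norm t0) ler_norml => /andP[b2 _].
have [h [h1 h2 Jh] mh] := merge_adherent (c 0) (c t) (@ltr01 R).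
have D1 := proj_lip (B (c 0) + - t) h (c 0); rewrite -phiE in D1.
have D2 := Jd Jh; have D3 := proj_dist h (c t).
rewrite [`|B (c t) - h|]ger0_norm ?subr_ge0// in D3.
have D4 : `|B (c 0) + - t - h| <= E + K0 + 1.
  by rewrite ler_norml; apply/andP; split; rewrite /E in bt *; lra.
have := dtri (phi (- t) (c 0)) (proj h (c 0)) (c t).
have := dtri (proj h (c 0)) (proj h (c t)) (c t); rewrite (dsym (proj h (c t))).
by lra.
Qed.

End ray.

Lemma boundary (T : Type) (Lf : set T) (sigma : T -> U) (h0 : R) (z0 : U) :
  (forall y : T, Lf y -> B (sigma y) = h0) ->
  (forall z, B z = h0 -> exists2 y : T, Lf y & sigma y = z) ->
  (forall y y' : T, Lf y -> Lf y' -> sigma y = sigma y' -> y = y') ->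
  exists star : set (R -> U),
    (forall z, ray_class d (fun t => phi (- t) z) = star) /\
    set_bij Lf (gromov_boundary d `\ star) (fun y : T => ray_class d (fun t => phi t (sigma y))).
Proof.
move=> sh ssurj sinj; exists (ray_class d (fun t => phi (- t) z0)); split.
  by move=> z; apply: ray_class_eq; exact: backward_asymptotic.
split.
- move=> y Ly; split.
    by exists (fun t => phi t (sigma y)) => //; exact: forward_geodesic.
  by move=> /(ray_class_inj (backward_geodesic z0)); exact: forward_backward.
- move=> y y'; rewrite !inE => Ly Ly' E; apply: sinj => //; apply: forward_inj.
    by rewrite !sh.
  exact: ray_class_inj (forward_geodesic (sigma y')) E.
- move=> _ [[c gc <-] cs].
  have [bd|nb] := pselect (exists m, forall t, 0 <= t -> m <= B (c t) - t).
    have [m bm] := bd; have [w [wh wc]] := ray_forward gc h0 bm.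
    have [y Ly yw] := ssurj w wh; exists y => //.
    by rewrite yw; exact: ray_class_eq.
  exfalso; apply: cs => /=; apply: ray_class_eq; apply: asymptotic_sym.
  apply: asymptotic_trans (backward_asymptotic z0 (c 0)) _; apply: ray_backward => // m.
  apply: contrapT => H; apply: nb; exists m => t t0; rewrite leNgt; apply/negP => ht.
  by apply: H; exists t.
Qed.

End hyperbolicity.

Theorem theorem1p1 (R : realType) :
  exists delta : R -> R -> R -> R,
  forall (Cu au Au : R) (r n ku l : nat) (M : topologicalType)
    (A : atlas R n r.+1 M) (g : M -> 'M[R]_n)
    (f : R -> M -> M) (X : M -> 'rV[R]_n)
    (Wcu : foliation A ku.+1 l r) (Eu : M -> set 'rV[R]_n)
    (Wu : foliation A ku l.+1 1),
  1 <= Cu -> 0 < au -> au <= Au -> (3 <= r)%N ->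
  closed_space M ->
  riemannian_metric A r g ->
  flow_of_class A r f X ->
  (forall x, tnorm g x (X x) = 1) ->
  weak_expanding g f X Wcu Eu Cu au Au ->
  (forall x, tangent_space Wu x = Eu x) ->
  Ck_subfoliation Wu Wcu ->
  forall (x : M) (U : topologicalType) (p : U -> leaf_space Wcu),
  @universal_cover R U (leaf_space Wcu) p (leaf Wcu x) ->
  let d := cover_dist A g p in
  gromov_hyperbolic d (delta Cu au Au) /\
  forall (phi : R -> U -> U) (sigma : M -> U),
  flow_lift p f phi -> leaf_lift Wu x p sigma ->
  [/\ forall z, geodesic_ray d (fun t => phi t z),
      forall z, geodesic_ray d (fun t => phi (- t) z) &
      exists star : set (R -> U),
        (forall z, ray_class d (fun t => phi (- t) z) = star) /\
        set_bij (leaf Wu x) (gromov_boundary d `\ star)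
          (fun y => ray_class d (fun t => phi t (sigma y)))].

Proof.
exists (fun Cu au _ => 2 * descent au (2 * Cu * Cu) + 3 * (1 + 2 * descent au (2 * Cu / au))).
move=> Cu au Au [|r] n ku l M A g f X Wcu Eu Wu Cu1 au0 auAu r3; first by [].
move=> [cM hM] gR hf X1
  [EuS [cuE uX Eu_inv _ Eu_exp]] uE [sub_trans sub_level] x U p pU d.
have Eu0 y : Eu y 0 by case: (EuS y).
have FX y : tangent_space Wcu y (X y).
  by rewrite cuE; exists 0 => //; exists (X y); rewrite ?add0r//; exists 1; rewrite ?scale1r.
have /choice[Otau tau_spec] : forall q, exists z : set 'rV[R]_ku.+1 * ('rV[R]_ku.+1 -> R),
    let P := fun s => plaque Wcu q s (trans Wcu q q) in
    [/\ open z.1, z.1 (along Wcu q q),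
        forall s, z.1 s -> ball 0 1 s /\ fdom Wu q (P s),
        Ck r.+1 z.1 (z.2 : 'rV[R]_ku.+1 -> R^o) /\
          (forall s, z.1 s -> exists w, 'D_w (z.2 : 'rV[R]_ku.+1 -> R^o) s != 0) &
        forall s s', z.1 s -> z.1 s' ->
          (z.2 s = z.2 s' <-> trans Wu q (P s) = trans Wu q (P s'))].
  by move=> q; have [dom_tau [tau H]] := sub_level q; exists (dom_tau, tau).
have [H HP] := height_exists hf hM cuE uE Eu0 Eu_inv sub_trans tau_spec.
have [B BH] := height_global gR HP pU.
have lfc := leaf_flow_continuous hf hM FX.
have lfl (t : R) (y : leaf_space Wcu) : leaf Wcu x y -> leaf Wcu x (f t y) by exact: (@leaf_flow R n r M A f X hf hM ku.+1 l r Wcu FX x y t).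
have [phi Fphi] : exists phi, flow_lift (p : U -> M) f phi.
  exact: (@flow_lift_exists R U (leaf_space Wcu) p (leaf Wcu x) pU (f : R -> leaf_space Wcu -> leaf_space Wcu)
    (flow0 hf) lfc lfl).
have conn := cover_connected gR pU.
have pc := cover_map_continuous pU.
have dlt y z L : d y z < L -> joined A g (p : U -> M) setT y z L by exact: dist_joined.
have dle P y z L : joined A g (p : U -> M) P y z L -> d y z <= L by exact: joined_dist.
have dsym : forall y z, d y z = d z y by exact: dist_sym.
have dtri : forall x y z, d x z <= d x y + d y z by exact: dist_triangle.
have dB y z : `|B z - B y| <= d y z.
  apply/ler_addgt0Pr => e e0; apply: (joined_height gR X1 cuE uX HP pU BH (P := setT)).
  by apply: dlt; rewrite ltrDl.
pose J := level_joined g p B.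
have Jd h y z L : J h y z L -> d y z <= L by exact: dle.
have Jle h y z L L' : L <= L' -> J h y z L -> J h y z L' by exact: joined_le.
have Jsym h y z L : J h y z L -> J h z y L by exact: joined_sym.
have Jtrans h y z w L L' : J h y z L -> J h z w L' -> J h y w (L + L') by exact: joined_trans.
have Jeq0 h y z : (forall e : R, 0 < e -> J h y z e) -> y = z by exact: (level_eq0 gR hM pU).
(* Stated for an arbitrary lift of the flow: hyperbolicity applies it to the lift constructed above,
   the boundary to the given one. *)
have facts psi (Fpsi : flow_lift (p : U -> M) f psi) :
   [/\ forall y, psi 0 y = y, forall s t y, psi (s + t) y = psi s (psi t y),
       forall t y, B (psi t y) = B y + t,
       forall s t y, d (psi s y) (psi t y) <= `|s - t| &
   [/\ forall y z, B y = B z -> exists L, J (B z) y z L,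
       forall h t y z L, J h y z L -> J (h + t) (psi t y) (psi t z)
         (Cu * expR ((if 0 <= t then Au else au) * t) * L),
       forall h y z L, d y z < L -> L <= B y + B z - 2 * h ->
         J h (psi (h - B y) y) (psi (h - B z) z)
         (2 * Cu / au * expR (- (au * ((B y + B z - 2 * h - L) / 2)))) &
       forall (u : nat -> U) h, (forall i, B (u i) = h) ->
       (forall e : R, 0 < e -> exists N, forall i j, (N <= i)%N -> (N <= j)%N ->
         J h (u i) (u j) e) ->
       exists w, B w = h /\ forall e : R, 0 < e -> exists N, forall i, (N <= i)%N ->
         J h (u i) w e]].
  split.
  - by move=> y; case: Fpsi.
  - exact: (phiD hf pU Fpsi).
  - exact: (phi_height hf hM EuS HP pU BH Fpsi).
  - by move=> s t y; exact: (dle setT _ _ _ (phi_joined hf hM X1 Fpsi s t y)).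
  - split.
    + move=> y z yz; have [L yzL] := conn y z; eexists.
      have := joined_project gR hf hM X1 Cu1 au0 auAu EuS cuE uX Eu_inv Eu_exp HP pU BH Fpsi (B z) yzL.
      by rewrite yz subrr !(phi0 Fpsi); exact.
    + move=> h t y z L.
      exact: (level_flow gR hf hM X1 Cu1 EuS cuE uX Eu_inv Eu_exp HP pU BH Fpsi).
    + move=> h y z L /dlt yzL hL.
      exact: (projection_bound gR hf hM X1 Cu1 au0 EuS cuE uX Eu_inv Eu_exp HP pU BH Fpsi yzL hL).
    + exact: (level_complete gR hf hM cM X1 Cu1 au0 auAu EuS cuE uX Eu_inv Eu_exp HP pU BH Fpsi).
split.
  have [f0 fD fB fd [Jex Jfl Jproj Jcomp]] := facts phi Fphi.
  exact: (hyperbolic Cu1 au0 dsym dtri dB f0 fD fB fd Jd Jle Jsym Jtrans Jex Jfl Jproj).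
move=> psi sigma Fpsi sP.
have [f0 fD fB fd [Jex Jfl Jproj Jcomp]] := facts psi Fpsi.
split.
- exact: forward_geodesic.
- exact: backward_geodesic.
- have Lx : leaf Wu x x by exact: leaf_refl.
  have sh := sigma_height HP BH sP sub_trans.
  apply: (boundary Cu1 au0 dsym dtri dB f0 fD fB fd Jd Jle Jsym Jtrans Jex Jfl Jproj Jeq0 Jcomp (h0 := B (sigma x)) (sigma x)) => //.
  (* Points of equal height are joined inside their level, so [sigma] reaches the whole level set of
     [sigma x]. *)
  + move=> z zB; have [L JL] := Jex (sigma x) z (esym zB).
    rewrite zB in JL.
    have [xz zE] := level_sigma HP pU BH sP Lx erefl JL.
    by exists (p z).
  + move=> y y' Ly Ly' E; have [<- _] := sP y Ly; have [<- _] := sP y' Ly'.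
    by rewrite E.
Qed.
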